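(* Let $\mathcal{G}$ be a grounded degree sandwich monotone graph class. Then there exists a linear-time recognition algorithm for level-$\mathcal{G}$ weighted graphs if and only if both of the following conditions hold: (1) there exists a linear-time recognition algorithm for graphs in $\mathcal{G}$; (2) there exists an algorithm which checks in linear time whether a given edge ordering of any graph $G \in \mathcal{G}$ is a $\mathcal{G}$-safe edge elimination scheme of $G$.
   Context: All graphs are finite, simple and undirected; a graph class is a set of graphs; linear time means $O(|V|+|E|)$ for an input graph $G=(V,E)$ (together with its edge weights when weighted). A $k$-weighted graph is a pair $(G,\omega)$ where $\omega:E(G)\to\{1,\dots,k\}$ is surjective. For $1\le i\le k+1$, the $i$-th level graph of $(G,\omega)$ is obtained from $G$ by removing all edges $e$ with $\omega(e)<i$. For a graph class $\mathcal{G}$, a weighted graph is level-$\mathcal{G}$ if all its level graphs are in $\mathcal{G}$. For $G\in\mathcal{G}$, a set $F\subseteq E(G)$ (resp. an edge $e$) is $\mathcal{G}$-safe if $G-F\in\mathcal{G}$ (resp. $G-e\in\mathcal{G}$). $\mathcal{G}$ is grounded if for every $G\in\mathcal{G}$ the whole set $E(G)$ is $\mathcal{G}$-safe. For an edge ordering $\tau=(e_1,\dots,e_m)$ of $G$, let $G^i_\tau=G-\{e_1,\dots,e_i\}$. For $G\in\mathcal{G}$, a $\mathcal{G}$-safe edge elimination scheme of $G$ is an edge ordering $\tau$ of $G$ with $G^i_\tau\in\mathcal{G}$ for all $i\in\{1,\dots,m\}$. Given a graph $G$ and $F\subseteq E(G)$, an edge $e\in F$ is degree-minimal in $F$ if its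 endpoints can be named $u,v$ so that (i) $u$ has the smallest degree in $G$ among all vertices incident to an edge of $F$, and (ii) $v$ has the smallest degree in $G$ among all vertices $w$ with $uw\in F$. $\mathcal{G}$ is degree sandwich monotone if for each $G\in\mathcal{G}$ and each $\mathcal{G}$-safe set $F\subseteq E(G)$, every degree-minimal edge in $F$ is $\mathcal{G}$-safe. *)

(* Defs.v *)
From mathcomp Require Import all_boot.
Set Implicit Arguments. Unset Strict Implicit. Unset Printing Implicit Defensive.

Record graph := Graph {
  gV : nat;
  gE : {set {set 'I_gV}};
  gE_wf : [forall e in gE, #|e| == 2] }.

Lemma gdel_wf (G : graph) (F : {set {set 'I_(gV G)}}) :
  [forall e in gE G :\: F, #|e| == 2].
Proof.
apply/forallP => e; apply/implyP => /setDP [he _].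
exact: (implyP (forallP (gE_wf G) e) he).
Qed.

Definition gdel (G : graph) (F : {set {set 'I_(gV G)}}) : graph :=
  @Graph (gV G) (gE G :\: F) (gdel_wf F).
Arguments gdel : clear implicits.

Definition gclass := graph -> Prop.

Definition deg (G : graph) (v : 'I_(gV G)) : nat := #|[set e in gE G | v \in e]|.

Definition safe_set (C : gclass) (G : graph) (F : {set {set 'I_(gV G)}}) : Prop :=
  F \subset gE G /\ C (gdel G F).
Arguments safe_set : clear implicits.

Definition grounded (C : gclass) : Prop :=
  forall G, C G -> C (gdel G (gE G)).

Definition degree_minimal (G : graph) (F : {set {set 'I_(gV G)}})
    (e : {set 'I_(gV G)}) : Prop :=
  e \in F /\
  exists u v : 'I_(gV G), e = [set u; v] /\
    (forall f w, f \in F -> w \in f -> deg u <= deg w) /\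
    (forall w, [set u; w] \in F -> deg v <= deg w).

Definition degree_sandwich_monotone (C : gclass) : Prop :=
  forall G, C G -> forall F, safe_set C G F ->
    forall e, degree_minimal F e -> C (gdel G [set e]).

Definition edge_ordering (G : graph) (tau : seq {set 'I_(gV G)}) : Prop :=
  perm_eq tau (enum (gE G)).

Definition safe_elim_scheme (C : gclass) (G : graph) (tau : seq {set 'I_(gV G)}) : Prop :=
  edge_ordering tau /\
  forall i, 1 <= i <= size tau -> C (gdel G [set e in take i tau]).

(* weighted graphs: omega is read only on edges *)
Definition wgraph := {G : graph & {set 'I_(gV G)} -> nat}.

Definition k_weighted (k : nat) (x : wgraph) : Prop :=
  (forall e, e \in gE (projT1 x) -> 1 <= projT2 x e <= k) /\
  (forall i, 1 <= i <= k -> exists2 e, e \in gE (projT1 x) & projT2 x e = i).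

Definition is_weighted (x : wgraph) : Prop := exists k, k_weighted k x.

Definition level_graph (x : wgraph) (i : nat) : graph :=
  gdel (projT1 x) [set e in gE (projT1 x) | projT2 x e < i].

Definition level_class (C : gclass) (x : wgraph) : Prop :=
  exists k, k_weighted k x /\ forall i, 1 <= i <= k.+1 -> C (level_graph x i).

(* Model of computation: a word RAM with unit-cost instructions,       *)
(* registers and an indirectly addressed memory; word size is          *)
(* polynomially bounded in the input size.                             *)
Inductive instr :=
| IConst of nat & nat
| IAdd of nat & nat & nat
| ISub of nat & nat & nat
| ILoad of nat & nat
| IStore of nat & nat
| IJz of nat & nat
| IJmp of nat
| IHalt.

Definition program := seq instr.

Record config := Config { pc : nat; reg : nat -> nat; mem : nat -> nat }.

Definition upd (f : nat -> nat) (i v : nat) : nat -> nat :=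
  fun j => if j == i then v else f j.

Definition step (p : program) (c : config) : option config :=
  let R := reg c in let M := mem c in let n := (pc c).+1 in
  match nth IHalt p (pc c) with
  | IConst r k => Some (Config n (upd R r k) M)
  | IAdd r a b => Some (Config n (upd R r (R a + R b)) M)
  | ISub r a b => Some (Config n (upd R r (R a - R b)) M)
  | ILoad r a => Some (Config n (upd R r (M (R a))) M)
  | IStore a b => Some (Config n R (upd M (R a) (R b)))
  | IJz r l => Some (Config (if R r == 0 then l else n) R M)
  | IJmp l => Some (Config l R M)
  | IHalt => None
  end.

Fixpoint run (p : program) (t : nat) (c : config) : option config :=
  match t with
  | 0 => Some c
  | t.+1 => obind (step p) (run p t c)
  end.

Definition init (s : seq nat) : config :=
  Config 0 (upd (fun _ => 0) 0 (size s)) (fun i => nth 0 s i).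

Definition runs_and_answers (p : program) (s : seq nat) (t B : nat) (b : Prop) : Prop :=
  exists cf, run p t (init s) = Some cf /\ step p cf = None /\
    (forall t' cf', t' <= t -> run p t' (init s) = Some cf' ->
        forall i, reg cf' i <= B /\ mem cf' i <= B) /\
    (reg cf 0 != 0 <-> b).

(* Input size of an encoding: first entry is |V|, the length is Theta(|E|). *)
Definition in_size (s : seq nat) : nat := nth 0 s 0 + size s.

Definition lin_time_decides {X : Type} (enc : X -> seq nat -> Prop)
    (dom P : X -> Prop) (p : program) : Prop :=
  exists c : nat, forall x s, dom x -> enc x s ->
    exists t, t <= c * (in_size s).+1 /\
      runs_and_answers p s t ((in_size s).+2 ^ c) (P x).

Definition enc_graph (G : graph) (s : seq nat) : Prop :=
  exists es : seq ('I_(gV G) * 'I_(gV G)),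
    s = gV G :: size es :: flatten [seq [:: val q.1; val q.2] | q <- es] /\
    perm_eq [seq [set q.1; q.2] | q <- es] (enum (gE G)).

Definition ordgraph := {G : graph & seq {set 'I_(gV G)}}.

Definition enc_ordering (x : ordgraph) (s : seq nat) : Prop :=
  exists es : seq ('I_(gV (projT1 x)) * 'I_(gV (projT1 x))),
    s = gV (projT1 x) :: size es :: flatten [seq [:: val q.1; val q.2] | q <- es] /\
    [seq [set q.1; q.2] | q <- es] = projT2 x.

Definition enc_wgraph (x : wgraph) (s : seq nat) : Prop :=
  exists es : seq ('I_(gV (projT1 x)) * 'I_(gV (projT1 x))),
    s = gV (projT1 x) :: size es ::
          flatten [seq [:: val q.1; val q.2; projT2 x [set q.1; q.2]] | q <- es] /\
    perm_eq [seq [set q.1; q.2] | q <- es] (enum (gE (projT1 x))).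

(* Main.v *)
Require Import Defs.
From mathcomp Require Import all_boot.
From mathcomp Require Import zify.

(* A recognizer of level-C weighted graphs is applied to a graph G with all weights 1,
   whose level graphs are G and an edgeless graph, and to a graph whose edges are weighted
   by their rank in an ordering, whose level graphs are the graphs of the elimination.

   Conversely, delete the edges by increasing weight, each time a degree-minimal edge among
   the remaining edges of least weight. By degree sandwich monotonicity the graph is level-C
   if and only if G is in C and this ordering is a safe elimination scheme. A vertex u of
   least degree keeps the least degree until its edges of the current weight are all deleted,
   and meanwhile the degree of any other vertex drops at most by one. Hence all levels can be
   handled together by one bucket queue of pairs (vertex, weight), keyed by the degree in the
   current graph of that level: stale entries are skipped, the current bucket moves down by
   one for each visited pair, and the total work is linear. Sorting the edges by weight, time
   of the visit and key of the other endpoint then gives the ordering.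

   On the machine, addresses modulo 64 give 64 independent memories. The two given programs
   run unchanged in memories of their own. Three-dimensional arrays are available in constant
   time because addresses may be polynomially large and the memory is initially zero. *)

Set Implicit Arguments. Unset Strict Implicit. Unset Printing Implicit Defensive.

(** * Structured programs *)

(** Different weights do not interact. The current graph of level [l] contains every edge heavier
    than [l] and no lighter edge, whatever has been deleted elsewhere, so a deletion changes only
    degrees attached to its own weight. One queue can therefore interleave the levels, and sorting
    by weight afterwards separates them. The choice of the second endpoint is postponed in the same
    way. A visit of [u] deletes its edges in arbitrary order; as the graph is simple, each other
    endpoint loses a single edge during the visit, so the key read at the deletion is its degree
    when the visit begins. Sorting the edges of a visit by this key meets the second condition of
    degree-minimality. The machine neither multiplies nor divides: the factor 64 is six doublings,
    and products of indices come from tables prepared once. Values have to stay polynomial, so every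
    layer carries a bound on values next to its time bound. The program for elimination schemes is
    only known to be correct on graphs of the class, so it is started only after the recognizer has
    accepted. *)

Inductive cmd (A : Type) :=
| Skip
| Atom of A
| Seq of cmd A & cmd A
| If of nat & cmd A & cmd A
| While of nat & cmd A.
Arguments Skip {A}.

(** Control flow is shared by two instruction sets, [ram] for the machine and [alang] for tables and
    stacks. Partiality of [eff] lets [ram] refuse jumps and values above the word bound. *)
Record lang := Lang {
  op : Type;
  state : Type;
  eff : op -> state -> option state;
  value : state -> nat -> nat;
  tick : state -> nat;
  test : state -> state;
  tick_eff : forall a s s', eff a s = Some s' -> tick s <= tick s';
  tick_test : forall s, tick s < tick (test s) }.

Inductive exec (L : lang) : cmd (op L) -> state L -> state L -> Prop :=
| ExSkip s : exec Skip s s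
| ExAtom a s s' : eff a s = Some s' -> exec (Atom a) s s'
| ExSeq c1 c2 s1 s2 s3 : exec c1 s1 s2 -> exec c2 s2 s3 -> exec (Seq c1 c2) s1 s3
| ExIf x c1 c2 s s' :
    exec (if value s x == 0 then c2 else c1) (test s) s' -> exec (If x c1 c2) s s'
| ExWhile0 x c s : value s x = 0 -> exec (While x c) s (test s)
| ExWhileS x c s1 s2 s3 : value s1 x <> 0 -> exec c (test s1) s2 ->
    exec (While x c) s2 s3 -> exec (While x c) s1 s3.

Lemma exec_tick L (c : cmd (op L)) s s' : exec c s s' -> tick s <= tick s'.
Proof.
elim=> {c s s'} //.
- by move=> a s s'; apply: tick_eff.
- by move=> c1 c2 s1 s2 s3 _ h1 _ h2; apply: leq_trans h2.
- by move=> x c1 c2 s s' _; apply: leq_trans; apply/ltnW/tick_test.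
- by move=> x c s _; apply/ltnW/tick_test.
- move=> x c s1 s2 s3 _ _ h1 _ h2; apply: leq_trans h2; apply: leq_trans h1.
  exact/ltnW/tick_test.
Qed.

(** Total correctness: some execution terminates in [Q]. Time bounds are assertions about [tick]
    inside [Q]. *)
Definition wp (L : lang) (c : cmd (op L)) (Q : state L -> Prop) (s : state L) : Prop :=
  exists2 s', exec c s s' & Q s'.

Lemma wp_mono L (c : cmd (op L)) (Q Q' : state L -> Prop) s :
  wp c Q s -> (forall s', Q s' -> Q' s') -> wp c Q' s.
Proof. by move=> [s' h hQ] hQQ; exists s' => //; apply: hQQ. Qed.

Lemma wp_skip L (Q : state L -> Prop) s : Q s -> wp Skip Q s.
Proof. by exists s => //; constructor. Qed.

Lemma wp_seq L (c1 c2 : cmd (op L)) (Q : state L -> Prop) s :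
  wp c1 (wp c2 Q) s -> wp (Seq c1 c2) Q s.
Proof. by move=> [s1 h1 [s2 h2 hQ]]; exists s2 => //; apply: ExSeq h1 h2. Qed.

Lemma wp_if L x (c1 c2 : cmd (op L)) (Q : state L -> Prop) s :
  (value s x = 0 -> wp c2 Q (test s)) -> (value s x <> 0 -> wp c1 Q (test s)) ->
  wp (If x c1 c2) Q s.
Proof.
move=> h0 h1; have h : wp (if value s x == 0 then c2 else c1) Q (test s).
  by case: eqP => [/h0|/h1].
by have [s' he hQ] := h; exists s' => //; constructor.
Qed.

(* A bound on the clock is what makes the loop terminate: every test advances it. *)
Lemma wp_while L x (c : cmd (op L)) (I Q : state L -> Prop) N s :
  I s -> (forall s, I s -> tick s <= N) ->
  (forall s, I s -> value s x <> 0 -> wp c I (test s)) ->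
  (forall s, I s -> value s x = 0 -> Q (test s)) ->
  wp (While x c) Q s.
Proof.
move=> hI hN hS h0; move: {2}(N - tick s) (leqnn (N - tick s)) => n.
elim: n s hI => [|n IHn] s hI hn; have hs := hN s hI.
- case: (value s x =P 0) => hx; first by exists (test s); [constructor | apply: h0].
  have [s' he hI'] := hS s hI hx.
  have := hN _ hI'; have := exec_tick he; have := tick_test s; lia.
- case: (value s x =P 0) => hx; first by exists (test s); [constructor | apply: h0].
  have [s' he hI'] := hS s hI hx.
  have [|s2 he2 hQ] := IHn s' hI'.
    by have := hN _ hI'; have := exec_tick he; have := tick_test s; lia.
  by exists s2 => //; apply: ExWhileS he he2.
Qed.

Fixpoint block (A : Type) (l : seq A) : cmd A :=
  if l is a :: l' then Seq (Atom a) (block l') else Skip.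

(** * Runs of the machine *)

Definition bounded (B : nat) (c : config) : Prop := forall i, reg c i <= B /\ Defs.mem c i <= B.

(** Carries the value bound along all intermediate configurations, because [runs_and_answers] asks
    for it at every time. *)
Definition steps (P : program) (B n : nat) (c c' : config) : Prop :=
  run P n c = Some c' /\
  forall t cf, t <= n -> run P t c = Some cf -> bounded B cf.

Lemma run_add P a b c : run P (a + b) c = obind (run P b) (run P a c).
Proof.
elim: b => [|b IHb]; first by rewrite addn0 /=; case: (run P a c).
by rewrite addnS /= IHb; case: (run P a c).
Qed.

Lemma steps_refl P B c : bounded B c -> steps P B 0 c c.
Proof. by move=> hb; split=> // t cf; rewrite leqn0 => /eqP -> [<-]. Qed.

Lemma steps_trans P B m n c1 c2 c3 :
  steps P B m c1 c2 -> steps P B n c2 c3 -> steps P B (m + n) c1 c3.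
Proof.
move=> [h1 b1] [h2 b2]; split; first by rewrite run_add h1.
move=> t cf ht; case: (leqP t m) => htm; first exact: b1.
by rewrite -(subnKC (ltnW htm)) run_add h1 /=; apply: b2; lia.
Qed.

Lemma steps_one P B c c' : bounded B c -> step P c = Some c' -> bounded B c' ->
  steps P B 1 c c'.
Proof.
move=> hb hs hb'; split=> // -[|[|t]] cf //= _; first by case=> <-.
by rewrite hs => -[<-].
Qed.

Lemma steps_bounded P B n c c' : steps P B n c c' -> bounded B c'.
Proof. by move=> [h hb]; apply: (hb n). Qed.

(** * Straight-line machine code with structured control *)

Record rstate := RState { rreg : nat -> nat; rmem : nat -> nat; rtick : nat }.

Definition rconf (pc : nat) (s : rstate) : config := Config pc (rreg s) (rmem s).

(** Undefined above [B], so that the mere existence of an execution certifies the word-size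
    bound. *)
Definition rset B (s : rstate) (r v : nat) : option rstate :=
  if v <= B then Some (RState (upd (rreg s) r v) (rmem s) (rtick s).+1) else None.

Definition reff (B : nat) (i : instr) (s : rstate) : option rstate :=
  match i with
  | IConst r k => rset B s r k
  | IAdd r a b => rset B s r (rreg s a + rreg s b)
  | ISub r a b => rset B s r (rreg s a - rreg s b)
  | ILoad r a => rset B s r (rmem s (rreg s a))
  | IStore a b =>
      if rreg s b <= B
      then Some (RState (rreg s) (upd (rmem s) (rreg s a) (rreg s b)) (rtick s).+1)
      else None
  | _ => None
  end.

(* A test costs two ticks: the conditional jump and the jump that closes the branch. *)
Definition rtest (s : rstate) := RState (rreg s) (rmem s) (rtick s).+2.

Lemma rtick_eff B a s s' : reff B a s = Some s' -> rtick s <= rtick s'.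
Proof.
by case: a => //= [r k|r a b|r a b|r a|a b]; rewrite /rset; case: ifP => // _ [<-] /=.
Qed.

Definition ram (B : nat) : lang :=
  @Lang instr rstate (reff B) rreg rtick rtest (@rtick_eff B) (fun s => leqnSn _).

(** Jumps are absolute, hence the load address [o] as an argument. Every construct is left through
    the address following its code. *)
Fixpoint compile (c : cmd instr) (o : nat) : program :=
  match c with
  | Skip => [::]
  | Atom i => [:: i]
  | Seq c1 c2 => let p := compile c1 o in p ++ compile c2 (o + size p)
  | If x c1 c2 =>
      let p1 := compile c1 o.+1 in
      let o2 := (o + size p1).+2 in
      let p2 := compile c2 o2 in
      IJz x o2 :: p1 ++ IJmp (o2 + size p2) :: p2
  | While x c => let p := compile c o.+1 in IJz x (o + size p).+2 :: p ++ [:: IJmp o]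
  end.

Definition loaded (P : program) (o : nat) (p : program) : Prop :=
  forall i, i < size p -> nth IHalt P (o + i) = nth IHalt p i.

Lemma loaded_cat P o p q : loaded P o (p ++ q) -> loaded P o p /\ loaded P (o + size p) q.
Proof.
move=> h; split=> i hi.
  by rewrite h ?nth_cat ?hi // size_cat ltn_addr.
by rewrite -addnA h ?size_cat ?ltn_add2l // nth_cat ltnNge leq_addr /= addKn.
Qed.

Lemma loaded_cons P o i q : loaded P o (i :: q) -> nth IHalt P o = i /\ loaded P o.+1 q.
Proof.
move=> h; split; first by have := h 0 isT; rewrite addn0.
by move=> j hj; have := h j.+1 hj; rewrite addnS.
Qed.

Lemma loaded_mid pre p post : loaded (pre ++ p ++ post) (size pre) p.
Proof.
by move=> i hi; rewrite nth_cat ltnNge leq_addr /= addKn nth_cat hi.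
Qed.

Lemma reff_step B P o i s s' : reff B i s = Some s' -> nth IHalt P o = i ->
  bounded B (rconf o s) ->
  [/\ step P (rconf o s) = Some (rconf o.+1 s'), bounded B (rconf o.+1 s')
    & rtick s' = (rtick s).+1].
Proof.
move=> h hi hb; rewrite /step /= hi.
have hset r v : rset B s r v = Some s' ->
    [/\ Some (Config o.+1 (upd (rreg s) r v) (rmem s)) = Some (rconf o.+1 s'),
        bounded B (rconf o.+1 s') & rtick s' = (rtick s).+1].
  rewrite /rset; case: ifP => // hv [<-]; split=> // j; have [h1 h2] := hb j.
  by split=> //=; rewrite /upd; case: eqP.
case: i h {hi} => //= [r a b|r a b|r a|a b]; try exact: hset.
case: ifP => // hv [<-]; split=> // j; have [h1 h2] := hb j.
by split=> //=; rewrite /upd; case: eqP.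
Qed.

Theorem compile_correct B (c : cmd instr) s s' : @exec (ram B) c s s' ->
  forall P o, loaded P o (compile c o) -> bounded B (rconf o s) ->
  exists2 n, n + rtick s <= rtick s'
    & steps P B n (rconf o s) (rconf (o + size (compile c o)) s').
Proof.
elim=> {c s s'}.
- by move=> s P o _ hb; exists 0 => //; rewrite addn0; apply: steps_refl.
- move=> a s s' h P o hl hb; have [hi _] := loaded_cons hl.
  have [h1 h2 h3] := reff_step h hi hb.
  by exists 1; [rewrite h3 | rewrite addn1; apply: steps_one].
- move=> c1 c2 s1 s2 s3 _ IH1 _ IH2 P o /= hl hb.
  have [hl1 hl2] := loaded_cat hl.
  have [n1 t1 r1] := IH1 P o hl1 hb.
  have [n2 t2 r2] := IH2 P _ hl2 (steps_bounded r1).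
  by exists (n1 + n2); [lia | rewrite size_cat addnA; apply: steps_trans r1 r2].
- move=> x c1 c2 s s' _ IH P o /= hl hb.
  have [hi /loaded_cat [hl1 /loaded_cons [hj hl2]]] := loaded_cons hl.
  have hb' k : bounded B (rconf k (rtest s)) by exact: hb.
  have jump k : step P (rconf o s) = Some (rconf k (rtest s)) ->
      steps P B 1 (rconf o s) (rconf k (rtest s)) by move=> h; apply: steps_one.
  have := IH P; rewrite /=; case: eqP => hx {}IH.
    have e2 : (o.+1 + size (compile c1 o.+1)).+1 = (o + size (compile c1 o.+1)).+2 by lia.
    move: hl2; rewrite e2 => hl2.
    have [n t r] := IH _ hl2 (hb' _).
    exists (1 + n); first by move: t => /=; lia.
    apply: steps_trans (jump _ _) _; first by rewrite /step /= hi hx.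
    rewrite size_cat /=; move: r; set a := size _; set b := size _.
    by have -> : (o + a).+2 + b = o + (a + b.+1).+1 by lia.
  have [n t r] := IH _ hl1 (hb' _).
  have hbr := steps_bounded r.
  exists (1 + n + 1); first by move: t => /=; lia.
  apply: steps_trans (steps_trans (jump _ _) r) _.
    by rewrite /step /= hi; move/eqP/negbTE: hx => ->.
  apply: steps_one => //.
  rewrite /step /= hj size_cat /=; congr (Some (Config _ _ _)); lia.
- move=> x c s hx P o /= hl hb.
  have [hi _] := loaded_cons hl.
  exists 1 => /=; first by lia.
  apply: steps_one => //.
  rewrite /step /= hi size_cat /=; move: hx => /= ->; congr (Some (Config _ _ _)); lia.
- move=> x c s1 s2 s3 hx _ IH1 _ IH2 P o hl hb; move: (hl) => /=.
  move=> /loaded_cons [hi /loaded_cat [hl1 /loaded_cons [hj _]]].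
  have hb' k : bounded B (rconf k (rtest s1)) by exact: hb.
  have [n1 t1 r1] := IH1 P _ hl1 (hb' _).
  have hbr := steps_bounded r1.
  have [n2 t2 r2] := IH2 P o hl hbr.
  exists (1 + n1 + 1 + n2); first by move: t1 t2 => /=; lia.
  have jump : steps P B 1 (rconf o s1) (rconf o.+1 (rtest s1)).
    by apply: steps_one => //; rewrite /step /= hi; move/eqP/negbTE: hx => ->.
  apply: steps_trans r2; apply: steps_trans (steps_trans jump r1) _.
  by apply: steps_one; [exact: hbr | rewrite /step /= hj | exact: hbr].
Qed.

Fixpoint reffs (B : nat) (l : seq instr) (s : rstate) : option rstate :=
  if l is i :: l' then obind (reffs B l') (reff B i s) else Some s.

Lemma reffs_cat B l1 l2 s : reffs B (l1 ++ l2) s = obind (reffs B l2) (reffs B l1 s).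
Proof. by elim: l1 s => [|i l IH] s //=; case: (reff B i s) => //=. Qed.

Lemma reffs_steps B P l o s s' : reffs B l s = Some s' -> loaded P o l ->
  bounded B (rconf o s) -> steps P B (size l) (rconf o s) (rconf (o + size l) s').
Proof.
elim: l o s => [|i l IH] o s /=.
  by move=> [<-] _ hb; rewrite addn0; apply: steps_refl.
case he: (reff B i s) => [s1|] //= hs /loaded_cons [hi hl] hb.
have [h1 h2 _] := reff_step he hi hb.
rewrite -[_.+1]add1n addnA addn1; apply: steps_trans (IH _ _ hs hl h2).
exact: steps_one.
Qed.

Lemma wp_block B l (Q : rstate -> Prop) s s' :
  reffs B l s = Some s' -> Q s' -> @wp (ram B) (block l) Q s.
Proof.
move=> h hQ; exists s' => // {hQ}; elim: l s h => [|i l IH] s /=.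
  by move=> [<-]; constructor.
case he: (reff B i s) => [s1|] //= hs.
by apply: ExSeq (IH _ hs); constructor.
Qed.

Lemma upd_eq f i v : upd f i v i = v.
Proof. by rewrite /upd eqxx. Qed.

Lemma upd_ne f i v j : (j != i :> nat) -> upd f i v j = f j.
Proof. by rewrite /upd => /negbTE ->. Qed.

(* Address of cell [R a] of the [f]-th of 64 interleaved memories; register 7 is scratch. *)
Definition lea (f t a : nat) : seq instr :=
  IAdd t a a :: nseq 5 (IAdd t t t) ++ [:: IConst 7 f; IAdd t t 7].

Lemma lea_eff B f t a s : t != 7 -> a != 7 -> 64 * rreg s a + f <= B ->
  exists2 R', reffs B (lea f t a) s = Some (RState R' (rmem s) (rtick s + 8))
    & R' t = 64 * rreg s a + f /\ forall x : nat, x != t -> x != 7 -> R' x = rreg s x.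
Proof.
move=> ht ha hB; have h7 : (7 == t) = false by rewrite eq_sym; apply/negbTE.
rewrite /lea /= /rset /=.
have E v b r m k : v <= B -> (if v <= B then Some (RState r m k) else b) = Some (RState r m k).
  by move=> ->.
do 8! (rewrite E /= ?upd_eq ?(upd_ne _ _ ht) ?upd_eq; last by lia).
eexists; first by congr (Some (RState _ _ _)); lia.
split; first by rewrite upd_eq; lia.
by move=> x hx hx7; rewrite !upd_ne.
Qed.

(** * Running a program inside one of the interleaved memories *)

(* Program [p] lives in the registers congruent to [k] modulo 4 and in the
   addresses congruent to [f] modulo 64; every instruction becomes 9 instructions. *)
Definition embed_instr (k f o n : nat) (i : instr) : seq instr :=
  let g r := 4 * r + k in
  let t l := o + 9 * minn l n in
  let pad i := rcons (nseq 8 (IConst 7 0)) i in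
  match i with
  | IConst r v => pad (IConst (g r) v)
  | IAdd r a b => pad (IAdd (g r) (g a) (g b))
  | ISub r a b => pad (ISub (g r) (g a) (g b))
  | ILoad r a => rcons (lea f 3 (g a)) (ILoad (g r) 3)
  | IStore a b => rcons (lea f 3 (g a)) (IStore 3 (g b))
  | IJz r l => pad (IJz (g r) (t l))
  | IJmp l => pad (IJmp (t l))
  | IHalt => pad (IJmp (t n))
  end.

(** The common length 9, eight instructions of [lea] or padding and one for the effect, sends
    address [l] to [o + 9 * l]. The [minn] in the jumps redirects every exit, including [IHalt], to
    the address following the embedded code. *)
Definition embed (k f : nat) (p : program) (o : nat) : program :=
  flatten [seq embed_instr k f o (size p) i | i <- p].

Lemma size_embed_instr k f o n i : size (embed_instr k f o n i) = 9.
Proof. by case: i. Qed.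

Lemma size_embed k f p o : size (embed k f p o) = 9 * size p.
Proof.
rewrite /embed; move: {1}(size p) => n; elim: p => [|i p IH] //=.
by rewrite size_cat size_embed_instr IH; lia.
Qed.

Lemma loaded_embed P k f p o j : loaded P o (embed k f p o) -> j < size p ->
  loaded P (o + 9 * j) (embed_instr k f o (size p) (nth IHalt p j)).
Proof.
rewrite /embed; suff h n o1 : loaded P o1 (flatten [seq embed_instr k f o n i | i <- p]) ->
  j < size p -> loaded P (o1 + 9 * j) (embed_instr k f o n (nth IHalt p j)) by exact: h.
elim: p o1 j => [|i p IH] o1 [|j] //=.
  by move=> /loaded_cat [h _] _; rewrite muln0 addn0.
move=> /loaded_cat [_ h] hj; rewrite size_embed_instr in h.
by have := IH _ _ h hj; rewrite mulnS addnA.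
Qed.

Section Embed.
Variables (P p : program) (k f o B BB : nat).
Hypotheses (hk : k < 3) (hP : loaded P o (embed k f p o)) (hf : f < 64).
Hypothesis hBB : 64 * B + 64 <= BB.

Definition embedded (c : config) (R M : nat -> nat) : Prop :=
  [/\ forall r, R (4 * r + k) = reg c r & forall a, M (64 * a + f) = Defs.mem c a].

(** Registers congruent to 3 modulo 4 are scratch for everyone; the rest must survive, since it
    belongs to the other embedded program or to the surrounding code. *)
Definition framed (R M R' M' : nat -> nat) : Prop :=
  [/\ forall x, x %% 4 != k -> x %% 4 != 3 -> R' x = R x
    & forall b, b %% 64 != f -> M' b = M b].

Definition epc (c : config) := o + 9 * minn (pc c) (size p).

Lemma framed_trans R M R' M' R2 M2 :
  framed R M R' M' -> framed R' M' R2 M2 -> framed R M R2 M2.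
Proof.
move=> [h1 h2] [h3 h4]; split=> [x hx hx3|b hb]; first by rewrite h3 ?h1.
by rewrite h4 ?h2.
Qed.

Let g_inj r r' : (4 * r' + k == 4 * r + k) = (r' == r).
Proof. by apply/eqP/eqP; lia. Qed.
Let g3 r : 4 * r + k != 3. Proof. by lia. Qed.
Let g7 r : 4 * r + k != 7. Proof. by lia. Qed.
Let gm r : (4 * r + k) %% 4 = k. Proof. by lia. Qed.

Lemma embed_pad s : bounded BB (rconf 0 s) ->
  exists2 R', reffs BB (nseq 8 (IConst 7 0)) s = Some (RState R' (rmem s) (rtick s + 8))
    & forall x, x != 7 -> R' x = rreg s x.
Proof.
move=> hb; eexists; first by rewrite /= /rset /=; congr (Some (RState _ _ _)); lia.
by move=> x hx; rewrite /= !upd_ne.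
Qed.

Lemma embed_step c c1 R M : step p c = Some c1 -> bounded B c -> bounded B c1 ->
  embedded c R M -> bounded BB (Config (epc c) R M) ->
  exists R' M', [/\ steps P BB 9 (Config (epc c) R M) (Config (epc c1) R' M'),
    embedded c1 R' M' & framed R M R' M'].
Proof.
move=> hs hbc hbc1 [hR hM] hb.
have hpc : pc c < size p.
  rewrite ltnNge; apply/negP => h; move: hs.
  by rewrite /step nth_default.
have hl := loaded_embed hP hpc.
have epcE : epc c = o + 9 * pc c by rewrite /epc; congr (_ + 9 * _); apply/minn_idPl/ltnW.
rewrite epcE in hb *.
set s := RState R M 0.
have [R1 h1 hR1] := embed_pad (s := s) hb.
have hRB r : reg c r <= B by case: (hbc r).
have hRB1 r : reg c1 r <= B by case: (hbc1 r).
have keepR R0 r v : (forall x, x != 3 -> x != 7 -> R0 x = R x) ->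
    embedded (Config (pc c).+1 (upd (reg c) r v) (Defs.mem c)) (upd R0 (4 * r + k) v) M
    /\ framed R M (upd R0 (4 * r + k) v) M.
  move=> h0; split; split=> //=.
    by move=> r'; rewrite /upd g_inj; case: eqP => // _; rewrite h0.
  move=> x hx hx3; rewrite /upd; case: eqP => [e|_]; last by apply: h0; lia.
  by move: hx; rewrite e gm eqxx.
have straight s' : reffs BB (embed_instr k f o (size p) (nth IHalt p (pc c))) s = Some s' ->
    pc c1 = (pc c).+1 -> embedded c1 (rreg s') (rmem s') -> framed R M (rreg s') (rmem s') ->
    exists R' M', [/\ steps P BB 9 (Config (o + 9 * pc c) R M) (Config (epc c1) R' M'),
      embedded c1 R' M' & framed R M R' M'].
  move=> h hpc1 h2 h3; exists (rreg s'), (rmem s'); split=> //.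
  have := reffs_steps h hl hb; rewrite size_embed_instr.
  by rewrite /epc hpc1 (minn_idPl hpc) mulnS [9 + _]addnC addnA.
have jump l : embed_instr k f o (size p) (nth IHalt p (pc c)) =
      rcons (nseq 8 (IConst 7 0)) l ->
    (forall P s, nth IHalt P (o + 9 * pc c + 8) = l -> rreg s =1 R1 -> rmem s = M ->
      step P (rconf (o + 9 * pc c + 8) s) = Some (rconf (epc c1) s)) ->
    reg c1 = reg c -> Defs.mem c1 = Defs.mem c ->
    exists R' M', [/\ steps P BB 9 (Config (o + 9 * pc c) R M) (Config (epc c1) R' M'),
      embedded c1 R' M' & framed R M R' M'].
  move=> hi hstep hr hm; exists R1, M; split.
  - move: hl; rewrite hi -cats1 => /loaded_cat [hl1 /loaded_cons [hl2 _]].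
    rewrite size_nseq in hl2.
    have r := reffs_steps h1 hl1 hb; have hb1 := steps_bounded r.
    rewrite -[9]/(8 + 1); apply: steps_trans r _; apply: steps_one => //.
    by rewrite size_nseq; apply: hstep.
  - by split=> [r|a]; rewrite ?hr ?hm // hR1.
  - by split=> // x _ hx; apply: hR1; lia.
have pad i : reffs BB (rcons (nseq 8 (IConst 7 0)) i) s = reff BB i (RState R1 M 8).
  by rewrite -cats1 reffs_cat h1 /=; case: (reff _ _ _).
have R1e r : R1 (4 * r + k) = reg c r by rewrite hR1.
have jumpP i l : c1 = Config l (reg c) (Defs.mem c) ->
    nth IHalt p (pc c) = i ->
    embed_instr k f o (size p) i = rcons (nseq 8 (IConst 7 0)) (IJmp (epc c1)) ->
    exists R' M', [/\ steps P BB 9 (Config (o + 9 * pc c) R M) (Config (epc c1) R' M'),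
      embedded c1 R' M' & framed R M R' M'].
  move=> hc1 hi he; apply: (jump (IJmp (epc c1))); rewrite ?hc1 // ?hi ?he ?hc1 //.
  by move=> P' s' hs' _ _; rewrite /step /= hs'.
move: hs; rewrite /step; case hi: (nth IHalt p (pc c)) => [r v|r a b|r a b|r a|a b|r l|l|] // -[hc1].
- have [h2 h3] := keepR R1 r v (fun x _ h => hR1 x h).
  have hv : v <= BB by have := hRB1 r; rewrite -hc1 /= upd_eq; lia.
  apply: (straight (RState (upd R1 (4 * r + k) v) M 9)); rewrite -?hc1 //.
  by rewrite hi pad /= /rset hv.
- have [h2 h3] := keepR R1 r (reg c a + reg c b) (fun x _ h => hR1 x h).
  have hv : reg c a + reg c b <= BB by have := hRB1 r; rewrite -hc1 /= upd_eq; lia.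
  apply: (straight (RState (upd R1 (4 * r + k) (reg c a + reg c b)) M 9)); rewrite -?hc1 //.
  by rewrite hi pad /= /rset /= !R1e hv.
- have [h2 h3] := keepR R1 r (reg c a - reg c b) (fun x _ h => hR1 x h).
  have hv : reg c a - reg c b <= BB by have := hRB1 r; rewrite -hc1 /= upd_eq; lia.
  apply: (straight (RState (upd R1 (4 * r + k) (reg c a - reg c b)) M 9)); rewrite -?hc1 //.
  by rewrite hi pad /= /rset /= !R1e hv.
- have ha : 64 * rreg s (4 * r + k) + f <= BB by have := hRB r; rewrite /= hR; lia.
  have ha' : 64 * rreg s (4 * a + k) + f <= BB by have := hRB a; rewrite /= hR; lia.
  have [R2 e2 [t2 o2]] := lea_eff (t := 3) isT (g7 a) ha'.
  have [h2 h3] := keepR R2 r (Defs.mem c (reg c a)) o2.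
  have hv : Defs.mem c (reg c a) <= BB by have [_ h] := hbc (reg c a); lia.
  apply: (straight (RState (upd R2 (4 * r + k) (Defs.mem c (reg c a))) M 9)); rewrite -?hc1 //.
  rewrite hi (_ : embed_instr _ _ _ _ _ = lea f 3 (4 * a + k) ++ [:: ILoad (4 * r + k) 3]) //.
  by rewrite reffs_cat e2 /= /rset /= t2 /= hR hM hv.
- have ha : 64 * rreg s (4 * a + k) + f <= BB by have := hRB a; rewrite /= hR; lia.
  have [R2 e2 [t2 o2]] := lea_eff (t := 3) isT (g7 a) ha.
  have hv : reg c b <= BB by have := hRB b; lia.
  have R2e r : R2 (4 * r + k) = reg c r by rewrite o2.
  apply: (straight (RState R2 (upd M (64 * reg c a + f) (reg c b)) 9)); rewrite -?hc1 //.
  + rewrite hi (_ : embed_instr _ _ _ _ _ = lea f 3 (4 * a + k) ++ [:: IStore 3 (4 * b + k)]) //.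
    by rewrite reffs_cat e2 /= R2e hv t2 /= hR.
  + split=> //= a'; rewrite /upd; have -> : (64 * a' + f == 64 * reg c a + f) = (a' == reg c a).
      by apply/eqP/eqP; lia.
    by case: eqP.
  + split=> [x hx hx3|b' hb'] /=; first by apply: o2; lia.
    by rewrite upd_ne //; apply: contra hb' => /eqP ->; lia.
- apply: (jump (IJz (4 * r + k) (o + 9 * minn l (size p)))); rewrite -?hc1 ?hi //.
  move=> P' s' hs' hr _; rewrite /step /= hs' hr R1e /epc /=; congr (Some (Config _ _ _)).
  by case: eqP => // _; rewrite (minn_idPl hpc); lia.
- by apply: (jumpP (IJmp l) l); rewrite -?hc1.
Qed.

Lemma embed_run t c0 R M cf : run p t c0 = Some cf ->
  (forall t' c', t' <= t -> run p t' c0 = Some c' -> bounded B c') ->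
  embedded c0 R M -> bounded BB (Config (epc c0) R M) ->
  exists R' M', [/\ steps P BB (9 * t) (Config (epc c0) R M) (Config (epc cf) R' M'),
    embedded cf R' M' & framed R M R' M'].
Proof.
elim: t cf => [|t IH] cf hr hbd he hb.
  by case: hr => <-; exists R, M; split=> //; apply: steps_refl.
case hr1: (run p t c0) (hr) => [c1|] //=; rewrite hr1 //= => hs.
have [|R1 [M1 [s1 e1 f1]]] := IH _ hr1 _ he hb.
  by move=> t' c' ht'; apply: hbd; apply: leqW.
have [||R2 [M2 [s2 e2 f2]]] := embed_step hs _ _ e1 (steps_bounded s1).
- exact: hbd (leqnSn _) hr1.
- exact: hbd (leqnn _) hr.
exists R2, M2; split=> //; last exact: framed_trans f2.
by rewrite mulnS addnC; apply: steps_trans s2.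
Qed.

(** A halted run stands beyond the program or on an [IHalt]. In the second case the embedded jump
    takes nine more steps, whence the additive 9; both cases end at the address following the
    embedded code. *)
Theorem embed_correct t c0 R M cf : run p t c0 = Some cf -> step p cf = None -> pc c0 = 0 ->
  (forall t' c', t' <= t -> run p t' c0 = Some c' -> bounded B c') ->
  embedded c0 R M -> bounded BB (Config o R M) ->
  exists n R' M', [/\ n <= 9 * t + 9,
    steps P BB n (Config o R M) (Config (o + 9 * size p) R' M'),
    embedded cf R' M' & framed R M R' M'].
Proof.
move=> hr hs h0 hbd he hb; have e0 : epc c0 = o by rewrite /epc h0 min0n muln0 addn0.
rewrite -e0 in hb; have [R1 [M1 [s1 e1 f1]]] := embed_run hr hbd he hb.
rewrite e0 in s1; have hb1 := steps_bounded s1.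
case: (ltnP (pc cf) (size p)) => hpc; last first.
  exists (9 * t), R1, M1; split=> //; first by lia.
  by move: s1; rewrite /epc (minn_idPr hpc).
have hl := loaded_embed hP hpc.
have hi : nth IHalt p (pc cf) = IHalt by move: hs; rewrite /step; case: (nth _ _ _).
have epcE : epc cf = o + 9 * pc cf by rewrite /epc; congr (_ + 9 * _); apply/minn_idPl/ltnW.
rewrite epcE in hb1 s1.
move: hl; rewrite hi /= -[_ :: _]/(nseq 8 (IConst 7 0) ++ [:: IJmp (o + 9 * minn (size p) (size p))]).
move=> /loaded_cat [hl1 /loaded_cons [hl2 _]]; rewrite size_nseq in hl2.
have [R2 h2 hR2] := embed_pad (s := RState R1 M1 0) hb1.
have s2 := reffs_steps h2 hl1 hb1; have hb2 := steps_bounded s2.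
exists (9 * t + (8 + 1)), R2, M1; split=> //.
- apply: steps_trans s1 (steps_trans s2 _); apply: steps_one => //.
  by rewrite /step /= hl2 minnn.
- by case: e1 => h3 h4; split=> // r; rewrite hR2.
- apply: framed_trans f1 _; split=> // x _ hx; apply: hR2; lia.
Qed.
End Embed.

(** * An abstract language with tables and stacks *)

(* Arguments are names of variables, except for the constant in [Cst] and the
   name [j] of a table or of a family of stacks. *)
Inductive aop :=
| Cst (x k : nat)
| Mov (x y : nat)
| Inc (x : nat)
| Diff (x y z : nat)
| Get (x j y z : nat)
| Put (j y z x : nat)
| Push (j y z x1 x2 : nat)
| Pop (x1 x2 j y z : nat)
| Len (x j y z : nat)
| Nth (x1 x2 j y z i : nat).

Record astate := AState {
  va : nat -> nat;
  cell : nat -> nat -> nat -> nat;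
  stk : nat -> nat -> nat -> seq (nat * nat);
  atick : nat }.

Definition upd3 T (f : nat -> nat -> nat -> T) j y z v :=
  fun j' y' z' => if [&& j' == j, y' == y & z' == z] then v else f j' y' z'.

Definition aset (s : astate) x v :=
  AState (upd (va s) x v) (cell s) (stk s) (atick s).+1.

Definition aput (s : astate) j y z v :=
  AState (va s) (upd3 (cell s) j y z v) (stk s) (atick s).+1.

Definition astk (s : astate) j y z l :=
  AState (va s) (cell s) (upd3 (stk s) j y z l) (atick s).+1.

(* The cost of a constant is its value: no value can then exceed the initial
   values by more than the elapsed time. *)
Definition aeff (a : aop) (s : astate) : astate :=
  match a with
  | Cst x k => AState (upd (va s) x k) (cell s) (stk s) (atick s + k.+1)
  | Mov x y => aset s x (va s y)
  | Inc x => aset s x (va s x).+1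
  | Diff x y z => aset s x (va s y - va s z)
  | Get x j y z => aset s x (cell s j (va s y) (va s z))
  | Put j y z x => aput s j (va s y) (va s z) (va s x)
  | Push j y z x1 x2 =>
      astk s j (va s y) (va s z) (rcons (stk s j (va s y) (va s z)) (va s x1, va s x2))
  | Pop x1 x2 j y z =>
      let l := stk s j (va s y) (va s z) in
      let q := last (0, 0) l in
      AState (upd (upd (va s) x1 q.1) x2 q.2) (cell s)
        (upd3 (stk s) j (va s y) (va s z) (take (size l).-1 l)) (atick s).+1
  | Len x j y z => aset s x (size (stk s j (va s y) (va s z)))
  | Nth x1 x2 j y z i =>
      let q := nth (0, 0) (stk s j (va s y) (va s z)) (va s i) in
      AState (upd (upd (va s) x1 q.1) x2 q.2) (cell s) (stk s) (atick s).+1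
  end.

Definition atest (s : astate) := AState (va s) (cell s) (stk s) (atick s).+1.

Lemma atick_lt a s : atick s < atick (aeff a s).
Proof. by case: a => * /=; lia. Qed.

Lemma atick_eff a s s' : Some (aeff a s) = Some s' -> atick s <= atick s'.
Proof. by move=> [<-]; apply/ltnW/atick_lt. Qed.

Definition alang : lang :=
  @Lang aop astate (fun a s => Some (aeff a s)) va atick atest atick_eff (fun s => leqnn _).

Definition acmd := cmd aop.

Definition abound (N : nat) (s : astate) : Prop :=
  [/\ forall x, va s x <= N, forall j y z, cell s j y z <= N,
      forall j y z, size (stk s j y z) <= N
    & forall j y z i, (nth (0, 0) (stk s j y z) i).1 <= N /\
                      (nth (0, 0) (stk s j y z) i).2 <= N].

Lemma last_nth00 (l : seq (nat * nat)) : last (0, 0) l = nth (0, 0) l (size l).-1.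
Proof. by rewrite nth_last; case: l. Qed.

Lemma abound_eff N a s : abound (N + atick s) s -> abound (N + atick (aeff a s)) (aeff a s).
Proof.
move=> [h1 h2 h3 h4]; move: (atick_lt a s); set t := atick (aeff a s) => ht.
have h1' x : va s x <= N + t by have := h1 x; lia.
have h2' j y z : cell s j y z <= N + t by have := h2 j y z; lia.
have h3' j y z : size (stk s j y z) <= N + t by have := h3 j y z; lia.
have h4' j y z i : (nth (0, 0) (stk s j y z) i).1 <= N + t /\
    (nth (0, 0) (stk s j y z) i).2 <= N + t by have [] := h4 j y z i; lia.
have u f x v : (forall y, f y <= N + t) -> v <= N + t -> forall y, upd f x v y <= N + t.
  by move=> hf hv y; rewrite /upd; case: eqP.
case: a @t ht h1' h2' h3' h4' u => [x k|x y|x|x y z|x j y z|j y z x|j y z x1 x2|x1 x2 j y z|x j y z|x1 x2 j y z i] t ht h1' h2' h3' h4' u.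
all: split=> //=; try (by apply: u; rewrite // /t /=; lia).
- by apply: u; rewrite // /t /=; have := h1 x; lia.
- by apply: u; rewrite // /t /=; have := h1 y; lia.
- by move=> j' y' z'; rewrite /upd3; case: ifP.
- move=> j' y' z'; rewrite /upd3; case: ifP => // _; rewrite size_rcons.
  by have := h3 j (va s y) (va s z); rewrite /t /=; lia.
- move=> j' y' z' i; rewrite /upd3; case: ifP => // _; rewrite nth_rcons.
  by case: ifP => // _; case: ifP => /= _; split.
- by apply: (u); [apply: (u) | ]; rewrite // last_nth00; have [] := h4' j (va s y) (va s z) (size (stk s j (va s y) (va s z))).-1.
- move=> j' y' z'; rewrite /upd3; case: ifP => // _; rewrite size_take.
  by have := h3' j (va s y) (va s z); case: ifP => //; lia.
- move=> j' y' z' i; rewrite /upd3; case: ifP => // _.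
  set l := stk _ _ _ _; case: (ltnP i (size l).-1) => hi; first by rewrite nth_take //; exact: h4'.
  by rewrite nth_default // size_take; case: ifP => //; lia.
- by have [? ?] := h4' j (va s y) (va s z) (va s i); apply: (u) => //; apply: (u).
Qed.

Lemma abound_exec N c s s' : @exec alang c s s' ->
  abound (N + atick s) s -> abound (N + atick s') s'.
Proof.
have w s1 n n' : n <= n' -> abound n s1 -> abound n' s1.
  move=> hn [h1 h2 h3 h4]; split=> *; try by apply: leq_trans hn.
  by split; apply: leq_trans hn; apply h4.
have t s1 : abound (N + atick s1) s1 -> abound (N + atick (atest s1)) (atest s1).
  by move=> h; apply: (w _ (N + atick s1)); [rewrite /=; lia | case: h].
elim=> {c s s'} //.
- by move=> a s s' [<-]; apply: abound_eff.
- by move=> c1 c2 s1 s2 s3 _ h1 _ h2 h; apply/h2/h1.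
- by move=> x c1 c2 s s' _ h1 h; apply: h1; apply: t.
- by move=> x c s _ h; apply: t.
- by move=> x c s1 s2 s3 _ _ h1 _ h2 h; apply/h2/h1/t.
Qed.

(** * Implementation of the abstract language *)

(* Position [p] of the stack, or table entry, of indices [x] and [y]; the
   products with [S] are looked up in tables of multiples. *)
Definition pos (S x y p : nat) := x * (S * S) + y * S + p.

Lemma pos_decode S x y p : y < S -> p < S ->
  [/\ pos S x y p %/ (S * S) = x, pos S x y p %/ S %% S = y & pos S x y p %% S = p].
Proof.
move=> hy hp; have hS : 0 < S by lia.
have e : pos S x y p = (x * S + y) * S + p by rewrite /pos; lia.
split.
- by rewrite divnMA e !divnMDl // !(divn_small hp, divn_small hy) addn0 divnMDl // divn_small // addn0.
- by rewrite e divnMDl // divn_small // addn0 modnMDl modn_small.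
- by rewrite e modnMDl modn_small.
Qed.

Lemma pos_encode S a : pos S (a %/ (S * S)) (a %/ S %% S) (a %% S) = a.
Proof. by rewrite /pos divnMA mulnA -mulnDl -divn_eq -divn_eq. Qed.

(* Families 0-15 and 16-31 hold the two components of the stack entries, 32-47
   the heights of the stacks, 48-61 the tables. *)
Definition layout (s : astate) (j x y p : nat) : nat :=
  if j < 16 then (nth (0, 0) (stk s j x y) p).1
  else if j < 32 then (nth (0, 0) (stk s (j - 16) x y) p).2
  else if p == 0 then
    if j < 48 then size (stk s (j - 32) x y) else cell s (j - 48) x y
  else 0.

(** Memories 62 and 63 are the tables of multiples. In the other memories every address is
    prescribed, also those with a huge first index, so untouched zero cells represent empty stacks
    and null table entries. *)
Definition stores (S : nat) (m : nat -> nat) (f : nat -> nat -> nat -> nat -> nat) : Prop :=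
  [/\ forall j a, j < 62 -> m (64 * a + j) = f j (a %/ (S * S)) (a %/ S %% S) (a %% S),
      forall i, i < S -> m (64 * i + 62) = i * (S * S)
    & forall i, i < S -> m (64 * i + 63) = i * S].

Lemma stores_read S m f j x y p : stores S m f -> j < 62 -> y < S -> p < S ->
  m (64 * pos S x y p + j) = f j x y p.
Proof. by move=> [h _ _] hj hy hp; rewrite h //; have [-> -> ->] := pos_decode x hy hp. Qed.

Lemma stores_write S m f j x y p v f' : stores S m f -> j < 62 -> y < S -> p < S ->
  (forall j' x' y' p', f' j' x' y' p' =
     if [&& j' == j, x' == x, y' == y & p' == p] then v else f j' x' y' p') ->
  stores S (upd m (64 * pos S x y p + j) v) f'.
Proof.
move=> [h1 h2 h3] hj hy hp hf; have [d1 d2 d3] := pos_decode x hy hp.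
split=> [j' a hj'|i hi|i hi].
- rewrite /upd hf h1 //; congr (if _ then _ else _); apply/eqP/and4P.
    move=> e; have -> : j' = j by lia.
    have -> : a = pos S x y p by lia.
    by rewrite d1 d2 d3.
  by move=> [/eqP -> /eqP e1 /eqP e2 /eqP e3]; rewrite -e1 -e2 -e3 pos_encode.
- by rewrite upd_ne ?h2 //; lia.
- by rewrite upd_ne ?h3 //; lia.
Qed.

Lemma stores_ext S m f f' : (forall j x y p, f j x y p = f' j x y p) ->
  stores S m f -> stores S m f'.
Proof. by move=> e [h1 h2 h3]; split=> // j a hj; rewrite h1. Qed.

(* Machine code for the operations on tables and stacks *)
Opaque lea.
Arguments reffs : simpl never.

Lemma reffs_cons B i l s : reffs B (i :: l) s = obind (reffs B l) (reff B i s).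
Proof. by []. Qed.

(** Looks up the multiples of [S * S] and of [S] given by registers [y] and [z], adds the offset and
    scales the sum by 64. Registers 7 and 11 are scratch. Three uses of [lea] and four other
    instructions make 28. *)
Definition loc (j y z p t : nat) : seq instr :=
  lea 62 t y ++ [:: ILoad t t] ++ lea 63 11 z ++
  [:: ILoad 11 11; IAdd t t 11; IAdd t t p] ++ lea j t t.

Lemma loc_eff B S f j y z p t s :
  stores S (rmem s) f -> t \notin [:: 7; 11] ->
  y \notin [:: 7; 11; t] -> z \notin [:: 7; 11; t] -> p \notin [:: 7; 11; t] ->
  rreg s y < S -> rreg s z < S -> j < 64 ->
  64 * pos S (rreg s y) (rreg s z) (rreg s p) + 64 <= B -> 64 * S + 64 <= B ->
  exists2 R', reffs B (loc j y z p t) s = Some (RState R' (rmem s) (rtick s + 28))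
    & R' t = 64 * pos S (rreg s y) (rreg s z) (rreg s p) + j /\
      forall x : nat, x \notin [:: 7; 11; t] -> R' x = rreg s x.
Proof.
rewrite !inE !negb_or => -[_ hm2 hm1] /andP [t7 t11] /and3P [y7 y11 yt] /and3P [z7 z11 zt]
  /and3P [p7 p11 pt] hy hz hj hB hS.
have hp1 : rreg s y * (S * S) <= pos S (rreg s y) (rreg s z) (rreg s p) by rewrite /pos; lia.
have hp2 : rreg s z * S <= pos S (rreg s y) (rreg s z) (rreg s p) by rewrite /pos; lia.
rewrite /loc reffs_cat.
have [|R1 -> [t1 o1]] := @lea_eff B 62 t y s t7 y7; first by lia.
rewrite /= reffs_cons /= /rset t1 hm2 //.
have -> : rreg s y * (S * S) <= B by lia.
rewrite /= reffs_cat.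
set s1 := RState _ _ _.
have e1 : rreg s1 z = rreg s z by rewrite /= upd_ne // o1.
have [|R2 -> [t2 o2]] := @lea_eff B 63 11 z s1 isT z7; first by rewrite e1; lia.
rewrite /= reffs_cons /= /rset t2 e1 hm1 //.
have -> : rreg s z * S <= B by lia.
have et : R2 t = rreg s y * (S * S) by rewrite o2 //= upd_eq.
have ep : R2 p = rreg s p by rewrite o2 //= upd_ne // o1.
rewrite /= reffs_cons /= /rset upd_eq upd_ne // et.
have -> : rreg s y * (S * S) + rreg s z * S <= B.
  by rewrite /pos in hB; lia.
rewrite /= reffs_cons /= /rset upd_eq upd_ne // upd_ne // ep.
have -> : rreg s y * (S * S) + rreg s z * S + rreg s p <= B.
  by rewrite /pos in hB; lia.
rewrite /=; set s2 := RState _ _ _.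
have e2 : rreg s2 t = pos S (rreg s y) (rreg s z) (rreg s p) by rewrite /= upd_eq.
have [|R3 -> [t3 o3]] := @lea_eff B j t t s2 t7 t7; first by rewrite e2; lia.
exists R3; first by congr (Some (RState _ _ _)); rewrite /=; lia.
split; first by rewrite t3 e2.
move=> x; rewrite !inE !negb_or => /and3P [x7 x11 xt].
by rewrite o3 //= !upd_ne // o2 //= upd_ne // o1.
Qed.

Definition does (B : nat) (l : seq instr) (s : rstate) (Q : rstate -> Prop) : Prop :=
  exists2 s', reffs B l s = Some s' & Q s'.

Lemma does_nil B s (Q : rstate -> Prop) : Q s -> does B [::] s Q.
Proof. by exists s. Qed.

Lemma does_cat B l1 l2 s Q :
  does B l1 s (fun s1 => does B l2 s1 Q) -> does B (l1 ++ l2) s Q.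
Proof. by move=> [s1 h1 [s2 h2 hQ]]; exists s2; rewrite // reffs_cat h1. Qed.

Lemma does_cons B i l s s1 Q : reff B i s = Some s1 -> does B l s1 Q -> does B (i :: l) s Q.
Proof. by move=> h [s2 h2 hQ]; exists s2; rewrite // reffs_cons h. Qed.

Lemma does_set B i l R M t r v Q :
  reff B i (RState R M t) = rset B (RState R M t) r v -> v <= B ->
  does B l (RState (upd R r v) M t.+1) Q -> does B (i :: l) (RState R M t) Q.
Proof. by move=> h hv; apply: does_cons; rewrite h /rset hv. Qed.

Lemma does_store B a b l R M t Q : R b <= B ->
  does B l (RState R (upd M (R a) (R b)) t.+1) Q -> does B (IStore a b :: l) (RState R M t) Q.
Proof. by move=> h; apply: does_cons; rewrite /= h. Qed.

Lemma does_loc B S f j y z p t l R M k Q :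
  stores S M f -> t \notin [:: 7; 11] ->
  y \notin [:: 7; 11; t] -> z \notin [:: 7; 11; t] -> p \notin [:: 7; 11; t] ->
  R y < S -> R z < S -> j < 64 ->
  64 * pos S (R y) (R z) (R p) + 64 <= B -> 64 * S + 64 <= B ->
  (forall R', R' t = 64 * pos S (R y) (R z) (R p) + j ->
     (forall x : nat, x \notin [:: 7; 11; t] -> R' x = R x) ->
     does B l (RState R' M (k + 28)) Q) ->
  does B (loc j y z p t ++ l) (RState R M k) Q.
Proof.
move=> hS h1 h2 h3 h4 h5 h6 h7 h8 h9 h; apply: does_cat.
have [R' e [e1 e2]] := @loc_eff B S f j y z p t (RState R M k) hS h1 h2 h3 h4 h5 h6 h7 h8 h9.
by exists (RState R' M (k + 28)) => //; apply: h.
Qed.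

(** Variable [x] lives in register [4 * x]. [Pop] overwrites the vacated entry by zeros, because
    [layout] reads zero from the height of a stack on. *)
Definition acode (a : aop) : seq instr :=
  match a with
  | Cst x k => [:: IConst (4 * x) k]
  | Mov x y => [:: IConst 15 0; IAdd (4 * x) (4 * y) 15]
  | Inc x => [:: IConst 15 1; IAdd (4 * x) (4 * x) 15]
  | Diff x y z => [:: ISub (4 * x) (4 * y) (4 * z)]
  | Get x j y z =>
      IConst 15 0 :: loc (48 + j) (4 * y) (4 * z) 15 3 ++ [:: ILoad (4 * x) 3]
  | Put j y z x =>
      IConst 15 0 :: loc (48 + j) (4 * y) (4 * z) 15 3 ++ [:: IStore 3 (4 * x)]
  | Push j y z x1 x2 =>
      IConst 15 0 :: loc (32 + j) (4 * y) (4 * z) 15 19 ++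
      ILoad 15 19 :: loc j (4 * y) (4 * z) 15 3 ++
      IStore 3 (4 * x1) :: loc (16 + j) (4 * y) (4 * z) 15 3 ++
      [:: IStore 3 (4 * x2); IConst 23 1; IAdd 15 15 23; IStore 19 15]
  | Pop x1 x2 j y z =>
      IConst 15 0 :: loc (32 + j) (4 * y) (4 * z) 15 19 ++
      [:: ILoad 15 19; IConst 23 1; ISub 15 15 23; IStore 19 15; IConst 23 0] ++
      loc (16 + j) (4 * y) (4 * z) 15 3 ++
      [:: ILoad 27 3; IStore 3 23] ++ loc j (4 * y) (4 * z) 15 3 ++
      [:: ILoad (4 * x1) 3; IStore 3 23; IAdd (4 * x2) 27 23]
  | Len x j y z =>
      IConst 15 0 :: loc (32 + j) (4 * y) (4 * z) 15 3 ++ [:: ILoad (4 * x) 3]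
  | Nth x1 x2 j y z i =>
      loc (16 + j) (4 * y) (4 * z) (4 * i) 3 ++
      ILoad 27 3 :: loc j (4 * y) (4 * z) (4 * i) 3 ++
      [:: ILoad (4 * x1) 3; IConst 23 0; IAdd (4 * x2) 27 23]
  end.

Definition awf_op (a : aop) : bool :=
  match a with
  | Get _ j _ _ | Put j _ _ _ => j < 14
  | Push j _ _ _ _ | Pop _ _ j _ _ | Len _ j _ _ | Nth _ _ j _ _ _ => j < 16
  | _ => true
  end.

Definition cap (S : nat) := 64 * (S * (S * S) + S * S + S) + 64.

(** Registers congruent to 1 and 2 modulo 4 stay null: they are reserved for the two embedded
    programs, which start from null registers except for register 0. *)
Record arel (S : nat) (s : astate) (u : rstate) : Prop := ARel {
  arel_va : forall x, rreg u (4 * x) = va s x;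
  arel_mem : stores S (rmem u) (layout s);
  arel_1 : forall x, rreg u (4 * x + 1) = 0;
  arel_2 : forall x, rreg u (4 * x + 2) = 0 }.

Lemma pos_cap S x y p : x < S -> y < S -> p < S -> 64 * pos S x y p + 64 <= cap S.
Proof.
move=> hx hy hp; rewrite /pos /cap.
have h1 : x * (S * S) <= S * (S * S) by rewrite leq_mul2r ltnW ?orbT.
have h2 : y * S <= S * S by rewrite leq_mul2r ltnW ?orbT.
lia.
Qed.

Lemma layout_cell S M s j x y : stores S M (layout s) -> j < 14 -> y < S -> 0 < S ->
  M (64 * pos S x y 0 + (48 + j)) = cell s j x y.
Proof.
move=> h hj hy hS; rewrite (stores_read x h) //.
have -> : j = (48 + j) - 48 by lia.
have : 48 <= 48 + j by lia.
rewrite subnKC; last by lia.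
move: (48 + j) => k hk; rewrite /layout eqxx.
by do 3 (rewrite ifF; last by lia).
Qed.

Lemma layout_len S M s j x y : stores S M (layout s) -> j < 16 -> y < S -> 0 < S ->
  M (64 * pos S x y 0 + (32 + j)) = size (stk s j x y).
Proof.
move=> h hj hy hS; rewrite (stores_read x h) //; last by lia.
have -> : j = (32 + j) - 32 by lia.
have : 32 <= 32 + j < 48 by lia.
rewrite subnKC; last by lia.
move: (32 + j) => k hk; rewrite /layout eqxx.
by do 2 (rewrite ifF; last by lia); rewrite ifT; last by lia.
Qed.

Lemma layout_fst S M s j x y p : stores S M (layout s) -> j < 16 -> y < S -> p < S ->
  M (64 * pos S x y p + j) = (nth (0, 0) (stk s j x y) p).1.
Proof.
move=> h hj hy hp; rewrite (stores_read x h) //; last by lia.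
by rewrite /layout hj.
Qed.

Lemma layout_snd S M s j x y p : stores S M (layout s) -> j < 16 -> y < S -> p < S ->
  M (64 * pos S x y p + (16 + j)) = (nth (0, 0) (stk s j x y) p).2.
Proof.
move=> h hj hy hp; rewrite (stores_read x h) //; last by lia.
have -> : j = (16 + j) - 16 by lia.
have : 16 <= 16 + j < 32 by lia.
rewrite subnKC; last by lia.
move: (16 + j) => k hk; rewrite /layout.
by rewrite ifF; [rewrite ifT //; lia | lia].
Qed.

Definition updf (f : nat -> nat -> nat -> nat -> nat) j x y p v :=
  fun j' x' y' p' =>
    if [&& j' == j, x' == x, y' == y & p' == p] then v else f j' x' y' p'.

Lemma stores_updf S m f j x y p v : stores S m f -> j < 62 -> y < S -> p < S ->
  stores S (upd m (64 * pos S x y p + j) v) (updf f j x y p v).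
Proof. by move=> h hj hy hp; apply: stores_write h hj hy hp _. Qed.

Lemma layout_put s j x y v j' x' y' p' :
  layout (aput s j x y v) j' x' y' p' = updf (layout s) (48 + j) x y 0 v j' x' y' p'.
Proof.
rewrite /updf /layout /= /upd3.
have -> : (j' == 48 + j) = (48 <= j') && (j' - 48 == j) by lia.
case: (ltnP j' 16) => h1; first by rewrite ifF //; lia.
case: (ltnP j' 32) => h2; first by rewrite ifF //; lia.
case: (ltnP j' 48) => h3 /=; first by [].
by case: (p' == 0); rewrite ?andbT ?andbF //.
Qed.

Lemma layout_push s j x y q j' x' y' p' : j < 16 ->
  let l := stk s j x y in let n := size l in
  layout (astk s j x y (rcons l q)) j' x' y' p' =
  updf (updf (updf (layout s) j x y n q.1) (16 + j) x y n q.2) (32 + j) x y 0 n.+1 j' x' y' p'.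
Proof.
move=> hj l n; rewrite /updf /layout /= /upd3.
have -> : (j' == 16 + j) = (16 <= j') && (j' - 16 == j) by lia.
have -> : (j' == 32 + j) = (32 <= j') && (j' - 32 == j) by lia.
have H : nth (0, 0) (rcons l q) p' = if p' == n then q else nth (0, 0) l p'.
  rewrite nth_rcons; case: ltngtP => // h; by rewrite nth_default // ltnW.
case: (ltnP j' 16) => h1.
  have -> /= : (32 <= j') = false by lia.
  case: (j' =P j) => [->|] //=; case: (x' =P x) => [->|] //=; case: (y' =P y) => [->|] //=.
  by rewrite H; case: eqP.
have -> : (j' == j) = false by lia.
case: (ltnP j' 32) => h2 /=.
  case: (j' - 16 =P j) => [->|] //=; case: (x' =P x) => [->|] //=; case: (y' =P y) => [->|] //=.
  by rewrite H; case: eqP.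
have -> : (j' - 16 == j) = false by lia.
case: (ltnP j' 48) => h3 /=; last first.
  have -> : (j' - 32 == j) = false by lia.
  by [].
case: (p' == 0); rewrite ?andbF // ?andbT.
case: (j' - 32 =P j) => [->|] //=; case: (x' =P x) => [->|] //=; case: (y' =P y) => //= _.
by rewrite size_rcons.
Qed.

Lemma layout_pop s j x y j' x' y' p' t v : j < 16 ->
  let l := stk s j x y in let n := (size l).-1 in
  layout (AState v (cell s) (upd3 (stk s) j x y (take n l)) t) j' x' y' p' =
  updf (updf (updf (layout s) (32 + j) x y 0 n) (16 + j) x y n 0) j x y n 0 j' x' y' p'.
Proof.
move=> hj l n; rewrite /updf /layout /= /upd3.
have -> : (j' == 16 + j) = (16 <= j') && (j' - 16 == j) by lia.
have -> : (j' == 32 + j) = (32 <= j') && (j' - 32 == j) by lia.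
have H : nth (0, 0) (take n l) p' = if p' == n then (0, 0) else nth (0, 0) l p'.
  case: (ltngtP p' n) => h.
  - by rewrite nth_take.
  - by rewrite !nth_default // ?size_take; [rewrite /n in h *; lia | case: ifP; lia].
  - by rewrite nth_default // size_take; case: ifP; lia.
case: (ltnP j' 16) => h1.
  have -> /= : (32 <= j') = false by lia.
  case: (j' =P j) => [->|] //=; case: (x' =P x) => [->|] //=; case: (y' =P y) => [->|] //=.
  by rewrite H; case: eqP.
have -> : (j' == j) = false by lia.
case: (ltnP j' 32) => h2 /=.
  case: (j' - 16 =P j) => [->|] //=; case: (x' =P x) => [->|] //=; case: (y' =P y) => [->|] //=.
  by rewrite H; case: eqP.
have -> : (j' - 16 == j) = false by lia.
case: (ltnP j' 48) => h3 /=; last first.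
  have -> : (j' - 32 == j) = false by lia.
  by [].
case: (p' == 0); rewrite ?andbF // ?andbT.
case: (j' - 32 =P j) => [->|] //=; case: (x' =P x) => [->|] //=; case: (y' =P y) => //= _.
by rewrite size_take; case: ifP; lia.
Qed.

(** [Push] and [Pop] are the longest, with three address computations of 28 instructions each and a
    few others; 130 leaves room. Bounding the state both before and after the operation by [N < S]
    keeps all indices decodable and all stored values below [B]. *)
Lemma acode_ok S N B a s u : awf_op a -> arel S s u -> abound N s ->
  abound N (aeff a s) -> N < S -> cap S <= B ->
  does B (acode a) u (fun u' => arel S (aeff a s) u' /\
    rtick u' <= rtick u + 130).
Proof.
case: u => R M t hw [/= hva hm hr1 hr2] [b1 b2 b3 b4] [c1 c2 c3 c4] hN hB.
have hS : 0 < S by lia.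
have vS x : va s x < S by apply: leq_ltn_trans hN.
have SB : 64 * S + 64 <= B.
  apply: leq_trans hB; rewrite /cap leq_add2r leq_mul2l /=.
  exact: leq_addl.
have NB n : n <= N -> n <= B by lia.
have relset R' x v t' t2 : (forall y, y %% 4 != 3 -> R' y = R y) ->
    arel S (AState (upd (va s) x v) (cell s) (stk s) t') (RState (upd R' (4 * x) v) M t2).
  move=> e; split=> //= y.
  - rewrite /upd -hva e; last by lia.
    by have -> : (4 * y == 4 * x) = (y == x) by apply/eqP/eqP; lia.
  - by rewrite upd_ne ?e //; lia.
  - by rewrite upd_ne ?e //; lia.
have relmem R' M' s' t2 : (forall y, y %% 4 != 3 -> R' y = R y) -> va s' = va s ->
    stores S M' (layout s') -> arel S s' (RState R' M' t2).
  by move=> e ev hM; split=> //= y; rewrite e ?ev //; lia.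
have locate f j y z p n t' tt l R' M' Q : stores S M' f ->
    tt \in [:: 3; 19] -> p \notin [:: 7; 11; tt] -> R' p = n ->
    R' (4 * y) = va s y -> R' (4 * z) = va s z -> n < S -> j < 64 ->
    (forall R2, R2 tt = 64 * pos S (va s y) (va s z) n + j ->
       (forall x : nat, x \notin [:: 7; 11; tt] -> R2 x = R' x) ->
       does B l (RState R2 M' (t' + 28)) Q) ->
    does B (loc j (4 * y) (4 * z) p tt ++ l) (RState R' M' t') Q.
  move=> hm' htt hp hn hy hz hnS hj h.
  have htt' : (tt == 3) || (tt == 19) by move: htt; rewrite !inE.
  apply: (does_loc hm') => //; rewrite ?hy ?hz ?hn //; try by rewrite !inE; lia.
  by apply: leq_trans hB; apply: pos_cap.
have R15 v x : x %% 4 != 3 -> upd R 15 v x = R x by move=> hx; apply: upd_ne; lia.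
case: a hw c1 c2 c3 c4 => [x k|x y|x|x y z|x j y z|j y z x|j y z x1 x2|x1 x2 j y z|x j y z|x1 x2 j y z i] /= hw c1 c2 c3 c4.
- apply: does_set => //; first by have := c1 x; rewrite upd_eq; apply: NB.
  by apply: does_nil; split; [exact: relset | rewrite /=; lia].
- apply: does_set => //; apply: (does_set (v := va s y)).
  + by rewrite /= upd_eq R15 ?hva ?addn0 //; lia.
  + exact: NB.
  by apply: does_nil; split; [by apply: relset => w; apply: R15 | rewrite /=; lia].
- apply: does_set => //; first by apply: leq_trans SB; lia.
  apply: (does_set (v := (va s x).+1)).
  + by rewrite /= upd_eq R15 ?hva ?addn1 //; lia.
  + by have := c1 x; rewrite upd_eq; apply: NB.
  by apply: does_nil; split; [by apply: relset => w; apply: R15 | rewrite /=; lia].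
- apply: (does_set (v := va s y - va s z)); first by rewrite /= !hva.
    by have := c1 x; rewrite upd_eq; apply: NB.
  by apply: does_nil; split; [exact: relset | rewrite /=; lia].
- apply: does_set => //.
  apply: (locate (layout s) _ _ _ _ 0) => //; rewrite ?upd_eq ?R15 ?hva //; try by lia.
  move=> R2 e2 k2; apply: (does_set (v := cell s j (va s y) (va s z))).
  + by rewrite /= e2 (layout_cell _ hm).
  + exact: NB.
  apply: does_nil; split; last by rewrite /=; lia.
  by apply: relset => w hw'; rewrite k2 ?R15 // !inE; lia.
- apply: does_set => //.
  apply: (locate (layout s) _ _ _ _ 0) => //; rewrite ?upd_eq ?R15 ?hva //; try by lia.
  move=> R2 e2 k2; have ex : R2 (4 * x) = va s x by rewrite k2 ?R15 ?hva // ?inE; lia.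
  apply: does_store; rewrite ex; first exact: NB.
  apply: does_nil; split; last by rewrite /=; lia.
  apply: relmem => //; first by move=> w hw'; rewrite k2 ?R15 // !inE; lia.
  apply: stores_ext (fun j' x' y' p' => esym (layout_put _ _ _ _ _ _ _ _ _)) _.
  by rewrite e2; apply: stores_updf => //; lia.
- apply: does_set => //.
  apply: (locate (layout s) _ _ _ _ 0) => //; rewrite ?upd_eq ?R15 ?hva //; try by lia.
  move=> R2 e2 k2; set n := size (stk s j (va s y) (va s z)).
  have hn : n <= N by exact: b3.
  apply: (does_set (v := n)); [by rewrite /= e2 (layout_len _ hm) | exact: NB | ].
  have k3 w : w %% 4 != 3 -> upd R2 15 n w = R w.
    by move=> hw'; rewrite upd_ne; [rewrite k2 ?R15 // !inE | ]; lia.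
  apply: (locate (layout s) _ _ _ _ n) => //; rewrite ?upd_eq ?k3 ?hva //; try by lia.
  move=> R4 e4 k4; have k4' w : w %% 4 != 3 -> R4 w = R w.
    by move=> hw'; rewrite k4 ?k3 // !inE; lia.
  have x4 : R4 (4 * x1) = va s x1 by rewrite k4' ?hva //; lia.
  apply: does_store; rewrite ?x4 ?e4; first exact: NB.
  have hj6 : j < 62 by lia.
  have hm4 := stores_updf (va s y) (va s x1) hm hj6 (vS z) (leq_ltn_trans hn hN).
  have n15 : R4 15 = n by rewrite k4 // upd_eq.
  apply: (locate _ _ _ _ _ n _ _ _ _ _ _ hm4) => //; rewrite ?k4' ?hva //; try by lia.
  move=> R5 e5 k5; have k5' w : w %% 4 != 3 -> R5 w = R w.
    by move=> hw'; rewrite k5 ?k4' // !inE; lia.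
  have x5 : R5 (4 * x2) = va s x2 by rewrite k5' ?hva //; lia.
  apply: does_store; rewrite ?x5 ?e5; first exact: NB.
  have hj6' : 16 + j < 62 by lia.
  have hm5 := stores_updf (va s y) (va s x2) hm4 hj6' (vS z) (leq_ltn_trans hn hN).
  apply: does_set => //; first by apply: leq_trans SB; lia.
  have n15' : R5 15 = n by rewrite k5.
  apply: (does_set (v := n.+1)).
  + by rewrite /= upd_eq upd_ne // n15' addn1.
  + by apply: NB; have := c3 j (va s y) (va s z); rewrite /upd3 !eqxx /= size_rcons.
  have e19 : upd (upd R5 23 1) 15 n.+1 19 = 64 * pos S (va s y) (va s z) 0 + (32 + j).
    by rewrite !upd_ne // k5 // k4 // upd_ne.
  apply: does_store; rewrite ?e19 ?upd_eq.
    by apply: NB; have := c3 j (va s y) (va s z); rewrite /upd3 !eqxx /= size_rcons.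
  have hj6'' : 32 + j < 62 by lia.
  have hm6 := stores_updf (va s y) n.+1 hm5 hj6'' (vS z) hS.
  apply: does_nil; split; last by rewrite /=; lia.
  apply: relmem => //; first by move=> w hw'; rewrite !upd_ne ?k5' //; lia.
  apply: stores_ext hm6 => j' x' y' p'; symmetry.
  exact: (layout_push s (va s y) (va s z) (va s x1, va s x2)).
- apply: does_set => //.
  apply: (locate (layout s) _ _ _ _ 0) => //; rewrite ?upd_eq ?R15 ?hva //; try by lia.
  move=> R2 e2 k2; set l := stk s j (va s y) (va s z); set n := size l.
  have hn : n <= N by exact: b3.
  apply: (does_set (v := n)); [by rewrite /= e2 (layout_len _ hm) | exact: NB | ].
  apply: does_set => //; first by apply: leq_trans SB; lia.
  apply: (does_set (v := n.-1)).
  + by rewrite /= upd_eq upd_ne // upd_eq subn1.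
  + by apply: NB; lia.
  set R3 := upd _ 15 n.-1.
  have k3 w : w %% 4 != 3 -> R3 w = R w.
    by move=> hw'; rewrite /R3 !upd_ne; [rewrite k2 ?R15 // !inE | | | ]; lia.
  have e19 : R3 19 = 64 * pos S (va s y) (va s z) 0 + (32 + j) by rewrite /R3 !upd_ne.
  have e15 : R3 15 = n.-1 by rewrite /R3 upd_eq.
  apply: does_store; rewrite ?e19 ?e15; first by apply: NB; lia.
  have hn1 : n.-1 < S by lia.
  have hj1 : 32 + j < 62 by lia.
  have hm1 := stores_updf (va s y) n.-1 hm hj1 (vS z) hS.
  apply: does_set => //.
  set R4 := upd R3 23 0.
  have k4 w : w %% 4 != 3 -> R4 w = R w by move=> hw'; rewrite /R4 upd_ne ?k3 //; lia.
  apply: (locate _ _ _ _ _ n.-1 _ _ _ _ _ _ hm1) => //; rewrite ?k4 ?hva //; try by lia.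
  move=> R5 e5 k5; have k5' w : w %% 4 != 3 -> R5 w = R w.
    by move=> hw'; rewrite k5 ?k4 // !inE; lia.
  set q := last (0, 0) l.
  have q2 : nth (0, 0) l n.-1 = q by rewrite /q last_nth00.
  have hq := b4 j (va s y) (va s z) n.-1; rewrite -/l q2 in hq; case: hq => hq1 hq2.
  have hj2 : 16 + j < 62 by lia.
  apply: (does_set (v := q.2)); [ | exact: NB | ].
    rewrite /= e5 (stores_read _ hm1) // /updf ifF; last by lia.
    have := layout_snd (va s y) hm hw (vS z) hn1; rewrite (stores_read _ hm) //.
    by move=> ->; rewrite -/l q2.
  set R6 := upd R5 27 q.2.
  have k6 w : w %% 4 != 3 -> R6 w = R w by move=> hw'; rewrite /R6 upd_ne ?k5' //; lia.
  have e6 : R6 3 = 64 * pos S (va s y) (va s z) n.-1 + (16 + j) by rewrite /R6 upd_ne.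
  have e6' : R6 23 = 0 by rewrite /R6 upd_ne // k5 // /R4 upd_eq.
  apply: does_store; rewrite ?e6 ?e6' //.
  have hm2 := stores_updf (va s y) 0 hm1 hj2 (vS z) hn1.
  have e6'' : R6 15 = n.-1 by rewrite /R6 upd_ne // k5 // /R4 upd_ne.
  apply: (locate _ _ _ _ _ n.-1 _ _ _ _ _ _ hm2) => //; rewrite ?k6 ?hva //; try by lia.
  move=> R7 e7 k7; have k7' w : w %% 4 != 3 -> R7 w = R w.
    by move=> hw'; rewrite k7 ?k6 // !inE; lia.
  have hj3 : j < 62 by lia.
  apply: (does_set (v := q.1)); [ | exact: NB | ].
    rewrite /= e7 (stores_read _ hm2) // /updf ifF; last by lia.
    rewrite ifF; last by lia.
    have := layout_fst (va s y) hm hw (vS z) hn1; rewrite (stores_read _ hm) //.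
    by move=> ->; rewrite -/l q2.
  set R8 := upd R7 (4 * x1) q.1.
  have e8 : R8 3 = 64 * pos S (va s y) (va s z) n.-1 + j by rewrite /R8 upd_ne //; lia.
  have e8' : R8 23 = 0 by rewrite /R8 upd_ne ?k7 //; lia.
  apply: does_store; rewrite ?e8 ?e8' //.
  have hm3 := stores_updf (va s y) 0 hm2 hj3 (vS z) hn1.
  apply: (does_set (v := q.2)); [ | exact: NB | ].
    rewrite /= e8' addn0; congr rset; rewrite /R8 upd_ne; last by lia.
    by rewrite k7 // /R6 upd_eq.
  apply: does_nil; split; last by rewrite /=; lia.
  have [v1 _ w1 w2] := relset R7 x1 q.1 0 0 k7'.
  split=> /=.
  + move=> w; rewrite {1}/upd; have -> : (4 * w == 4 * x2) = (w == x2) by apply/eqP/eqP; lia.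
    by rewrite [in RHS]/upd; case: eqP => // _; apply: v1.
  + apply: stores_ext hm3 => j' x' y' p'; symmetry.
    exact: (layout_pop s (va s y) (va s z) _ _ _ _ _ _ hw).
  + by move=> w; rewrite upd_ne; [exact: w1 | lia].
  + by move=> w; rewrite upd_ne; [exact: w2 | lia].
- apply: does_set => //.
  apply: (locate (layout s) _ _ _ _ 0) => //; rewrite ?upd_eq ?R15 ?hva //; try by lia.
  move=> R2 e2 k2; apply: (does_set (v := size (stk s j (va s y) (va s z)))).
  + by rewrite /= e2 (layout_len _ hm).
  + exact: NB.
  apply: does_nil; split; last by rewrite /=; lia.
  by apply: relset => w hw'; rewrite k2 ?R15 // !inE; lia.
- have hj1 : 16 + j < 62 by lia.
  apply: (locate (layout s) _ _ _ _ (va s i)) => //; rewrite ?inE //; try by lia.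
  move=> R2 e2 k2; have k2' w : w %% 4 != 3 -> R2 w = R w by move=> hw'; rewrite k2 // !inE; lia.
  set q := nth (0, 0) (stk s j (va s y) (va s z)) (va s i).
  have [hq1 hq2] := b4 j (va s y) (va s z) (va s i).
  apply: (does_set (v := q.2)); [by rewrite /= e2 (layout_snd _ hm) | exact: NB | ].
  set R3 := upd _ _ _; have k3 w : w %% 4 != 3 -> R3 w = R w by move=> hw'; rewrite /R3 upd_ne ?k2' //; lia.
  apply: (locate (layout s) _ _ _ _ (va s i)) => //; rewrite ?inE ?k3 ?hva //; try by lia.
  move=> R4 e4 k4; have k4' w : w %% 4 != 3 -> R4 w = R w by move=> hw'; rewrite k4 ?k3 // !inE; lia.
  apply: (does_set (v := q.1)); [by rewrite /= e4 (layout_fst _ hm) | exact: NB | ].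
  apply: does_set => //.
  apply: (does_set (v := q.2)); [ | exact: NB | ].
    rewrite /= upd_eq addn0; congr rset; rewrite !upd_ne; try by lia.
    by rewrite k4 // /R3 upd_eq.
  apply: does_nil; split; last by rewrite /=; lia.
  have k5 w : w %% 4 != 3 -> R4 w = R w by exact: k4'.
  have [v1 v2 w1 w2] := relset R4 x1 q.1 0 0 k5.
  split=> //=.
  + move=> w; rewrite {1}/upd; have -> : (4 * w == 4 * x2) = (w == x2) by apply/eqP/eqP; lia.
    rewrite [in RHS]/upd; case: eqP => // _; rewrite upd_ne; [exact: v1 | lia].
  + by move=> w; rewrite !upd_ne; try lia; rewrite k4'; [exact: hr1 | lia].
  + by move=> w; rewrite !upd_ne; try lia; rewrite k4'; [exact: hr2 | lia].
Qed.

Fixpoint acompile (c : acmd) : cmd instr :=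
  match c with
  | Skip => Skip
  | Atom a => block (acode a)
  | Seq c1 c2 => Seq (acompile c1) (acompile c2)
  | If x c1 c2 => If (4 * x) (acompile c1) (acompile c2)
  | While x c => While (4 * x) (acompile c)
  end.

Fixpoint awf (c : acmd) : bool :=
  match c with
  | Skip => true
  | Atom a => awf_op a
  | Seq c1 c2 | If _ c1 c2 => awf c1 && awf c2
  | While _ c => awf c
  end.

Lemma wp_does B l s Q : does B l s Q -> @wp (ram B) (block l) Q s.
Proof. by move=> [s' h hQ]; apply: wp_block h hQ. Qed.

Lemma wp_does_test B l R M t Q : does B l (RState R M t.+2) Q ->
  @wp (ram B) (block l) Q (@test (ram B) (RState R M t)).
Proof. exact: wp_does. Qed.

Lemma abound_mono N N' s : N <= N' -> abound N s -> abound N' s.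
Proof.
move=> hn [h1 h2 h3 h4]; split=> *; try by apply: leq_trans hn.
by split; apply: leq_trans hn; apply h4.
Qed.

Lemma arel_test S s u : arel S s u -> arel S (atest s) (rtest u).
Proof. by case. Qed.

(** By [abound_exec] no value exceeds the initial bound plus the elapsed time, so an [S] above [N]
    plus the final clock keeps every index of the whole execution below [S]. *)
Theorem acompile_correct S N B c s s' : @exec alang c s s' -> awf c ->
  abound (N + atick s) s -> N + atick s' < S -> cap S <= B ->
  forall u, arel S s u -> exists u', [/\ @exec (ram B) (acompile c) u u', arel S s' u'
    & rtick u' + 130 * atick s <= rtick u + 130 * atick s'].
Proof.
move=> he hw hb hS hB; elim: he hw hb hS => {c s s'} /=.
- by move=> s _ _ _ u hu; exists u; split=> //; constructor.
- move=> a s s' [<-] hw hb hS u hu.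
  have [u' hr [hu' ht]] := acode_ok hw hu
    (abound_mono (leq_add (leqnn N) (ltnW (atick_lt a s))) hb) (abound_eff a hb) hS hB.
  exists u'; split=> //; last by have := atick_lt a s; lia.
  have [u2 h2 e2] : @wp (ram B) (block (acode a)) (eq u') u by apply: wp_block hr erefl.
  by rewrite e2.
- move=> c1 c2 s1 s2 s3 he1 IH1 he2 IH2 /andP [hw1 hw2] hb hS u hu.
  have ht := @exec_tick alang _ _ _ he2.
  have hS1 : N + atick s2 < S by apply: leq_ltn_trans hS; rewrite leq_add2l.
  have [u1 [x1 r1 t1]] := IH1 hw1 hb hS1 u hu.
  have [u2 [x2 r2 t2]] := IH2 hw2 (abound_exec he1 hb) hS u1 r1.
  by exists u2; split=> //; [apply: ExSeq x1 x2 | lia].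
- move=> x c1 c2 s s' he IH /andP [hw1 hw2] hb hS u hu; have ha := arel_va hu.
  have hb' : abound (N + (atick s).+1) (atest s).
    by case: (abound_mono (_ : N + atick s <= N + (atick s).+1) hb); rewrite ?leq_add2l.
  have [|u' [x1 r1 t1]] := IH _ hb' hS (rtest u) (arel_test hu); first by case: ifP.
  exists u'; split=> //; last by move: t1 => /=; lia.
  by constructor; rewrite /= ha; move: x1; case: (va s x == 0).
- move=> x c s hx hw hb hS u hu; exists (rtest u); split=> /=; [ | exact: arel_test | lia].
  by constructor; rewrite /= (arel_va hu).
- move=> x c s1 s2 s3 hx he1 IH1 he2 IH2 hw hb hS u hu; have ha := arel_va hu.
  have ht := @exec_tick alang _ _ _ he2.
  have hS1 : N + atick s2 < S by apply: leq_ltn_trans hS; rewrite leq_add2l.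
  have hb' : abound (N + (atick s1).+1) (atest s1).
    by case: (abound_mono (_ : N + atick s1 <= N + (atick s1).+1) hb); rewrite ?leq_add2l.
  have [u1 [x1 r1 t1]] := IH1 hw hb' hS1 (rtest u) (arel_test hu).
  have [u2 [x2 r2 t2]] := IH2 hw (abound_exec he1 hb') hS u1 r1.
  exists u2; split=> //; last by move: t1 => /=; lia.
  by apply: ExWhileS x1 x2; rewrite /= ha.
Qed.

Arguments block : simpl never.

(** * Setting up the memory *)

(** The input, given at consecutive addresses, becomes a stack of family 2: entry [i] moves to
    [64 * i + 2] and its old cell is cleared. Going downwards is safe, as the target lies above [i]
    and the unread entries below. *)
Definition relocate : cmd instr :=
  Seq (block [:: IConst 27 1; IConst 15 0; IAdd 19 0 15])
      (While 19 (block ([:: ISub 19 19 27; ILoad 23 19; IStore 19 15] ++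
                        lea 2 3 19 ++ [:: IStore 3 23]))).

(* Registers 35 and 27 hold the number [S] of entries and the constant 1. *)
Definition fill (f r : nat) : cmd instr :=
  Seq (block [:: IConst 19 0; IConst 39 0; IAdd 43 35 15])
      (While 43 (block (lea f 3 19 ++
        [:: IStore 3 39; IAdd 39 39 r; IAdd 19 19 27; ISub 43 43 27]))).

(** [S] is obtained by adding [C] times the successor of the input size; the vertex number is found
    at address 2, where entry 0 has moved. Address 34 is the height of stack 2 at indices 0 and 0.
    The first [fill] ends with [S * S] in register 39, which is the increment of the second. *)
Definition setup (C : nat) : cmd instr :=
  Seq relocate
  (Seq (block ([:: IConst 3 2; ILoad 31 3; IAdd 31 31 0; IAdd 31 31 27; IConst 35 0] ++
               nseq C (IAdd 35 35 31) ++ [:: IConst 3 34; IStore 3 0; IConst 0 0]))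
  (Seq (fill 63 35)
  (Seq (block [:: IAdd 47 39 15]) (fill 62 47)))).

(** Memory when the entries from [i] on have been moved and those below [i] still wait: the
    invariant of the loop of [relocate]. *)
Definition relocated (s : seq nat) (i b : nat) : nat :=
  if b < i then nth 0 s b
  else if (b %% 64 == 2) && (i <= b %/ 64 < size s) then nth 0 s (b %/ 64) else 0.

Lemma does_lea B f t a l R M k Q : t != 7 -> a != 7 -> 64 * R a + f <= B ->
  (forall R', R' t = 64 * R a + f ->
     (forall x : nat, x != t -> x != 7 -> R' x = R x) ->
     does B l (RState R' M (k + 8)) Q) ->
  does B (lea f t a ++ l) (RState R M k) Q.
Proof.
move=> ht ha hB h; apply: does_cat.
have [R' e [e1 e2]] := @lea_eff B f t a (RState R M k) ht ha hB.
by exists (RState R' M (k + 8)) => //; apply: h.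
Qed.

Lemma relocate_ok B s R M t : R 0 = size s -> (forall b, M b = nth 0 s b) ->
  (forall x, R x <= B) -> (forall b, nth 0 s b <= B) -> 64 * size s + 64 <= B ->
  @wp (ram B) relocate (fun u => [/\ forall b, rmem u b = relocated s 0 b,
    (forall x, x \notin [:: 3; 7; 15; 19; 23; 27] -> rreg u x = R x),
    rreg u 15 = 0, rreg u 27 = 1 & rtick u <= t + 20 * size s + 10]) (RState R M t).
Proof.
move=> h0 hM hR hs hB; apply: wp_seq; apply: wp_does.
apply: does_set => //; first by lia.
apply: does_set => //.
apply: (does_set (v := size s)); first by rewrite /= !upd_eq !upd_ne // h0 addn0.
  by lia.
apply: does_nil.
pose I (u : rstate) := exists i, [/\ i <= size s, rreg u 19 = i,
  forall b, rmem u b = relocated s i b,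
  [/\ (forall x, x \notin [:: 3; 7; 15; 19; 23; 27] -> rreg u x = R x),
  rreg u 15 = 0 & rreg u 27 = 1] & rtick u + 20 * i <= t + 20 * size s + 3].
apply: (@wp_while (ram B) _ _ I _ (t + 20 * size s + 3)).
- exists (size s); split=> //=.
  + move=> b; rewrite hM /relocated; case: (ltnP b (size s)) => // hb.
    by rewrite nth_default // ifF //; lia.
  + split=> //.
    by move=> x; rewrite !inE !negb_or => /and5P [? ? ? ? /andP [? ?]]; rewrite !upd_ne.
  + by lia.
- by move=> u [i [_ _ _ _ h]] /=; lia.
- move=> [R1 M1 t1] [i [/= hi h19 hM1 [hR1 h15 h27] ht]] /= hi0.
  case: i => [|i] in hi h19 hM1 ht *; first by rewrite h19 in hi0.
  apply: wp_does_test.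
  apply: (does_set (v := i)); first by rewrite /= h19 h27 subn1.
    by lia.
  apply: (does_set (v := nth 0 s i)).
  + by rewrite /= upd_eq hM1 /relocated ltnSn.
  + exact: hs.
  set R' := upd _ 23 _.
  have w19 : R' 19 = i by rewrite /R' upd_ne // upd_eq.
  have w15 : R' 15 = 0 by rewrite /R' !upd_ne.
  apply: does_store; rewrite w15 ?w19 //.
  apply: does_lea => //; first by rewrite w19; lia.
  move=> R2 e2 k2; rewrite w19 in e2.
  have r23 : R2 23 = nth 0 s i by rewrite k2.
  apply: does_store; rewrite r23 ?e2 //.
  apply: does_nil; exists i.
  split=> //=; first by lia.
  + by rewrite k2.
  + move=> b; rewrite /upd; case: eqP => [->|hb].
      rewrite /relocated ifF; last by lia.
      have -> : (64 * i + 2) %/ 64 = i by lia.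
      by rewrite ifT //; lia.
    case: eqP => [->|hbi].
      rewrite /relocated ltnn; have [e|//] := boolP ((_ == 2) && _).
      by lia.
    rewrite hM1 /relocated ltnS leq_eqVlt; move/eqP/negbTE: (hbi) => -> /=.
    case: (ltnP b i) => // hb'; congr (if _ then _ else _).
    have hb2 : b %% 64 == 2 -> b %/ 64 != i by move=> h; apply/eqP => h'; apply: hb; lia.
    by case: (b %% 64 =P 2) hb2 => //= _ /(_ isT); lia.
  + split.
    * move=> x hx; move: (hx); rewrite !inE !negb_or => /and5P [? ? ? ? /andP [? ?]].
      by rewrite k2 // /R' !upd_ne // hR1.
    * by rewrite k2.
    * by rewrite k2.
  + by lia.
- move=> u [i [hi h19 hM1 [hR1 h15 h27] ht]] /= e0.
  rewrite h19 in e0; rewrite e0 in hM1 ht.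
  by split=> //=; lia.
Qed.

Lemma fill_ok B S f r R M t : R 35 = S -> R 15 = 0 -> R 27 = 1 -> f < 64 ->
  r \notin [:: 3; 7; 19; 39; 43] ->
  64 * S + 64 <= B -> S * R r <= B ->
  @wp (ram B) (fill f r) (fun u => [/\ forall i, i < S -> rmem u (64 * i + f) = i * R r,
    (forall b, (forall i, i < S -> b != 64 * i + f) -> rmem u b = M b),
    (forall x, x \notin [:: 3; 7; 19; 39; 43] -> rreg u x = R x),
    rreg u 39 = S * R r & rtick u <= t + 20 * S + 10]) (RState R M t).
Proof.
move=> h35 h15 h27 hf hr hB hB2; apply: wp_seq; apply: wp_does.
apply: does_set => //.
apply: does_set => //.
apply: (does_set (v := S)); first by rewrite /= !upd_ne // h35 h15 addn0.
  by lia.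
apply: does_nil.
pose I (u : rstate) := exists i, [/\ i <= S, rreg u 19 = i /\ rreg u 43 = S - i,
  (forall i', i' < i -> rmem u (64 * i' + f) = i' * R r) /\
  (forall b, (forall i', i' < i -> b != 64 * i' + f) -> rmem u b = M b),
  (forall x, x \notin [:: 3; 7; 19; 39; 43] -> rreg u x = R x) /\
  rreg u 39 = i * R r & rtick u + 20 * (S - i) <= t + 20 * S + 3].
apply: (@wp_while (ram B) _ _ I _ (t + 20 * S + 3)).
- exists 0; split=> //=; try by lia.
  + by split; rewrite ?subn0.
  + split=> //.
    by move=> x; rewrite !inE !negb_or => /and5P [? ? ? ? ?]; rewrite !upd_ne.
- by move=> u [i [_ _ _ _ h]] /=; lia.
- move=> [R1 M1 t1] [i [/= hi [h19 h43] [hM1 hM2] [hR1 h39] ht]] hi0.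
  have hi' : i < S by move: hi0 => /=; rewrite h43; lia.
  have hRr : i * R r + R r <= S * R r by rewrite -mulSnr leq_mul2r hi' orbT.
  have e27 : R1 27 = 1 by rewrite hR1.
  have rr : R1 r = R r by rewrite hR1.
  apply: wp_does_test; apply: does_lea => //; first by rewrite h19; lia.
  move=> R2 e2 k2; rewrite h19 in e2.
  have r19 : R2 19 = i by rewrite k2.
  have r39 : R2 39 = i * R r by rewrite k2.
  have r43 : R2 43 = S - i by rewrite k2.
  have r27 : R2 27 = 1 by rewrite k2.
  have r2r : R2 r = R r by move: hr; rewrite !inE !negb_or => /and5P [? ? ? ? ?]; rewrite k2.
  apply: does_store; first by rewrite r39; lia.
  rewrite e2 r39.
  apply: (does_set (v := i.+1 * R r)); first by rewrite /= r39 r2r (mulSnr i).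
    by rewrite (mulSnr i); lia.
  apply: (does_set (v := i.+1)); first by rewrite /= !upd_ne // r19 r27 addn1.
    by lia.
  apply: (does_set (v := S - i.+1)); first by rewrite /= !upd_ne // r43 r27; congr rset; lia.
    by lia.
  apply: does_nil; exists i.+1; split=> //=; last by lia.
  + split.
    * move=> i'; rewrite ltnS leq_eqVlt => /orP [/eqP ->|hlt]; first by rewrite upd_eq.
      by rewrite upd_ne ?hM1 //; lia.
    * move=> b hb; rewrite upd_ne; last exact: hb.
      by apply: hM2 => i' hlt; apply: hb; lia.
  + split=> // x hx; move: (hx); rewrite !inE !negb_or => /and5P [? ? ? ? ?].
    by rewrite !upd_ne // k2 // hR1.
- move=> u [i [hi [h19 h43] [hM1 hM2] [hR1 h39] ht]] e0.
  have e : i = S by move: e0 => /=; rewrite h43; lia.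
  by rewrite e in hM1 hM2 h39 ht; split=> //=; lia.
Qed.

Lemma does_addn B C l R M t Q : R 35 + C * R 31 <= B ->
  (forall R', R' 35 = R 35 + C * R 31 -> (forall x : nat, x != 35 -> R' x = R x) ->
     does B l (RState R' M (t + C)) Q) ->
  does B (nseq C (IAdd 35 35 31) ++ l) (RState R M t) Q.
Proof.
elim: C R t => [|C IH] R t hB h /=.
  by rewrite -[t]addn0; apply: h => //; rewrite mul0n addn0.
rewrite mulSn in hB; apply: (does_set (v := R 35 + R 31)) => //; first by lia.
apply: IH; first by rewrite upd_eq upd_ne //; lia.
move=> R' h35 hR'; rewrite addSnnS; apply: h.
  by rewrite h35 upd_eq upd_ne // mulSn addnA.
by move=> x hx; rewrite hR' // upd_ne.
Qed.

Definition ainit (s : seq nat) : astate :=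
  AState (fun _ => 0) (fun _ _ _ => 0)
    (upd3 (fun _ _ _ => [::]) 2 0 0 [seq (v, 0) | v <- s]) 0.

Lemma decode_small S a : a < S -> [/\ a %/ (S * S) = 0, a %/ S %% S = 0 & a %% S = a].
Proof.
by move=> h; rewrite divnMA (divn_small h) div0n mod0n modn_small.
Qed.

Lemma decode_large S a : S <= a -> 0 < S ->
  (a %/ (S * S) == 0) && (a %/ S %% S == 0) = false.
Proof.
move=> h hS; apply/negP => /andP [/eqP h1 /eqP h2].
have h3 : 0 < a %/ S by rewrite divn_gt0.
by move: h3; rewrite (divn_eq (a %/ S) S) -divnMA h1 h2.
Qed.

Lemma nth_fst (l : seq (nat * nat)) p : (nth (0, 0) l p).1 = nth 0 [seq q.1 | q <- l] p.
Proof.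
by case: (ltnP p (size l)) => h; [rewrite (nth_map (0, 0)) | rewrite !nth_default ?size_map].
Qed.

Lemma setup_ok B C s : let N := in_size s in let S := C * N.+1 in 0 < C ->
  cap S <= B -> (forall b, nth 0 s b <= B) ->
  @wp (ram B) (setup C)
    (fun u => arel S (ainit s) u /\ rtick u <= 60 * S + C + 100)
    (RState (upd (fun _ => 0) 0 (size s)) (nth 0 s) 0).
Proof.
move=> N S hC hcap hs.
have hNS : N.+1 <= S by rewrite /S leq_pmull.
have hsz : size s < S by apply: leq_trans hNS; rewrite /N /in_size; lia.
have SB : 64 * S + 64 <= B by apply: leq_trans hcap; rewrite /cap; lia.
have SSB : 64 * (S * S) + 64 <= B by apply: leq_trans hcap; rewrite /cap; lia.
have SSSB : S * (S * S) <= B by apply: leq_trans hcap; rewrite /cap; lia.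
apply: wp_seq; set R0 := upd _ 0 _.
have hR0 : forall x, R0 x <= B.
  by move=> x; rewrite /R0 /upd; case: eqP => // _; lia.
have hszB : 64 * size s + 64 <= B by lia.
apply: wp_mono (@relocate_ok B s R0 (nth 0 s) 0 erefl (fun _ => erefl) hR0 hs hszB) _.
move=> [R1 M1 t1] [/= hM1 hR1 h15 h27 ht1].
apply: wp_seq; apply: wp_does.
have hM12 : M1 2 = nth 0 s 0.
  by rewrite hM1 /relocated /=; case: (posnP (size s)) => h //; rewrite nth_default // h.
have h0 : R1 0 = size s by rewrite hR1.
apply: does_set => //; first by lia.
apply: (does_set (v := nth 0 s 0)); [by rewrite /= upd_eq hM12 | exact: hs | ].
apply: (does_set (v := N)); first by rewrite /= upd_eq !upd_ne // h0.
  by lia.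
apply: (does_set (v := N.+1)); first by rewrite /= upd_eq !upd_ne // h27 addn1.
  by lia.
apply: does_set => //.
set R2 := upd _ 35 0.
have R2_35 : R2 35 = 0 by rewrite /R2 upd_eq.
have R2_31 : R2 31 = N.+1 by rewrite /R2 upd_ne // upd_eq.
apply: does_addn; rewrite R2_35 R2_31 add0n; first by lia.
move=> R3 e35 k3.
apply: does_set => //; first by lia.
have R3_0 : upd R3 3 34 0 = size s by rewrite upd_ne // k3 // /R2 !upd_ne.
apply: does_store; rewrite R3_0; first by lia.
rewrite upd_eq; apply: does_set => //; apply: does_nil.
set R4 := upd _ 0 0; set t4 := (_ + C).+1.+2; set M4 := upd _ _ _.
have R4_15 : R4 15 = 0 by rewrite /R4 !upd_ne // k3 // /R2 !upd_ne.
have R4_27 : R4 27 = 1 by rewrite /R4 !upd_ne // k3 // /R2 !upd_ne.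
have R4_35 : R4 35 = S by rewrite /R4 !upd_ne.
have R4_0 x : x %% 4 != 3 -> R4 x = 0.
  move=> hx; rewrite /R4 {1}/upd; case: eqP => // /eqP hx0.
  rewrite upd_ne; last by lia.
  rewrite k3; last by lia.
  rewrite /R2 !upd_ne; try by lia.
  by rewrite hR1 ?inE; [rewrite /R0 upd_ne | lia].
have hSS : S * R4 35 <= B by rewrite R4_35; lia.
apply: wp_seq.
apply: wp_mono (@fill_ok B S 63 35 R4 M4 t4 R4_35 R4_15 R4_27 isT isT SB hSS) _.
move=> [R5 M5 t5] [/= hM5 hM5' hR5 R5_39 ht5].
apply: wp_seq; apply: wp_does.
apply: (does_set (v := S * S)); first by rewrite /= R5_39 hR5 // R4_15 R4_35 addn0.
  by lia.
apply: does_nil; set R6 := upd _ _ _.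
have R6_35 : R6 35 = S by rewrite /R6 upd_ne // hR5.
have R6_15 : R6 15 = 0 by rewrite /R6 upd_ne // hR5.
have R6_27 : R6 27 = 1 by rewrite /R6 upd_ne // hR5.
have R6_47 : R6 47 = S * S by rewrite /R6 upd_eq.
have hSSS : S * R6 47 <= B by rewrite R6_47; lia.
apply: wp_mono (@fill_ok B S 62 47 R6 M5 t5.+1 R6_35 R6_15 R6_27 isT isT SB hSSS) _.
move=> [R7 M7 t7] [/= hM7 hM7' hR7 _ ht7].
have cls x : x %% 4 != 3 -> R7 x = 0.
  move=> hx; rewrite hR7 ?inE; last by lia.
  rewrite /R6 upd_ne; last by lia.
  by rewrite hR5 ?R4_0 // !inE; lia.
split; last by rewrite /= /t4 in ht1 ht5 ht7 *; lia.
split=> /=; try (by move=> x; apply: cls; lia).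
split=> [j a hj|i hi|i hi].
- rewrite hM7'; last by move=> i _; lia.
  rewrite hM5'; last by move=> i _; lia.
  rewrite /M4 /layout /= /upd3 {1}/upd hM1 /relocated ltn0 /=.
  have -> : (64 * a + j) %/ 64 = a by lia.
  have -> : (64 * a + j) %% 64 = j by lia.
  have [haS|haS] := ltnP a S; last first.
    have hd := decode_large haS (leq_ltn_trans (leq0n _) hsz).
    have hd1 k : [&& k == 2, a %/ (S * S) == 0 & a %/ S %% S == 0] = false.
      by rewrite hd andbF.
    rewrite !hd1 nth_nil /= if_same; have -> : (a < size s) = false by lia.
    rewrite andbF ifF; last by lia.
    by do 4 ?[case: ifP => // _].
  have [-> -> ->] := decode_small haS; rewrite !eqxx !andbT.
  have -> : (64 * a + j == 34) = (j == 34) && (a == 0) by lia.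
  have [->|h2] := j =P 2.
    rewrite /= nth_fst -map_comp map_id; case: ltnP => // h.
    by rewrite nth_default.
  have [->|h34] := j =P 34; first by rewrite /= size_map; case: eqP.
  rewrite /=; case: ifP => h16; first by rewrite nth_nil.
  case: ifP => h32.
    case: ifP => _; last by rewrite nth_nil.
    have [h|h] := ltnP a (size s); first by rewrite (nth_map 0).
    by rewrite nth_default // size_map.
  case: ifP => // _; case: ifP => // h48.
  rewrite ifF //; lia.
- rewrite hM7 // /R6 upd_eq //.
- rewrite hM7'; last by move=> i' _; lia.
  by rewrite hM5 // R4_35.
Qed.

(** * Reductions *)

(** The first components of families 0 and 1 occupy memories 0 and 1, which the two programs will
    take for their own. Stacks away from the origin must be empty because these programs expect
    zeros beyond their input. *)
Definition outputs (s : astate) (l1 l2 : seq nat) : Prop :=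
  [/\ va s 1 = size l1, va s 2 = size l2,
      [seq q.1 | q <- stk s 0 0 0] = l1, [seq q.1 | q <- stk s 1 0 0] = l2
    & forall j x y, j < 2 -> (x, y) != (0, 0) -> stk s j x y = [::]].

(** The base is at least 2, so a constant factor can be absorbed into the exponent. *)
Lemma leq_expn_mul a n e : a * n.+2 ^ e <= n.+2 ^ (e + a).
Proof.
case: a => [|a]; first by rewrite mul0n.
rewrite expnD mulnC leq_mul2l; apply/orP; right.
by apply: leq_trans (ltnW (ltn_expl _ (isT : 1 < 2))) _; rewrite leq_exp2r.
Qed.

Lemma abound_init s N : (forall v, v \in s -> v <= N) -> size s <= N -> abound N (ainit s).
Proof.
move=> h hs; split=> //= j x y; rewrite /upd3; case: ifP => // _; rewrite ?size_map //.
  move=> i; have [hi|hi] := ltnP i (size s); last by rewrite nth_default ?size_map.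
  by rewrite (nth_map 0) //=; split=> //; apply/h/mem_nth.
by move=> i; rewrite nth_nil.
Qed.

Lemma stores_out S m s j l : stores S m (layout s) -> j < 2 -> size l < S ->
  [seq q.1 | q <- stk s j 0 0] = l ->
  (forall x y, (x, y) != (0, 0) -> stk s j x y = [::]) ->
  forall a, m (64 * a + j) = nth 0 l a.
Proof.
move=> [h _ _] hj hl e h0 a; rewrite h; last by lia.
rewrite /layout ifT; last by lia.
have [haS|haS] := ltnP a S.
  by have [-> -> ->] := decode_small haS; rewrite nth_fst e.
rewrite h0; first by rewrite nth_nil nth_default // (leq_trans (ltnW hl)).
by rewrite xpair_eqE decode_large // (leq_ltn_trans _ hl).
Qed.

(** Registers 1 and 2 are the images of register 0 of the two programs: they receive the input
    lengths and later hold the answers. A null first answer skips the second program, about which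
    nothing is known in that case, and jumps to the final instruction that rejects. *)
Definition chain (C : nat) (c : acmd) (p1 p2 : program) : program :=
  let code := compile (Seq (setup C) (Seq (acompile c)
                (block [:: IConst 15 0; IAdd 1 4 15; IAdd 2 8 15]))) 0 in
  let o1 := size code in
  let o2 := (o1 + 9 * size p1).+1 in
  let oend := o2 + 9 * size p2 + 3 in
  code ++ embed 1 0 p1 o1 ++ [:: IJz 1 oend] ++ embed 2 1 p2 o2 ++
  [:: IConst 7 0; IAdd 0 2 7; IJmp oend.+1; IConst 0 0].

Lemma chain_pre C c p1 p2 B k s s' l1 l2 : awf c -> 0 < C ->
  let N := in_size s in let S := C * N.+1 in
  N + k < S -> cap S <= B -> (forall v, v \in s -> v <= N) ->
  size l1 < S -> size l2 < S ->
  @exec alang c (ainit s) s' -> atick s' <= k -> outputs s' l1 l2 ->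
  exists n R M, let o1 := size (compile (Seq (setup C) (Seq (acompile c)
                (block [:: IConst 15 0; IAdd 1 4 15; IAdd 2 8 15]))) 0) in
  [/\ steps (chain C c p1 p2) B n (init s) (Config o1 R M),
      n <= 60 * S + C + 110 + 130 * k,
      forall x, R (4 * x + 1) = (if x == 0 then size l1 else 0),
      forall x, R (4 * x + 2) = (if x == 0 then size l2 else 0)
    & (forall a, M (64 * a) = nth 0 l1 a) /\ (forall a, M (64 * a + 1) = nth 0 l2 a)].
Proof.
move=> hw hC N S hS hcap hs hl1 hl2 he hk [o1 o2 o3 o4 o5].
have SB : 64 * S + 64 <= B by apply: leq_trans hcap; rewrite /cap; lia.
have hsN b : nth 0 s b <= N.
  by have [h|h] := ltnP b (size s); [apply/hs/mem_nth | rewrite nth_default].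
have hsB b : nth 0 s b <= B by have := hsN b; lia.
have hszN : size s <= N by rewrite /N /in_size; lia.
have [u1 x1 [r1 t1]] := @setup_ok B C s hC hcap hsB.
have hS' : N + atick s' < S by lia.
have hb0 : abound (N + atick (ainit s)) (ainit s) by rewrite addn0; apply: abound_init.
have [u2 [x2 r2 t2]] := acompile_correct he hw hb0 hS' hcap r1.
have x3 : @wp (ram B) (block [:: IConst 15 0; IAdd 1 4 15; IAdd 2 8 15])
  (fun u => [/\ forall x, rreg u (4 * x + 1) = (if x == 0 then size l1 else 0),
     forall x, rreg u (4 * x + 2) = (if x == 0 then size l2 else 0),
     rmem u = rmem u2 & rtick u = (rtick u2).+3]) u2.
  case: u2 {x2 t2} r2 => R M t [/= hva hm h1 h2]; apply: wp_does.
  apply: does_set => //.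
  apply: (does_set (v := size l1)).
  + rewrite /= upd_eq upd_ne // addn0; congr rset.
    by rewrite -o1 -(hva 1).
  + by lia.
  apply: (does_set (v := size l2)).
  + rewrite /= [upd _ 1 _ 15]upd_ne // upd_eq addn0 !upd_ne //.
    by rewrite -o2 -(hva 2).
  + by lia.
  apply: does_nil; split=> //= x.
  + rewrite upd_ne; last by lia.
    by rewrite {1}/upd; case: x => [|x] //=; rewrite ifF ?upd_ne ?h1 //; lia.
  + by rewrite {1}/upd; case: x => [|x] //=; rewrite ifF ?upd_ne ?h2 //; lia.
have [u3 {}x3 [r3 r4 r5 t3]] := x3.
have hx : @exec (ram B) (Seq (setup C) (Seq (acompile c)
                (block [:: IConst 15 0; IAdd 1 4 15; IAdd 2 8 15])))
     (RState (upd (fun _ => 0) 0 (size s)) (nth 0 s) 0) u3.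
  by apply: ExSeq x1 _; apply: ExSeq x2 x3.
have hb : bounded B (init s).
  move=> i; split=> /=; last exact: hsB.
  by rewrite /upd; case: eqP => // _; lia.
have hl : loaded (chain C c p1 p2) 0 (compile (Seq (setup C) (Seq (acompile c)
                (block [:: IConst 15 0; IAdd 1 4 15; IAdd 2 8 15]))) 0).
  exact: (@loaded_mid [::]).
have [n hn hst] := compile_correct hx hl hb.
exists n, (rreg u3), (rmem u3); split=> //.
- by move: hn t1 t2; rewrite /= t3; lia.
- rewrite r5; have hm := arel_mem r2; split=> a.
    rewrite -[64 * a]addn0; apply: (stores_out hm _ hl1 o3) => // x y; exact: o5.
  by apply: (stores_out hm _ hl2 o4) => // x y; apply: o5.
Qed.

Lemma runs_steps P B n s c b : steps P B n (init s) c -> step P c = None ->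
  (reg c 0 != 0 <-> b) -> runs_and_answers P s n B b.
Proof. by move=> [h hb] hs hr; exists c; split=> //; split. Qed.

Lemma chain_run C c p1 p2 B B1 B2 k s s' l1 l2 t1 t2 (b1 b2 : Prop) :
  let N := in_size s in let S := C * N.+1 in
  awf c -> 0 < C -> N + k < S -> cap S <= B -> (forall v, v \in s -> v <= N) ->
  size l1 < S -> size l2 < S ->
  @exec alang c (ainit s) s' -> atick s' <= k -> outputs s' l1 l2 ->
  64 * B1 + 64 <= B -> 64 * B2 + 64 <= B ->
  runs_and_answers p1 l1 t1 B1 b1 -> (b1 -> runs_and_answers p2 l2 t2 B2 b2) ->
  exists2 t, t <= 60 * S + C + 140 + 130 * k + 9 * t1 + 9 * t2
    & runs_and_answers (chain C c p1 p2) s t B (b1 /\ b2).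
Proof.
move=> N S hw hC hS hcap hs hl1 hl2 he hk ho hB1 hB2 [cf1 [h1 [g1 [d1 a1]]]] hrun2.
have := chain_pre p1 p2 hw hC hS hcap hs hl1 hl2 he hk ho.
rewrite /chain; move: (compile _ 0) => code; set o1 := size code.
set o2 := (o1 + 9 * size p1).+1; set oend := o2 + 9 * size p2 + 3.
set P := code ++ _; move=> [n [R [M [st hn hR1 hR2 [hM0 hM1]]]]].
have ld1 : loaded P o1 (embed 1 0 p1 o1) by apply: loaded_mid.
have ld : loaded P (o1 + 9 * size p1)
    ([:: IJz 1 oend] ++ embed 2 1 p2 o2 ++ [:: IConst 7 0; IAdd 0 2 7; IJmp oend.+1; IConst 0 0]).
  have := @loaded_mid (code ++ embed 1 0 p1 o1) ([:: IJz 1 oend] ++ embed 2 1 p2 o2 ++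
    [:: IConst 7 0; IAdd 0 2 7; IJmp oend.+1; IConst 0 0]) [::].
  by rewrite cats0 -catA size_cat size_embed.
move: ld => /loaded_cons [ljz]; rewrite -/o2 => /loaded_cat [ld2].
rewrite size_embed => /loaded_cons [l_1 /loaded_cons [l_2 /loaded_cons [l_3 /loaded_cons [l_4 _]]]].
have sP : size P = oend.+1.
  by rewrite /P !size_cat !size_embed /= /oend /o2 /o1; lia.
have oendE : (o2 + 9 * size p2).+3 = oend by rewrite /oend addn3.
have e1 : embedded 1 0 (init l1) R M.
  split=> [r|a] /=; first by rewrite hR1 /upd.
  by rewrite addn0 hM0.
have hb1 := steps_bounded st.
have [n1 [R1 [M1 [hn1 st1 em1 fr1]]]] :=
  embed_correct (isT : 1 < 3) ld1 (isT : 0 < 64) hB1 h1 g1 erefl d1 e1 hb1.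
have {st st1} st := steps_trans st st1.
have hb := steps_bounded st.
have r1 : R1 1 = reg cf1 0 by case: em1 => h _; rewrite -(h 0).
have [r0|r0] := eqVneq (reg cf1 0) 0.
  have hb0 : bounded B (Config oend.+1 (upd R1 0 0) M1).
    by move=> i; have [x y] := hb i; split=> //=; rewrite /upd; case: eqP.
  exists (n + n1 + 2); first by lia.
  apply: (@runs_steps _ _ _ _ (Config oend.+1 (upd R1 0 0) M1)).
  - apply: steps_trans st (@steps_trans _ _ 1 1 _ (Config oend R1 M1) _ _ _).
      by apply: steps_one => //; rewrite /step /= ljz r1 r0.
    by apply: steps_one => //; rewrite /step /= -oendE l_4.
  - by rewrite /step nth_default //= sP.
  - by split=> // -[/a1]; rewrite r0.
have hb1' : b1 by apply/a1.
have [cf2 [h2 [g2 [d2 a2]]]] := hrun2 hb1'.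
have e2 : embedded 2 1 (init l2) R1 M1.
  case: fr1 => f1 f2; split=> [r|a] /=.
    by rewrite f1 ?hR2 /upd //; lia.
  by rewrite f2 ?hM1 //; lia.
have st1 : steps P B 1 (Config (o1 + 9 * size p1) R1 M1) (Config o2 R1 M1).
  by apply: steps_one => //; rewrite /step /= ljz r1 (negbTE r0).
have {}st := steps_trans st st1.
have hb2 := steps_bounded st.
have [n2 [R2 [M2 [hn2 st2 em2 fr2]]]] :=
  embed_correct (isT : 2 < 3) ld2 (isT : 1 < 64) hB2 h2 g2 erefl d2 e2 hb2.
have {st st2} st := steps_trans st st2.
have hb3 := steps_bounded st.
have r2 : R2 2 = reg cf2 0 by case: em2 => h _; rewrite -(h 0).
set Rf := upd (upd R2 7 0) 0 (reg cf2 0).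
have hbf pc : bounded B (Config pc (upd R2 7 0) M2).
  by move=> i; have [x y] := hb3 i; split=> //=; rewrite /upd; case: eqP.
have hbf' pc : bounded B (Config pc Rf M2).
  move=> i; have [x y] := hbf pc i; split=> //=; rewrite /Rf {1}/upd; case: eqP => // _.
  by rewrite -r2; have [] := hb3 2.
exists (n + n1 + 1 + n2 + (1 + (1 + 1))); first by lia.
apply: (@runs_steps _ _ _ _ (Config oend.+1 Rf M2)).
- apply: steps_trans st _.
  apply: (@steps_trans _ _ _ _ _ (Config (o2 + 9 * size p2).+1 (upd R2 7 0) M2)).
    by apply: steps_one => //; rewrite /step /= l_1.
  apply: (@steps_trans _ _ _ _ _ (Config (o2 + 9 * size p2).+2 Rf M2)).
    by apply: steps_one => //; rewrite /step /= l_2 upd_ne // upd_eq addn0 r2.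
  by apply: steps_one => //; rewrite /step /= l_3.
- by rewrite /step nth_default //= sP.
- by rewrite [reg _ 0]upd_eq a2; split=> [|[]].
Qed.

Definition reads_in_size (s : seq nat) : Prop := forall v, v \in s -> v <= in_size s.

(** For [S] at least 1, [cap S] is at most [256 * S ^ 3]; the constants then go into the
    exponent. *)
Lemma cap_bound C N : 0 < C -> cap (C * N.+1) <= N.+2 ^ (3 + 256 * C ^ 3).
Proof.
move=> hC; apply: leq_trans (leq_expn_mul _ _ _).
have hS : 0 < C * N.+1 by rewrite muln_gt0 hC.
have h1 : cap (C * N.+1) <= 256 * (C * N.+1) ^ 3.
  rewrite /cap !expnS expn0 muln1; move: (C * N.+1) hS => S hS.
  have := leq_mul hS (leq_mul hS hS); have := leq_mul hS (leqnn (S * S)).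
  have := leq_mul hS (leqnn S); rewrite !mul1n; lia.
apply: leq_trans h1 _; rewrite -mulnA leq_mul2l /= expnMn leq_mul2l; apply/orP; right.
by rewrite leq_exp2r.
Qed.

Lemma embed_bound N n k e : n <= k * N.+1 ->
  64 * n.+2 ^ e + 64 <= N.+2 ^ (e + 128 * (k + 2) ^ e).
Proof.
move=> hn; apply: leq_trans (leq_expn_mul _ _ _).
have h0 : 0 < n.+2 ^ e by rewrite expn_gt0.
apply: (@leq_trans (128 * n.+2 ^ e)); first by lia.
rewrite -mulnA leq_mul2l /= -expnMn; case: e {h0} => // e.
by rewrite leq_exp2r //; rewrite mulnDl; lia.
Qed.

(** All algorithms of the equivalence have this form: a linear-time preprocessing writes two inputs
    of linear length, on which the given programs run in turn. The second instance has to lie in the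
    domain of its problem only when the first is a positive one. *)
Theorem reduction (X X1 X2 : Type) (enc : X -> seq nat -> Prop)
    (enc1 : X1 -> seq nat -> Prop) (enc2 : X2 -> seq nat -> Prop)
    (dom P : X -> Prop) (dom1 P1 : X1 -> Prop) (dom2 P2 : X2 -> Prop) p1 p2 c k :
  lin_time_decides enc1 dom1 P1 p1 -> lin_time_decides enc2 dom2 P2 p2 -> awf c ->
  (forall x s, dom x -> enc x s -> reads_in_size s /\
     exists x1 x2 l1 l2,
     [/\ dom1 x1 /\ enc1 x1 l1, (P1 x1 -> dom2 x2) /\ enc2 x2 l2,
        in_size l1 <= k * (in_size s).+1 /\ in_size l2 <= k * (in_size s).+1,
        P x <-> P1 x1 /\ P2 x2
      & @wp alang c (fun s' => outputs s' l1 l2 /\ atick s' <= k * (in_size s).+1) (ainit s)]) ->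
  exists p, lin_time_decides enc dom P p.
Proof.
(* With the factor [k + 2], [S] exceeds [N + k * N.+1], the largest value the preprocessing can
   reach. *)
move=> [c1 h1] [c2 h2] hw h; pose C := k + 2; exists (chain C c p1 p2).
pose E1 := c1 + 128 * (k + 2) ^ c1; pose E2 := c2 + 128 * (k + 2) ^ c2.
pose E := 3 + 256 * C ^ 3; pose T := 61 * C + 140 + 130 * k + 9 * (c1 * k.+1) + 9 * (c2 * k.+1).
(* One constant serves as time factor and as exponent of the word bound: [T] is for the time, [E]
   for the addresses of tables and stacks, [E1] and [E2] for the embedded runs. *)
exists (T + (E + (E1 + E2))) => x s hx hs.
have [hrd [x1 [x2 [l1 [l2 [[hd1 he1] [hd2 he2] [hl1 hl2] hP [s' hex [ho ht]]]]]]]] := h x s hx hs.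
have hC : 0 < C by rewrite /C; lia.
have [t1 [ht1 hr1]] := h1 x1 l1 hd1 he1.
(* The duration of the second run has to be named before the first answer is known. The answer
   register decides [P1 x1], so no classical axiom is involved; after a negative answer 0 will
   do. *)
have [t2 [ht2 hr2]] : exists t2, t2 <= c2 * (in_size l2).+1 /\
    (P1 x1 -> runs_and_answers p2 l2 t2 ((in_size l2).+2 ^ c2) (P2 x2)).
  have [hp|hp] : P1 x1 \/ ~ P1 x1.
    case: hr1 => cf [_ [_ [_ h3]]]; case: (boolP (reg cf 0 != 0)) => h4; first by left; apply/h3.
    by right=> /h3; apply/negP.
  - by have [t2 [h3 h4]] := h2 x2 l2 (hd2 hp) he2; exists t2.
  - by exists 0.
set N := in_size s; set B := N.+2 ^ (T + (E + (E1 + E2))).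
have pw e : e <= T + (E + (E1 + E2)) -> N.+2 ^ e <= B by move=> he; rewrite leq_pexp2l.
have hcap : cap (C * N.+1) <= B by apply: leq_trans (cap_bound N hC) (pw _ _); rewrite -/E; lia.
have hB1 : 64 * (in_size l1).+2 ^ c1 + 64 <= B.
  by apply: leq_trans (embed_bound c1 hl1) (pw _ _); rewrite -/E1; lia.
have hB2 : 64 * (in_size l2).+2 ^ c2 + 64 <= B.
  by apply: leq_trans (embed_bound c2 hl2) (pw _ _); rewrite -/E2; lia.
have sz l : in_size l <= k * N.+1 -> size l < C * N.+1.
  by rewrite /in_size /C mulnDl; lia.
have hS : N + k * N.+1 < C * N.+1 by rewrite /C mulnDl; lia.
have [t ht' hr] := chain_run hw hC hS hcap hrd (sz _ hl1) (sz _ hl2) hex ht ho hB1 hB2 hr1 hr2.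
exists t; split; last first.
  by case: hr => cf [q1 [q2 [q3 q4]]]; exists cf; do ?split=> //; [move/q4/hP | move/hP/q4].
have b1 : t1 <= c1 * k.+1 * N.+1.
  by apply: leq_trans ht1 _; rewrite -mulnA leq_mul2l; apply/orP; right; rewrite mulSn; lia.
have b2 : t2 <= c2 * k.+1 * N.+1.
  by apply: leq_trans ht2 _; rewrite -mulnA leq_mul2l; apply/orP; right; rewrite mulSn; lia.
apply: leq_trans ht' _; apply: (@leq_trans (T * N.+1)); last first.
  by rewrite leq_mul2r leq_addr orbT.
rewrite /T !mulnDl.
have : C <= C * N.+1 by rewrite leq_pmulr.
move: b1 b2; set X0 := c1 * k.+1; set Y0 := c2 * k.+1 => b1 b2 b3.
rewrite -!mulnA; lia.
Qed.

(** * Loops of the abstract language *)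

Fixpoint aeffs (l : seq aop) (s : astate) : astate :=
  if l is a :: l' then aeffs l' (aeff a s) else s.

Lemma aeffs_cat l1 l2 s : aeffs (l1 ++ l2) s = aeffs l2 (aeffs l1 s).
Proof. by elim: l1 s => [|a l1 IH] s //=. Qed.

Lemma wp_ablock l (Q : astate -> Prop) s : Q (aeffs l s) -> @wp alang (block l) Q s.
Proof.
elim: l s => [|a l IH] s h; first exact: wp_skip.
apply: wp_seq; exists (aeff a s); first by constructor.
exact: IH.
Qed.

Definition cells := nat -> nat -> nat -> nat.
Definition stacks := nat -> nat -> nat -> seq (nat * nat).

(* Counters follow the nesting of loops: the body of a loop with counter [i]
   only writes variables beyond [i]. *)
Definition for_loop (i n : nat) (body : acmd) : acmd :=
  Seq (block [:: Cst i 0; Diff i.+1 n i])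
      (While i.+1 (Seq body (block [:: Inc i; Diff i.+1 n i]))).

Definition keeps (i : nat) (s s' : astate) : Prop := forall x, x < i -> va s' x = va s x.

Lemma keeps_trans i s1 s2 s3 : keeps i s1 s2 -> keeps i s2 s3 -> keeps i s1 s3.
Proof. by move=> h1 h2 x hx; rewrite h2 ?h1. Qed.

(** Loops can only test for zero, so variable [i.+1] holds the number of remaining rounds; being
    recomputed from [n] and [i] after the body, it may be overwritten there. A round costs three
    extra ticks, initialization and last test three more. *)
Lemma wp_for i n body (J : nat -> cells -> stacks -> Prop) (K : nat -> nat) s0 :
  n < i -> J 0 (cell s0) (stk s0) ->
  (forall k s, k < va s0 n -> va s i = k -> keeps i s0 s -> J k (cell s) (stk s) ->
     @wp alang body (fun s' => [/\ keeps i.+1 s s', J k.+1 (cell s') (stk s')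
                                 & atick s' <= atick s + K k]) s) ->
  @wp alang (for_loop i n body) (fun s' => [/\ keeps i s0 s', J (va s0 n) (cell s') (stk s')
      & atick s' <= atick s0 + \sum_(k < va s0 n) (K k + 3) + 3]) s0.
Proof.
move=> hn hJ hbody; set m := va s0 n.
have hni : (n == i) = false by lia.
have hii : (i == i.+1) = false by lia.
apply: wp_seq; apply: wp_ablock.
pose T k := \sum_(j < k) (K j + 3).
pose I (s : astate) := exists k, [/\ k <= m, va s i = k /\ va s i.+1 = m - k, keeps i s0 s,
  J k (cell s) (stk s) & atick s <= atick s0 + T k + 2].
have hT k : k <= m -> T k <= T m.
  move=> hk; rewrite /T -(big_mkord xpredT (fun j => K j + 3)) -(big_mkord xpredT (fun j => K j + 3)).
  by rewrite (big_cat_nat (leq0n k) hk) leq_addr.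
apply: (@wp_while alang _ _ I _ (atick s0 + T m + 2)).
- exists 0; split=> //=.
  + by rewrite /upd eqxx hii hni eqxx /m; split=> //; lia.
  + by move=> x hx /=; rewrite /upd; do 2 (rewrite ifF; last by lia).
  + by rewrite /T big_ord0; lia.
- by move=> s [k [hk _ _ _ h]] /=; have := hT k hk; lia.
- move=> s [k [hk [hi ht] hkeep hJk htick]] hne.
  have hkm : k < m by move: hne => /=; lia.
  apply: wp_seq; apply: wp_mono (hbody k (atest s) hkm hi hkeep hJk) _ => s' [h1 h2 h3].
  apply: wp_ablock; exists k.+1; split=> //=.
  + rewrite upd_ne ?hii // !upd_eq [upd _ i _ n]upd_ne ?hni // (h1 i) //= (h1 n) /= ?hi; last by lia.
    by rewrite (hkeep n hn).
  + move=> x hx /=; rewrite /upd; do 2 (rewrite ifF; last by lia).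
    by rewrite h1 /= ?hkeep //; lia.
  + by rewrite /T big_ord_recr /= -/(T k); move: h3 => /=; lia.
- move=> s [k [hk [hi ht] hkeep hJk htick]] /= h0.
  have e : k = m by lia.
  by rewrite e in hJk htick; split=> //=; rewrite -/(T m); lia.
Qed.

Definition writes (a : aop) : seq nat :=
  match a with
  | Cst x _ | Mov x _ | Inc x | Diff x _ _ | Get x _ _ _ | Len x _ _ _ => [:: x]
  | Pop x1 x2 _ _ _ | Nth x1 x2 _ _ _ _ => [:: x1; x2]
  | _ => [::]
  end.

Lemma keeps_aeffs i l s :
  all (fun a => all (leq i) (writes a)) l -> keeps i s (aeffs l s).
Proof.
elim: l s => [|a l IH] s //= /andP [ha hl]; apply: keeps_trans (IH _ hl) => x hx.
by case: a ha => //= *; rewrite ?upd_ne //; lia.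
Qed.

(** By convention variable 0 always holds 0 and serves as the second index. Variables [v + 5] and
    [v + 6] receive the current pair. *)
Definition traverse (v f n : nat) (body : acmd) : acmd :=
  for_loop v n (Seq (block [:: Len v.+2 f v 0])
    (for_loop v.+3 v.+2 (Seq (block [:: Nth (v + 5) (v + 6) f v 0 v.+3]) body))).

Lemma wp_traverse v f n body (J : seq (nat * nat) -> cells -> stacks -> Prop)
    (L : nat -> seq (nat * nat)) K s0 :
  0 < n < v -> va s0 0 = 0 -> J [::] (cell s0) (stk s0) ->
  (forall l c t, J l c t -> forall a, a < va s0 n -> t f a 0 = L a) ->
  (forall l e l' s, flatten [seq L a | a <- iota 0 (va s0 n)] = l ++ e :: l' ->
     va s (v + 5) = e.1 -> va s (v + 6) = e.2 -> keeps v s0 s -> J l (cell s) (stk s) ->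
     @wp alang body (fun s' => [/\ keeps (v + 5) s s', J (rcons l e) (cell s') (stk s')
                                 & atick s' <= atick s + K]) s) ->
  @wp alang (traverse v f n body) (fun s' => [/\ keeps v s0 s',
      J (flatten [seq L a | a <- iota 0 (va s0 n)]) (cell s') (stk s')
    & atick s' <= atick s0 + (K + 4) * size (flatten [seq L a | a <- iota 0 (va s0 n)])
        + 7 * va s0 n + 3]) s0.
Proof.
move=> /andP [hn0 hnv] hz hJ0 hL hbody; set m := va s0 n.
pose pre k := flatten [seq L a | a <- iota 0 k].
have preS k : pre k.+1 = pre k ++ L k by rewrite /pre -addn1 iotaD map_cat flatten_cat /= cats0.
have preM k : k < m -> exists l', pre m = pre k.+1 ++ l'.
  move=> hk; exists (flatten [seq L a | a <- iota k.+1 (m - k.+1)]).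
  by rewrite /pre -{1}(subnKC hk) iotaD map_cat flatten_cat.
pose J1 k := J (pre k).
apply: wp_mono (@wp_for v n _ J1 (fun k => (K + 4) * size (L k) + 4) s0 hnv hJ0 _) _; last first.
  move=> s' [h1 h2 h3]; split=> //; apply: leq_trans h3 _.
  have -> : size (pre m) = \sum_(k < m) size (L k).
    by rewrite /pre size_flatten /shape -map_comp sumnE big_map -{1}[m]subn0 -/(index_iota 0 m) big_mkord.
  suff : \sum_(k < m) ((K + 4) * size (L k) + 4 + 3) <= (K + 4) * \sum_(k < m) size (L k) + 7 * m.
    by rewrite -/m; lia.
  have -> : 7 * m = \sum_(k < m) 7 by rewrite sum_nat_const card_ord mulnC.
  rewrite big_distrr /= -big_split /=.
  by apply: leq_sum => k _; lia.
move=> k s hk hvk hkeep hJk; apply: wp_seq; apply: wp_ablock.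
set s1 := aeffs _ s.
have hz1 : va s 0 = 0 by rewrite hkeep //; lia.
have e2 : va s1 v.+2 = size (L k) by rewrite /= upd_eq hvk hz1 (hL _ _ _ hJk).
pose J2 c := J (pre k ++ take c (L k)).
have hJ2 : J2 0 (cell s1) (stk s1) by rewrite /J2 take0 cats0.
apply: wp_mono (@wp_for v.+3 v.+2 _ J2 (fun=> K.+1) s1 (leqnn _) hJ2 _) _; last first.
  move=> s' [h1 h2 h3]; split.
  - by move=> x hx; rewrite h1 /= ?upd_ne //; lia.
  - by move: h2; rewrite e2 /J1 /J2 take_size preS.
  - apply: leq_trans h3 _; rewrite e2 /= sum_nat_const card_ord; lia.
move=> c s2 hc hvc hkeep2 hJc; apply: wp_seq; apply: wp_ablock; set s3 := aeffs _ s2.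
rewrite e2 in hc; pose e := nth (0, 0) (L k) c.
have hvk2 : va s2 v = k by rewrite hkeep2 /= ?upd_ne ?hvk //; lia.
have hz2 : va s2 0 = 0 by rewrite hkeep2 //= upd_ne.
have he : nth (0, 0) (stk s2 f (va s2 v) (va s2 0)) (va s2 v.+3) = e.
  by rewrite hvk2 hz2 hvc (hL _ _ _ hJc).
have [l' hl'] := preM k hk.
have hsplit : pre m = (pre k ++ take c (L k)) ++ e :: (drop c.+1 (L k) ++ l').
  rewrite hl' preS -{1}(cat_take_drop c (L k)) (drop_nth (0, 0) hc) -/e.
  by rewrite -!catA cat_cons.
have k3 : keeps v s0 s3.
  move=> x hx /=; rewrite !upd_ne; try by lia.
  by rewrite hkeep2 /=; [rewrite upd_ne ?hkeep //; lia | lia].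
apply: wp_mono (hbody _ e _ s3 hsplit _ _ k3 hJc) _.
- by rewrite /= he upd_ne ?upd_eq //; lia.
- by rewrite /= he upd_eq.
move=> s' [h1 h2 h3]; split.
- by move=> x hx; rewrite h1 /= ?upd_ne //; lia.
- by rewrite /J2 (take_nth (0, 0) hc) -rcons_cat.
- by move: h3 => /=; lia.
Qed.

Lemma nth_flatten_width T (x0 : T) (F : T -> seq nat) w es k j :
  (forall q, size (F q) = w) -> k < size es -> j < w ->
  nth 0 (flatten [seq F q | q <- es]) (w * k + j) = nth 0 (F (nth x0 es k)) j.
Proof.
move=> hF; elim: es k => [|q es IH] [|k] //= hk hj; rewrite nth_cat hF.
  by rewrite muln0 hj.
by rewrite ifF ?mulnS; [rewrite -addnA addKn IH | lia].
Qed.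

Lemma size_flatten_width T (F : T -> seq nat) w es :
  (forall q, size (F q) = w) -> size (flatten [seq F q | q <- es]) = w * size es.
Proof. by move=> hF; elim: es => [|q es IH] /=; rewrite ?muln0 ?size_cat ?hF ?IH ?mulnS. Qed.

Lemma nth_input (s : seq nat) p : (nth (0, 0) [seq (v, 0) | v <- s] p).1 = nth 0 s p.
Proof. by rewrite nth_fst -map_comp map_id. Qed.

(** A trivial second problem, through which [reduction] also covers reductions to a single
    problem. *)
Definition accept : program := [:: IConst 0 1].

Lemma accept_decides :
  lin_time_decides (fun (_ : unit) (s : seq nat) => s = [::]) (fun _ => True) (fun _ => True) accept.
Proof.
exists 1 => x s _ ->; exists 1; split=> //.
exists (Config 1 (upd (upd (fun _ => 0) 0 0) 0 1) (fun i => nth 0 [::] i)).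
split=> //; split=> //; split.
  move=> [|[|t]] c //= _ [<-] i /=; rewrite nth_nil /upd; split=> //; repeat case: eqP => //.
by split.
Qed.

(** * From graphs and orderings to weighted graphs *)

Arguments upd f i v j /.

(* The instructions [ws] put the weight of the edge of rank [va s 10] in variable 25. *)
Definition weigh_code (ws : seq aop) : acmd :=
  Seq (block [:: Cst 5 0; Nth 3 6 2 0 0 5; Cst 5 1; Nth 4 6 2 0 0 5; Cst 5 2; Put 13 0 0 5;
                 Push 0 0 0 3 0; Push 0 0 0 4 0])
  (Seq (for_loop 10 4
          (block ([:: Get 20 13 0 0; Nth 21 23 2 0 0 20; Inc 20; Nth 22 23 2 0 0 20; Inc 20;
                      Put 13 0 0 20; Push 0 0 0 21 0; Push 0 0 0 22 0] ++
                  ws ++ [:: Push 0 0 0 25 0])))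
       (block [:: Len 1 0 0 0; Len 2 1 0 0])).

Definition weigh_out (f : nat -> nat) (es : seq (nat * nat)) : seq (seq nat) :=
  [seq [:: q.1.1; q.1.2; q.2] | q <- zip es (mkseq f (size es))].

Definition weighs (ws : seq aop) (f : nat -> nat) : Prop := forall s,
  [/\ forall x : nat, x != 25 -> va (aeffs ws s) x = va s x, va (aeffs ws s) 25 = f (va s 10),
      cell (aeffs ws s) = cell s, stk (aeffs ws s) = stk s & atick (aeffs ws s) <= atick s + 3].

Lemma weigh_ok ws f n es : weighs ws f ->
  let s := [:: n, size es & flatten [seq [:: q.1; q.2] | q <- es]] in
  @wp alang (weigh_code ws) (fun s' =>
     outputs s' [:: n, size es & flatten (weigh_out f es)] [::] /\
     atick s' <= 40 * (in_size s).+1) (ainit s).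
Proof.
move=> hws s; pose J k (c : cells) (t : stacks) :=
  [/\ c 13 0 0 = 2 + 2 * k,
      [seq q.1 | q <- t 0 0 0] = [:: n, size es & flatten (take k (weigh_out f es))],
      t 2 0 0 = [seq (v, 0) | v <- s], t 1 0 0 = [::]
    & forall j x y, j < 2 -> (x, y) != (0, 0) -> t j x y = [::]].
have upd_origin T (t : nat -> nat -> nat -> T) j l j' x y : (x, y) != (0, 0) ->
    upd3 t j 0 0 l j' x y = t j' x y.
  by move=> h; rewrite /upd3; case: ifP => // /and3P [_ /eqP hx /eqP hy]; rewrite hx hy in h.
have hsz : size (weigh_out f es) = size es by rewrite size_map size_zip size_mkseq minnn.
apply: wp_seq; apply: wp_ablock; set s1 := aeffs _ _.
have h3 : va s1 3 = n by [].
have h4 : va s1 4 = size es by [].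
have J1 : J 0 (cell s1) (stk s1).
  split=> //=; first by rewrite take0.
  by move=> j x y hj hxy; rewrite !upd_origin.
apply: wp_seq; apply: wp_mono (@wp_for 10 4 _ J (fun=> 14) s1 isT J1 _) _.
  move=> k s2; rewrite h4 => hk h10 hkeep [c1 c2 c3 c4 c5]; apply: wp_ablock.
  have h0 : va s2 0 = 0 by rewrite hkeep.
  have e1 : nth 0 s (2 + 2 * k) = (nth (0, 0) es k).1.
    by rewrite /s -[2 * k]addn0 /= (nth_flatten_width (0, 0)).
  have e2 : nth 0 s (2 + 2 * k).+1 = (nth (0, 0) es k).2.
    by rewrite /s -addn1 -addnA /= (nth_flatten_width (0, 0)).
  have ew : nth [::] (weigh_out f es) k = [:: (nth (0, 0) es k).1; (nth (0, 0) es k).2; f k].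
    rewrite (nth_map ((0, 0), 0)) ?size_zip ?size_mkseq ?minnn // nth_zip ?size_mkseq //=.
    by rewrite nth_mkseq.
  rewrite !aeffs_cat; set s3 := aeffs _ s2.
  have k3 : keeps 11 s2 s3 by apply: keeps_aeffs.
  have [w1 w2 w3 w4 w5] := hws s3; set s4 := aeffs ws s3 in w1 w2 w3 w4 w5 *.
  have h10' : va s3 10 = k by rewrite k3.
  have h0' : va s3 0 = 0 by rewrite k3.
  have e3 : [seq q.1 | q <- stk s3 0 0 0] =
      [:: n, size es & flatten (take k (weigh_out f es))] ++ [:: (nth (0, 0) es k).1; (nth (0, 0) es k).2].
    by rewrite /s3 /= !h0 c1 c3 !nth_input e1 e2 /upd3 /= !map_rcons c2 -!cats1 -catA.
  split.
  - by move=> x hx; rewrite /= w1 ?k3 //; lia.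
  - rewrite /= w3 w4 (w1 0) // h0' w2 h10'; split.
    + by rewrite /s3 /= h0 c1 /upd3 /=; lia.
    + rewrite /upd3 /= map_rcons e3 (take_nth [::]) ?hsz // flatten_rcons ew.
      by rewrite -cats1 -!catA.
    + by rewrite /s3 /= h0 /upd3 /=.
    + by rewrite /s3 /= h0 /upd3 /=.
    + by move=> j x y hj hxy; rewrite upd_origin // /s3 /= h0 !upd_origin // c5.
  - by move: w5; rewrite /s3 /=; lia.
move=> s' [hk [c1 c2 c3 c4 c5] ht]; apply: wp_ablock.
have h0 : va s' 0 = 0 by rewrite hk.
rewrite h4 in c2 ht; rewrite take_oversize ?hsz // in c2; split.
  split=> //=; rewrite ?h0 ?c4 //.
  by have := congr1 size c2; rewrite size_map.
move: ht; rewrite sum_nat_const card_ord /in_size /= (size_flatten_width (w := 2)) //; lia.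
Qed.

Lemma weighs_one : weighs [:: Cst 25 1] (fun=> 1).
Proof. by move=> s; split=> //= [x /negbTE -> //|]; lia. Qed.

Lemma weighs_rank : weighs [:: Mov 25 10; Inc 25] S.
Proof. by move=> s; split=> //= [x /negbTE -> //|]; lia. Qed.

(** * The elimination loop *)

Lemma count_iota_upd m (p p' : pred nat) e : e < m -> (forall f, f < m -> f != e -> p f = p' f) ->
  count p (iota 0 m) + p' e = count p' (iota 0 m) + p e.
Proof.
elim: m => // m IH hem hp; rewrite -addn1 iotaD !count_cat /= add0n !addn0.
have [hlt|hge] := ltnP e m.
  have := IH hlt (fun f hf => hp f (leqW hf)); rewrite (hp m) //; lia.
have -> : e = m by lia.
have -> : count p (iota 0 m) = count p' (iota 0 m); last by lia.
by apply: eq_in_count => f; rewrite mem_iota => hf; apply: hp; lia.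
Qed.

Section Elimination.
Variables (m : nat) (u v w : nat -> nat).

Definition inc (x e : nat) := (x == u e) || (x == v e).

Definition ends (x y e : nat) := (x == u e) && (y == v e) || (x == v e) && (y == u e).

(* [tt e] is the time at which edge [e] is deleted, and 0 as long as it is not. *)
Definition pend (tt : nat -> nat) (t f : nat) := (tt f == 0) || (t <= tt f).

(* Edge [f] belongs to the graph in which level [l] is being processed at time [t]. *)
Definition live (tt : nat -> nat) (l t f : nat) := (l < w f) || (w f == l) && pend tt t f.

(** Degree of [y] in the graph of level [l] just before the visit of time [t]. At [T.+1], where [T]
    is the present clock, it is the current degree. *)
Definition ldeg (tt : nat -> nat) (y l t : nat) :=
  count (fun f => inc y f && live tt l t f) (iota 0 m).

(* [x] is the vertex visited at time [tt e]. *)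
Definition scheduled (tt kd : nat -> nat) (e : nat) : Prop :=
  exists x y, [/\ ends x y e,
    forall f, f < m -> w f = w e -> inc x f -> 0 < tt f <= tt e,
    forall f, f < m -> tt f = tt e -> w f = w e /\ inc x f,
    kd e = ldeg tt y (w e) (tt e)
  & forall f z, f < m -> w f = w e -> pend tt (tt e) f -> inc z f ->
      ldeg tt x (w e) (tt e) <= ldeg tt z (w e) (tt e)].

Hypothesis loopless : forall e, e < m -> u e != v e.
Hypothesis simple : forall e f x y, e < m -> f < m -> ends x y e -> ends x y f -> e = f.

Lemma ends_inc x y e : ends x y e -> inc x e /\ inc y e.
Proof. by rewrite /ends /inc; lia. Qed.

Lemma ends_neq x y e : e < m -> ends x y e -> x != y.
Proof. by move=> /loopless; rewrite /ends; lia. Qed.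

Lemma inc_ends x y e : x != y -> inc x e -> inc y e -> ends x y e.
Proof. by rewrite /ends /inc; lia. Qed.

Lemma ends_cases x y z e : ends x y e -> inc z e -> z = x \/ z = y.
Proof. by rewrite /ends /inc; lia. Qed.

(** State between visits, with bucket [d], clock [T], queue [Q] and incidence stacks [I]. Stale
    entries are tolerated: what matters is that each endpoint of a pending edge is queued under its
    current degree and that no such degree lies below [d]. *)
Record main_inv (d T rem : nat) (key : nat -> nat -> nat) (tt kd : nat -> nat)
    (Q : nat -> seq (nat * nat)) (I : nat -> nat -> seq (nat * nat)) : Prop := MainInv {
  mi_time : forall f, f < m -> tt f <= T;
  mi_key : forall y f, f < m -> tt f = 0 -> inc y f ->
    [/\ key y (w f) = ldeg tt y (w f) T.+1, (y, w f) \in Q (key y (w f)) & d <= key y (w f)];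
  mi_inc : forall x y f, f < m -> tt f = 0 -> ends x y f -> (y, f) \in I x (w f);
  mi_ends : forall x y l f, (y, f) \in I x l -> [/\ f < m, w f = l & ends x y f];
  mi_rem : rem = count (fun f => tt f == 0) (iota 0 m);
  mi_sched : forall e, e < m -> tt e != 0 -> scheduled tt kd e;
  mi_d : d <= m }.

(** State during the visit of [x] at level [l] and time [t]. The pair [(x, l)] is exempt from
    [ii_key], since its key is left outdated. [ii_low] and [ii_min] refer to the degrees at the
    start of the visit, which are those that made [x] eligible. *)
Record inner_inv (d t x l rem : nat) (key : nat -> nat -> nat) (tt kd : nat -> nat)
    (Q : nat -> seq (nat * nat)) (I : nat -> nat -> seq (nat * nat)) : Prop := InnerInv {
  ii_pos : 0 < t;
  ii_time : forall f, f < m -> tt f <= t;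
  ii_now : forall f, f < m -> tt f = t -> w f = l /\ inc x f;
  ii_key : forall y f, f < m -> tt f = 0 -> inc y f -> (y, w f) != (x, l) ->
    key y (w f) = ldeg tt y (w f) t.+1 /\ (y, w f) \in Q (key y (w f));
  ii_low : forall y f, f < m -> tt f = 0 -> inc y f -> d <= ldeg tt y (w f) t;
  ii_inc : forall x' y f, f < m -> tt f = 0 -> ends x' y f -> (y, f) \in I x' (w f);
  ii_ends : forall x' y l' f, (y, f) \in I x' l' -> [/\ f < m, w f = l' & ends x' y f];
  ii_rem : rem = count (fun f => tt f == 0) (iota 0 m);
  ii_sched : forall e, e < m -> tt e != 0 -> tt e < t -> scheduled tt kd e;
  ii_kd : forall e, e < m -> tt e = t -> exists2 y, ends x y e & kd e = ldeg tt y l t;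
  ii_min : forall g f z, g < m -> inc x g -> w g = l -> pend tt t g ->
    f < m -> w f = l -> pend tt t f -> inc z f -> ldeg tt x l t <= ldeg tt z l t;
  ii_d : d <= m }.

Lemma ldeg_max tt y l t : ldeg tt y l t <= m.
Proof. by apply: leq_trans (count_size _ _) _; rewrite size_iota. Qed.

Lemma eq_ldeg tt tt' y l t t' : (forall f, f < m -> inc y f -> w f = l ->
  pend tt t f = pend tt' t' f) -> ldeg tt y l t = ldeg tt' y l t'.
Proof.
move=> h; apply: eq_in_count => f; rewrite mem_iota => hf.
case hi: (inc y f) => //=; rewrite /live; case: (w f =P l) => [e|] //=.
by rewrite h.
Qed.

Lemma ldeg_upd tt tt' y l t t' e : e < m ->
  (forall f, f < m -> f != e -> inc y f -> w f = l -> pend tt t f = pend tt' t' f) ->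
  ldeg tt y l t + inc y e && live tt' l t' e = ldeg tt' y l t' + inc y e && live tt l t e.
Proof.
move=> he h; apply: (count_iota_upd (p := fun f => inc y f && live tt l t f)
  (p' := fun f => inc y f && live tt' l t' f) he) => f hfm hfe.
by case hi: (inc y f) => //=; rewrite /live; case: (w f =P l) => //= e'; rewrite h.
Qed.

(** A remaining edge gives a vertex queued above bucket [d], under a degree, hence at most [m]; this
    keeps [d.+1] in range. *)
Lemma main_empty d T rem key tt kd Q I : main_inv d T rem key tt kd Q I ->
  rem != 0 -> Q d = [::] -> main_inv d.+1 T rem key tt kd Q I.
Proof.
move=> [h1 h2 h3 h4 h5 h6 h7] hr hQ.
have h2' y f : f < m -> tt f = 0 -> inc y f -> [/\ key y (w f) = ldeg tt y (w f) T.+1,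
    (y, w f) \in Q (key y (w f)) & d.+1 <= key y (w f)].
  move=> hf htt hi; have [e1 e2 e3] := h2 y f hf htt hi; split=> //.
  rewrite ltn_neqAle e3 andbT; apply/negP => /eqP e; move: e2.
  by rewrite -e hQ.
split=> //.
have : has (fun f => tt f == 0) (iota 0 m) by rewrite has_count; lia.
move=> /hasP [f]; rewrite mem_iota => hf /eqP htt.
have hi : inc (u f) f by rewrite /inc eqxx.
have [e1 _ e3] := h2' (u f) f hf htt hi; apply: leq_trans e3 _.
by rewrite e1 ldeg_max.
Qed.

(** The popped entry is stale: its bucket is not the key of [(x, l)], so it is not the entry that
    [mi_key] asks for. *)
Lemma main_skip d T rem key tt kd Q Q' I x l q : main_inv d T rem key tt kd Q I ->
  Q d = rcons q (x, l) -> (forall k, Q' k = if k == d then q else Q k) -> d < key x l ->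
  main_inv d T rem key tt kd Q' I.
Proof.
move=> [h1 h2 h3 h4 h5 h6 h7] hQ hQ' hk; split=> // y f hf htt hi.
have [e1 e2 e3] := h2 y f hf htt hi; split=> //.
rewrite hQ'; case: eqP => // e; move: e2; rewrite e hQ mem_rcons inE.
by case/orP => // /eqP [ey el]; move: hk; rewrite -ey -el e ltnn.
Qed.

(** If [x] has pending edges of weight [l], then [mi_key] makes its key exactly [d], the least one,
    which gives [ii_min]; otherwise the visit will delete nothing. The time [T.+1] is fresh, so
    degrees at the start of the visit are the current keys. *)
Lemma main_enter d T rem key tt kd Q Q' I x l q : main_inv d T rem key tt kd Q I ->
  Q d = rcons q (x, l) -> (forall k, Q' k = if k == d then q else Q k) -> key x l <= d ->
  inner_inv d T.+1 x l rem key tt kd Q' I.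
Proof.
move=> [h1 h2 h3 h4 h5 h6 h7] hQ hQ' hk.
have tT f : f < m -> tt f <> T.+1 by move=> /h1; lia.
have pT f : f < m -> pend tt T.+1 f = (tt f == 0).
  by move=> /h1 hf; rewrite /pend; lia.
have dT y l' : ldeg tt y l' T.+2 = ldeg tt y l' T.+1.
  by apply: eq_ldeg => f hf _ _; have := h1 f hf; rewrite /pend; lia.
split=> //.
- by move=> f /h1 hf; lia.
- by move=> f /tT.
- move=> y f hf htt hi hne; have [e1 e2 e3] := h2 y f hf htt hi.
  rewrite dT; split=> //; rewrite hQ'; case: eqP => // e; move: e2.
  by rewrite e hQ mem_rcons inE (negbTE hne).
- by move=> y f hf htt hi; have [e1 _ e3] := h2 y f hf htt hi; rewrite -e1.
- by move=> e hem htt _; apply: h6.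
- by move=> e /tT.
- move=> g f z hg hxg hwg; rewrite (pT g) // => /eqP hg0 hf hwf.
  rewrite pT // => /eqP hf0 hi.
  have [e1 _ _] := h2 x g hg hg0 hxg; have [e2 _ e3] := h2 z f hf hf0 hi.
  by rewrite hwg in e1; rewrite hwf in e2 e3; rewrite -e1 -e2; lia.
Qed.

(** Each edge is listed at both endpoints; an entry whose edge was already deleted from the other
    side is dropped. *)
Lemma inner_skip d t x l rem key tt kd Q I I' q y e :
  inner_inv d t x l rem key tt kd Q I ->
  I x l = rcons q (y, e) ->
  (forall x' l', I' x' l' = if (x' == x) && (l' == l) then q else I x' l') -> tt e != 0 ->
  inner_inv d t x l rem key tt kd Q I'.
Proof.
move=> [g1 g2 g3 g4 g5 g6 g7 g8 g9 g10 g11 g12] hI hI' htt; split=> //.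
- move=> x' y' f hf hf0 he; have := g6 x' y' f hf hf0 he; rewrite hI'.
  case: eqP => //= ->; case: eqP => //= ->; rewrite hI mem_rcons inE.
  by case/orP => // /eqP [_ ef]; move: htt; rewrite -ef hf0.
- move=> x' y' l' f; rewrite hI'; case: eqP => [->|_] /=; last exact: g7.
  case: eqP => [->|_] /=; last exact: g7.
  by move=> hq; apply: g7; rewrite hI mem_rcons inE hq orbT.
Qed.

Lemma pend_upd tt e t t' f : tt e = 0 -> t' <= t -> pend (upd tt e t) t' f = pend tt t' f.
Proof. by rewrite /pend /upd; case: (f =P e) => [->|] // -> ->; rewrite orbT. Qed.

(** At level [l] only [x] and [y] lose an edge. The key of [x] is exempt, that of [y] is lowered and
    queued anew. Earlier schedules survive because an edge deleted at time [t] still counts as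
    present at all times up to [t], so their degrees are unchanged. *)
Lemma inner_assign d t x l rem key key' tt tt' kd kd' Q Q' I I' q y e :
  inner_inv d t x l rem key tt kd Q I ->
  I x l = rcons q (y, e) ->
  (forall x' l', I' x' l' = if (x' == x) && (l' == l) then q else I x' l') -> tt e = 0 ->
  (forall f, tt' f = if f == e then t else tt f) ->
  (forall f, kd' f = if f == e then key y l else kd f) ->
  (forall y' l', key' y' l' = if (y' == y) && (l' == l) then (key y l).-1 else key y' l') ->
  (forall k, Q' k = if k == (key y l).-1 then rcons (Q k) (y, l) else Q k) ->
  [/\ inner_inv d t x l rem.-1 key' tt' kd' Q' I', 0 < rem & key y l <= m].
Proof.
move=> [g1 g2 g3 g4 g5 g6 g7 g8 g9 g10 g11 g12] hI hI' he0 htt hkd hkey hQ.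
have [hem hwe hends] : [/\ e < m, w e = l & ends x y e].
  by apply: g7; rewrite hI mem_rcons inE eqxx.
have [hxe hye] := ends_inc hends; have hxy := ends_neq hem hends.
have tte : tt' e = t by rewrite htt eqxx.
have tt0 f : tt' f = 0 -> tt f = 0 /\ f != e.
  by rewrite htt; case: eqP => // _ h; move: g1; rewrite h.
have ltt y' l' t' : t' <= t -> ldeg tt' y' l' t' = ldeg tt y' l' t'.
  move=> ht'; apply: eq_ldeg => f _ _ _; rewrite -(pend_upd f he0 ht').
  by rewrite /pend htt /upd.
have ptt f t' : t' <= t -> pend tt' t' f = pend tt t' f.
  by move=> ht'; rewrite -(pend_upd f he0 ht') /pend htt /upd.
have hupd y' l' : ldeg tt' y' l' t.+1 + (inc y' e && (w e == l')) = ldeg tt y' l' t.+1.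
  have := @ldeg_upd tt tt' y' l' t.+1 t.+1 e hem _.
  rewrite /live /pend he0 tte ltnn (negbTE (lt0n_neq0 g1)) /= => h.
  have {h} : ldeg tt y' l' t.+1 + inc y' e && (l' < w e) =
      ldeg tt' y' l' t.+1 + inc y' e && ((l' < w e) || (w e == l')).
    by move: h; rewrite andbF orbF andbT; apply => f hfm hf _ _; rewrite htt (negbTE hf).
  by case: (inc y' e) => //=; lia.
have hy : key y l = ldeg tt y l t.+1.
  have [|h _] := g4 y e hem he0 hye; last by rewrite -hwe h hwe.
  by rewrite xpair_eqE eq_sym (negbTE hxy).
(* Another edge of this visit at [y] would join [x] and [y] as well and coincide with [e]. Hence the
   key read now is the degree at the start of the visit, as [scheduled] demands. *)
have hyt : ldeg tt y l t.+1 = ldeg tt y l t.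
  apply: eq_ldeg => f hf hif hwf; rewrite /pend.
  case: (tt f =P t) => [h|h]; last by lia.
  have [_ hxf] := g3 f hf h.
  have := simple hf hem (inc_ends hxy hxf hif) hends.
  by move=> ef; move: g1; rewrite -h ef he0.
have hrem : count (fun f => tt' f == 0) (iota 0 m) + 1 = rem.
  have := @count_iota_upd m (fun f => tt' f == 0) (fun f => tt f == 0) e hem _.
  rewrite tte he0 eqxx g8 => h; rewrite h; first by lia.
  by move=> f hfm hfe; rewrite htt (negbTE hfe).
split; [split=> // | by lia | by rewrite hy ldeg_max].
- by move=> f hf; rewrite htt; case: eqP => // _; apply: g2.
- by move=> f hf; rewrite htt; case: eqP => [->|_ /(g3 f hf)].
- move=> y' f hf /tt0 [hf0 hfe] hi hne; have [e1 e2] := g4 y' f hf hf0 hi hne.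
  rewrite hkey; case: ifP => [/andP [/eqP ey /eqP el]|hn].
    have := hupd y l; rewrite -hy hye hwe eqxx /= => h.
    rewrite ey el; split; first by lia.
    by rewrite hQ eqxx mem_rcons inE eqxx.
  have := hupd y' (w f); have -> : inc y' e && (w e == w f) = false.
    apply/negP => /andP [hi' /eqP hw']; move/negP: hn; apply.
    have [ey|ey] := ends_cases hends hi'; last by rewrite ey -hw' hwe !eqxx.
    by move: hne; rewrite ey -hw' hwe eqxx.
  rewrite addn0 => ->; split=> //; rewrite hQ; case: ifP => // _.
  by rewrite mem_rcons inE e2 orbT.
- by move=> y' f hf /tt0 [hf0 _] hi; rewrite ltt //; apply: g5.
- move=> x' y' f hf /tt0 [hf0 hfe] he; have := g6 x' y' f hf hf0 he; rewrite hI'.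
  case: eqP => //= ->; case: eqP => //= ->; rewrite hI mem_rcons inE.
  by case/orP => // /eqP [_ ef]; rewrite ef eqxx in hfe.
- move=> x' y' l' f; rewrite hI'; case: eqP => [->|_] /=; last exact: g7.
  case: eqP => [->|_] /=; last exact: g7.
  by move=> hq; apply: g7; rewrite hI mem_rcons inE hq orbT.
- by rewrite -hrem addn1.
- move=> f hf hf0 hft; have hfe : f != e by apply/eqP => ef; move: hft; rewrite ef tte ltnn.
  have ef : tt' f = tt f by rewrite htt (negbTE hfe).
  rewrite ef in hf0 hft; have [a [b [s1 s2 s3 s4 s5]]] := g9 f hf hf0 hft.
  have hft' := ltnW hft.
  exists a, b; rewrite ef; split=> //.
  + move=> g hg hwg hag; rewrite htt; case: eqP => [eg|_]; last exact: s2.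
    by have := s2 g hg hwg hag; rewrite eg he0.
  + move=> g hg; rewrite htt; case: eqP => [eg eq|_]; last exact: s3.
    by move: hft; rewrite -eq ltnn.
  + by rewrite hkd (negbTE hfe) ltt.
  + by move=> g z hg hwg; rewrite ptt // !ltt //; apply: s5.
- move=> f hf; rewrite htt hkd; case: eqP => [-> _|hfe ht].
    by exists y => //; rewrite ltt // hy hyt.
  by have [y' h1 h2] := g10 f hf ht; exists y' => //; rewrite ltt.
- by move=> a b z; rewrite !ptt // !ltt //; apply: g11.
Qed.

(** With its stack empty, [ii_inc] leaves [x] no pending edge of weight [l], so the outdated key of
    [x] no longer falls under the invariant. *)
Lemma inner_exit d t x l rem key tt kd Q I : inner_inv d t x l rem key tt kd Q I ->
  I x l = [::] -> main_inv d.-1 t rem key tt kd Q I.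
Proof.
move=> [g1 g2 g3 g4 g5 g6 g7 g8 g9 g10 g11 g12] hI.
have hx f : f < m -> w f = l -> inc x f -> tt f != 0.
  move=> hf hwf hi; apply/eqP => hf0.
  have [y hy] : exists y, ends x y f.
    by move: hi; rewrite /inc /ends => /orP [] ->; [exists (v f) | exists (u f)]; rewrite eqxx ?orbT.
  by have := g6 x y f hf hf0 hy; rewrite hwf hI.
(* Two edges deleted at [y] during this visit would both join [x] and [y], contradicting
   simplicity. *)
have low y l' : (y, l') != (x, l) -> ldeg tt y l' t <= (ldeg tt y l' t.+1).+1.
  move=> hne; case: (boolP (has (fun f => [&& tt f == t, inc y f & w f == l']) (iota 0 m))); last first.
    move=> /hasPn h; apply: ltnW; rewrite ltnS; apply: eq_leq; apply: eq_ldeg => f hf hi hwf.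
    have := h f; rewrite mem_iota hi hwf eqxx !andbT /pend => /(_ hf); lia.
  move=> /hasP [f]; rewrite mem_iota => hf /and3P [/eqP htf hi /eqP hwf].
  have [hwl hxf] := g3 f hf htf.
  have hyx : x != y by apply: contra hne => /eqP ->; rewrite -hwf hwl.
  have hends := inc_ends hyx hxf hi.
  have := @ldeg_upd tt tt y l' t t.+1 f hf _; rewrite hi /= => h.
  suff : ldeg tt y l' t + live tt l' t.+1 f = ldeg tt y l' t.+1 + live tt l' t f.
    by case: (live _ _ _ f); case: (live _ _ _ f); lia.
  apply: h => f' hfm' hf' hi' hwf'; rewrite /pend; case: (tt f' =P t) => [htf'|]; last by lia.
  have [_ hxf'] := g3 f' hfm' htf'; move/eqP: hf'; case.
  exact: simple hfm' hf (inc_ends hyx hxf' hi') hends.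
split=> //.
- move=> y f hf hf0 hi; have hne : (y, w f) != (x, l).
    apply/negP; rewrite xpair_eqE => /andP [/eqP ey /eqP ew].
    by move: (hx f hf ew); rewrite -ey hf0 => /(_ hi).
  have [e1 e2] := g4 y f hf hf0 hi hne; split=> //.
  by have := low y (w f) hne; have := g5 y f hf hf0 hi; rewrite e1; lia.
- move=> e hem he0; have := g2 e hem; rewrite leq_eqVlt => /orP [/eqP het|]; last exact: g9.
  have [hwe hxe] := g3 e hem het; have [y hy hkd] := g10 e hem het.
  exists x, y; rewrite het hwe; split=> //.
  + by move=> f hf hwf hi; rewrite lt0n hx // g2.
  + by move=> f z hf hwf hp hi; apply: (g11 e f z) => //; rewrite /pend het leqnn orbT.
- by apply: leq_trans g12; lia.
Qed.

Lemma main_done d T key tt kd Q I : main_inv d T 0 key tt kd Q I ->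
  forall e, e < m -> 0 < tt e <= T /\ scheduled tt kd e.
Proof.
move=> [h1 _ _ _ h5 h6 _] e he; have he0 : tt e != 0.
  apply/negP => h0; have : has (fun f => tt f == 0) (iota 0 m).
    by apply/hasP; exists e; rewrite ?mem_iota.
  by rewrite has_count -h5.
by rewrite lt0n he0 h1 //; split=> //; apply: h6.
Qed.
End Elimination.

(** * Bucket sort *)

Definition dist (R : nat) (key : nat -> nat) (l : seq nat) : seq nat :=
  flatten [seq [seq e <- l | key e == a] | a <- iota 0 R].

Definition lexi (key : nat -> nat) (r : rel nat) : rel nat :=
  fun e f => (key e < key f) || (key e == key f) && r e f.

Lemma distS R key l : dist R.+1 key l = dist R key l ++ [seq e <- l | key e == R].
Proof. by rewrite /dist -addn1 iotaD map_cat flatten_cat /= cats0. Qed.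

Lemma dist_perm R key l : (forall e, e \in l -> key e < R) -> perm_eq (dist R key l) l.
Proof.
move=> h; have H k : perm_eq (dist k key l) [seq e <- l | key e < k].
  elim: k => [|k IH]; first by rewrite (eq_filter (a2 := pred0)) ?filter_pred0.
  rewrite distS; apply/permP => p; rewrite count_cat (permP IH) !count_filter.
  rewrite -count_predUI [X in _ + X](eq_count (a2 := pred0)) ?count_pred0 ?addn0.
    by apply: eq_count => e /=; case: (p e) => //=; lia.
  by move=> e /=; apply/negP => /andP [/andP [_ h1] /andP [_ h2]]; lia.
by apply: perm_trans (H R) _; rewrite (eq_in_filter (a2 := predT)) ?filter_predT.
Qed.

Lemma mem_dist R key l e : e \in dist R key l -> e \in l /\ key e < R.
Proof.
move=> /flattenP [s /mapP [a]]; rewrite mem_iota => ha ->.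
by rewrite mem_filter => /andP [/eqP -> ->].
Qed.

(** Distribution is stable: within a bucket the order of the former passes is kept, so passes go
    from the least to the most significant key. *)
Lemma dist_pairwise R key r l : pairwise r l -> pairwise (lexi key r) (dist R key l).
Proof.
move=> h; elim: R => // R IH; rewrite distS pairwise_cat IH andTb; apply/andP; split.
  apply/allrelP => e f /mem_dist [_ he]; rewrite mem_filter /lexi => /andP [/eqP -> _].
  by rewrite he.
have : pairwise r [seq e <- l | key e == R] by apply: pairwise_filter.
move=> hp; apply: (sub_in_pairwise (P := [pred e | key e == R])) hp.
  by move=> e f /eqP he /eqP hf hr; rewrite /lexi he hf eqxx hr orbT.
exact: filter_all.
Qed.

Definition items (l : seq nat) : seq (nat * nat) := [seq (e, 0) | e <- l].

Lemma items_flatten (L : nat -> seq nat) r :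
  flatten [seq items (L a) | a <- r] = items (flatten [seq L a | a <- r]).
Proof. by rewrite /items map_flatten -map_comp. Qed.

Lemma items_split l p e q : items l = p ++ e :: q ->
  exists p' q', [/\ p = items p', l = p' ++ e.1 :: q' & e.2 = 0].
Proof.
elim: p l => [|a p IH] [|b l] //=.
  by move=> [<- _]; exists [::], l.
by move=> [<- /IH [p' [q' [-> -> h]]]]; exists (b :: p'), q'.
Qed.

Definition distribute (f g j n : nat) : acmd :=
  traverse 10 f n (block [:: Get 20 j 15 0; Push g 20 0 15 0]).

Lemma distribute_ok (f g j n : nat) s0 (L : nat -> seq nat) : f != g -> 0 < n < 10 -> va s0 0 = 0 ->
  (forall a, a < va s0 n -> stk s0 f a 0 = items (L a)) ->
  (forall a, stk s0 g a 0 = [::]) ->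
  let l := flatten [seq L a | a <- iota 0 (va s0 n)] in
  @wp alang (distribute f g j n) (fun s' => [/\ keeps 10 s0 s', cell s' = cell s0,
     forall a, stk s' g a 0 = items [seq e <- l | cell s0 j e 0 == a],
     forall j' x y, (j' != g :> nat) -> stk s' j' x y = stk s0 j' x y
   & atick s' <= atick s0 + 6 * size l + 7 * va s0 n + 3]) s0.
Proof.
move=> hfg hn h0 hf hg l.
pose J (q : seq (nat * nat)) (c : cells) (t : stacks) := [/\ c = cell s0,
  forall a, t g a 0 = items [seq e <- [seq p.1 | p <- q] | cell s0 j e 0 == a]
  & forall j' x y, (j' != g :> nat) -> t j' x y = stk s0 j' x y].
have hl : flatten [seq items (L a) | a <- iota 0 (va s0 n)] = items l by exact: items_flatten.
have htag q : [seq p.1 | p <- items q] = q by rewrite /items -map_comp map_id.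
apply: wp_mono (@wp_traverse 10 f n _ J (fun a => items (L a)) 2 s0 hn h0 _ _ _) _.
- by split.
- by move=> q c t [_ _ ht] a ha; rewrite ht // hf.
- move=> q e q' s; rewrite hl => /items_split [p' [q2 [-> _ e2]]] h15 h16 hk [h1 h2 h3].
  apply: wp_ablock; have hz : va s 0 = 0 by rewrite hk.
  split; [exact: keeps_aeffs | | by rewrite /=; lia].
  split=> /=.
  + exact: h1.
  + move=> a; rewrite /upd3 hz h1 h15 !eqxx /= !h2 !htag map_rcons htag filter_rcons.
    rewrite eq_sym andbT; case: eqP => [->|_] //=.
    by rewrite /items map_rcons.
  + by move=> j' x y hj; rewrite /upd3 (negbTE hj) (h3 _ _ _ hj).
- move=> s' [h1 [h2 h3 h4] h5]; split=> //.
  + by move=> a; rewrite h3 hl htag.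
  + by move: h5; rewrite hl size_map.
Qed.

(** * Totals over stacks *)

Definition volume (A B : nat) (f : nat -> nat -> seq (nat * nat)) : nat :=
  \sum_(i < A) \sum_(j < B) size (f i j).

Lemma sum_upd n (F F' : nat -> nat) i : i < n -> (forall j, j < n -> j != i -> F' j = F j) ->
  \sum_(j < n) F' j + F i = \sum_(j < n) F j + F' i.
Proof.
move=> hi h; rewrite (bigD1 (Ordinal hi)) //= [X in _ = X + _](bigD1 (Ordinal hi)) //=.
rewrite (eq_bigr (fun j : 'I_n => F j)); first by lia.
by move=> j; rewrite -val_eqE /= => hj; apply: h.
Qed.

Lemma volume_upd A B (f f' : nat -> nat -> seq (nat * nat)) (i j : nat) l : i < A -> j < B ->
  (forall i' j' : nat, f' i' j' = if (i' == i) && (j' == j) then l else f i' j') ->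
  volume A B f' + size (f i j) = volume A B f + size l.
Proof.
move=> hi hj h.
have h1 : volume A B f' + \sum_(j < B) size (f i j) = volume A B f + \sum_(j < B) size (f' i j).
  apply: (sum_upd (F := fun i => \sum_(j < B) size (f i j))
    (F' := fun i => \sum_(j < B) size (f' i j)) hi) => i' _ hne.
  by apply: eq_bigr => j' _; rewrite h (negbTE hne).
have h2 : \sum_(j < B) size (f' i j) + size (f i j) = \sum_(j < B) size (f i j) + size (f' i j).
  apply: (sum_upd (F := fun j => size (f i j)) (F' := fun j => size (f' i j)) hj) => j' _ hne.
  by rewrite h (negbTE hne) andbF.
rewrite h !eqxx /= in h2; move: h1 h2.
by move: (\sum_(_ < _) size (f i _)) (\sum_(_ < _) size (f' i _)) => X Y; lia.
Qed.

(** * The ordering algorithm *)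

(* Variables: 3 number of vertices, 4 number [m] of edges, 5 [m.+1], 6 edges not yet
   deleted, 7 current bucket, 8 clock, 9 constant 1.
   Tables: 0, 1 endpoints, 2 weight, 3 degree, 4 key, 6 deletion time,
   7 key of the other endpoint at deletion, 8 reversed weight, 13 reading position.
   Stacks: 0, 1 outputs, 2 input, 4 incident edges by vertex and level,
   5 queue by key, 9 all edges, and 3, 6, 7, 8 edges bucketed by the keys in tables
   8, 7, 6, 2. *)
Definition read_code : acmd :=
  Seq (block [:: Cst 5 0; Nth 3 29 2 0 0 5; Cst 5 1; Nth 4 29 2 0 0 5; Cst 5 2; Put 13 0 0 5;
                 Push 0 0 0 3 0; Push 0 0 0 4 0; Push 1 0 0 3 0; Push 1 0 0 4 0;
                 Cst 9 1; Mov 5 4; Inc 5; Mov 6 4])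
      (for_loop 10 4 (block [:: Get 20 13 0 0; Nth 21 29 2 0 0 20; Inc 20; Nth 22 29 2 0 0 20;
                 Inc 20; Nth 23 29 2 0 0 20; Inc 20; Put 13 0 0 20;
                 Put 0 10 0 21; Put 1 10 0 22; Put 2 10 0 23; Diff 24 4 23; Put 8 10 0 24;
                 Push 9 0 0 10 0; Push 0 0 0 21 0; Push 0 0 0 22 0])).

Definition push (f : nat -> nat -> seq (nat * nat)) (i j : nat) (q : nat * nat) :=
  fun i' j' : nat => if (i' == i) && (j' == j) then rcons (f i j) q else f i' j'.

Lemma volume_push A B f i j q : i < A -> j < B ->
  volume A B (push f i j q) = (volume A B f).+1.
Proof.
move=> hi hj; have := @volume_upd A B f (push f i j q) i j (rcons (f i j) q) hi hj (fun _ _ => erefl).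
by rewrite size_rcons; lia.
Qed.

Lemma volume_ext A B f f' : (forall i j, f i j = f' i j) -> volume A B f = volume A B f'.
Proof. by move=> h; apply: eq_bigr => i _; apply: eq_bigr => j _; rewrite h. Qed.

Lemma mem_push f i j q i' j' q' : q' \in f i' j' -> q' \in push f i j q i' j'.
Proof.
rewrite /push; case: ifP => // /andP [/eqP -> /eqP ->] h.
by rewrite mem_rcons inE h orbT.
Qed.

Lemma push_mem f i j q : q \in push f i j q i j.
Proof. by rewrite /push !eqxx mem_rcons inE eqxx. Qed.

Lemma push_inv f i j q i' j' q' : q' \in push f i j q i' j' ->
  q' \in f i' j' \/ [/\ i' = i, j' = j & q' = q].
Proof.
rewrite /push; case: ifP => [/andP [/eqP -> /eqP ->]|_]; last by left.
by rewrite mem_rcons inE => /orP [/eqP ->|h]; [right | left].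
Qed.

(** The first pass puts the heaviest edges first, by reversed weight. A vertex is queued at each of
    its insertions, which leaves stale entries behind but only two entries per edge in all. *)
Definition index_code : acmd :=
  Seq (distribute 9 3 8 9)
  (traverse 10 3 5 (block [:: Get 20 0 15 0; Get 21 1 15 0; Get 22 2 15 0;
     Get 23 3 20 0; Inc 23; Put 3 20 0 23; Put 4 20 22 23;
     Push 4 20 22 21 15; Push 5 23 0 20 22;
     Get 24 3 21 0; Inc 24; Put 3 21 0 24; Put 4 21 22 24;
     Push 4 21 22 20 15; Push 5 24 0 21 22])).

Definition delete_code : acmd :=
  Seq (block [:: Pop 26 27 4 21 22; Get 28 6 27 0])
  (Seq (If 28 Skip (block [:: Put 6 27 0 8; Get 29 4 26 22; Put 7 27 0 29; Diff 29 29 9;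
                              Put 4 26 22 29; Push 5 29 0 26 22; Diff 6 6 9]))
       (block [:: Len 25 4 21 22])).

Definition visit_code : acmd :=
  Seq (block [:: Inc 8; Len 25 4 21 22]) (Seq (While 25 delete_code) (block [:: Diff 7 7 9])).

Definition main_code : acmd :=
  While 6 (Seq (block [:: Len 20 5 7 0])
    (If 20 (Seq (block [:: Pop 21 22 5 7 0; Get 23 4 21 22; Diff 24 23 7]) (If 24 Skip visit_code))
           (block [:: Inc 7]))).

(** Least significant key first: recorded key, deletion time, weight. [Inc 8] is there because times
    range up to the clock inclusively, so that the time buckets number one more than the clock. *)
Definition sort_code : acmd :=
  Seq (distribute 9 6 7 9)
  (Seq (distribute 6 7 6 5)
  (Seq (block [:: Inc 8])
  (Seq (distribute 7 8 2 8)
  (Seq (traverse 10 8 5 (block [:: Get 20 0 15 0; Get 21 1 15 0; Push 1 0 0 20 0; Push 1 0 0 21 0]))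
       (block [:: Len 1 0 0 0; Len 2 1 0 0]))))).

Definition order_code : acmd := Seq read_code (Seq index_code (Seq main_code sort_code)).

(** * Correctness and linear time of the ordering algorithm *)

Section Ordering.
Variables (n : nat) (es : seq (nat * nat * nat)).

Let m := size es.
Let edge e := nth (0, 0, 0) es e.
Let u e := (edge e).1.1.
Let v e := (edge e).1.2.
Let w e := (edge e).2.
Let inp := [:: n, m & flatten [seq [:: q.1.1; q.1.2; q.2] | q <- es]].
Let out := [seq [:: q.1.1; q.1.2] | q <- es].

Definition edge_tables (c : cells) : Prop := forall e, e < m ->
  [/\ c 0 e 0 = u e, c 1 e 0 = v e, c 2 e 0 = w e & c 8 e 0 = m - w e].

Definition headers (s : astate) : Prop :=
  [/\ va s 0 = 0, va s 3 = n, va s 4 = m, va s 5 = m.+1 & va s 9 = 1].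

Definition out_stacks (t : stacks) (l0 l1 : seq nat) : Prop :=
  [/\ [seq q.1 | q <- t 0 0 0] = l0, [seq q.1 | q <- t 1 0 0] = l1
    & forall j x y, j < 2 -> (x, y) != (0, 0) -> t j x y = [::]].

Lemma upd3_origin T (t : nat -> nat -> nat -> T) j l j' x y :
  (x, y) != (0, 0) -> upd3 t j 0 0 l j' x y = t j' x y.
Proof.
by move=> h; rewrite /upd3; case: ifP => // /and3P [_ /eqP hx /eqP hy]; rewrite hx hy in h.
Qed.

Lemma read_ok :
  @wp alang read_code (fun s => [/\ headers s /\ [/\ va s 6 = m, va s 7 = 0 & va s 8 = 0],
    edge_tables (cell s) /\ (forall j x y, 2 < j < 8 -> cell s j x y = 0),
    stk s 9 0 0 = items (iota 0 m) /\ (forall j x y, 2 < j < 9 -> stk s j x y = [::]),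
    out_stacks (stk s) [:: n, m & flatten out] [:: n; m]
  & atick s <= 19 * m + 40]) (ainit inp).
Proof.
pose J k (c : cells) (t : stacks) :=
  [/\ c 13 0 0 = 2 + 3 * k,
      (forall e, e < k -> [/\ c 0 e 0 = u e, c 1 e 0 = v e, c 2 e 0 = w e & c 8 e 0 = m - w e])
      /\ (forall j x y, 2 < j < 8 -> c j x y = 0),
      t 9 0 0 = items (iota 0 k) /\ (forall j x y, 2 < j < 9 -> t j x y = [::]),
      out_stacks t [:: n, m & flatten (take k out)] [:: n; m]
    & t 2 0 0 = [seq (x, 0) | x <- inp]].
have hout : size out = m by rewrite size_map.
apply: wp_seq; apply: wp_ablock; set s1 := aeffs _ _.
have h4 : va s1 4 = m by [].
have J1 : J 0 (cell s1) (stk s1).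
  split=> //=.
  - by split=> // j x y hj; rewrite /upd3; case: ifP => // /andP [/eqP hj']; rewrite hj' in hj.
  - by split=> // j x y hj; rewrite /upd3; do 5 (rewrite ifF; last by lia).
  - split=> //=; first by rewrite take0.
    by move=> j x y hj hxy; rewrite !upd3_origin.
apply: wp_mono (@wp_for 10 4 _ J (fun=> 16) s1 isT J1 _) _; last first.
  move=> s' [hk [j1 [j2 j2'] [j3 j3'] j4 j5] ht]; rewrite h4 in j2 j3 j4 ht.
  split=> //; first by split; split; rewrite hk.
  - by rewrite take_oversize ?hout in j4.
  - by move: ht; rewrite sum_nat_const card_ord /=; lia.
move=> k s2; rewrite h4 => hk h10 hkeep [c1 [c2 c2'] [c3 c3'] [c4 c4' c4''] c5]; apply: wp_ablock.
have h0 : va s2 0 = 0 by rewrite hkeep.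
have h4' : va s2 4 = m by rewrite hkeep.
have e1 : nth 0 inp (2 + 3 * k) = u k.
  by rewrite /inp -[3 * k]addn0 /= (nth_flatten_width (0, 0, 0)).
have e2 : nth 0 inp (2 + 3 * k).+1 = v k.
  by rewrite /inp -addn1 -addnA /= (nth_flatten_width (0, 0, 0)).
have e3 : nth 0 inp (2 + 3 * k).+2 = w k.
  by rewrite /inp -addn2 -addnA /= (nth_flatten_width (0, 0, 0)).
split; [exact: keeps_aeffs | | by rewrite /=; lia].
have ew : nth [::] out k = [:: u k; v k] by rewrite (nth_map (0, 0, 0)).
rewrite /= !h0 h10 h4' c1 c5 !nth_input e1 e2 e3; split.
- by rewrite /upd3 /=; lia.
- split=> [e|j x y hj].
    rewrite /upd3 /= andbT ltnS leq_eqVlt; case: eqP => [-> //|_] /= he.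
    by have [-> -> -> ->] := c2 e he.
  by rewrite /upd3; do 5 (rewrite ifF; last by lia); rewrite c2'.
- split=> [|j x y hj].
    by rewrite /upd3 [LHS]/= c3 -addn1 iotaD /items map_cat cats1.
  by rewrite /upd3; do 3 (rewrite ifF; last by lia); rewrite c3'.
- split=> /=.
  + by rewrite /upd3 /= !map_rcons c4 (take_nth [::]) ?hout // flatten_rcons ew -!cats1 -!catA.
  + by rewrite /upd3 /=.
  + by move=> j x y hj hxy; rewrite !upd3_origin // c4''.
- by rewrite /upd3 /=.
Qed.

Hypotheses (u_lt : forall e, e < m -> u e < n) (v_lt : forall e, e < m -> v e < n).
Hypotheses (w_le : forall e, e < m -> w e <= m).
Hypothesis loopless : forall e, e < m -> u e != v e.
Hypothesis simple : forall e f x y, e < m -> f < m -> ends u v x y e -> ends u v x y f -> e = f.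

Record indexed (ls : seq nat) (c : cells) (t : stacks) : Prop := Indexed {
  ix_deg : forall x, c 3 x 0 = count (inc u v x) ls;
  ix_key : forall x e, e \in ls -> inc u v x e ->
    c 4 x (w e) = count (fun f => inc u v x f && (w e <= w f)) ls /\
    (x, w e) \in t 5 (c 4 x (w e)) 0;
  ix_inc : forall x y f, f \in ls -> ends u v x y f -> (y, f) \in t 4 x (w f);
  ix_ends : forall x y l f, (y, f) \in t 4 x l -> [/\ f \in ls, w f = l & ends u v x y f];
  ix_volume : volume m.+1 1 (t 5) = 2 * size ls /\ volume n m.+1 (t 4) = 2 * size ls }.

(** No inserted edge is lighter than [e], so the running degree in table 3 counts exactly the edges
    of weight at least [w e] and is the key of this level; the keys of heavier levels do not see
    [e]. *)
Lemma index_step ls e c t c' t' : indexed ls c t -> e < m -> size ls < m ->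
  (forall f, f \in ls -> w e <= w f) ->
  (forall x, c' 3 x 0 = if x == v e then (c 3 (v e) 0).+1
                        else if x == u e then (c 3 (u e) 0).+1 else c 3 x 0) ->
  (forall x l, c' 4 x l = if (x == v e) && (l == w e) then (c 3 (v e) 0).+1
     else if (x == u e) && (l == w e) then (c 3 (u e) 0).+1 else c 4 x l) ->
  (forall i j, t' 5 i j = push (push (t 5) (c 3 (u e) 0).+1 0 (u e, w e))
                               (c 3 (v e) 0).+1 0 (v e, w e) i j) ->
  (forall i j, t' 4 i j = push (push (t 4) (u e) (w e) (v e, e)) (v e) (w e) (u e, e) i j) ->
  indexed (rcons ls e) c' t'.
Proof.
move=> [g1 g2 g3 g4 [g5 g6]] hem hsz hw hc hk hQ hI.
have huv := loopless hem.
have cnt (p : pred nat) : count p (rcons ls e) = count p ls + p e.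
  by rewrite -cats1 count_cat /= addn0.
have cle x : c 3 x 0 < m by rewrite g1; apply: leq_ltn_trans (count_size _ _) hsz.
split.
- move=> x; rewrite hc cnt /inc -!g1; case: eqP => [->|_].
    by rewrite orbT addn1.
  by rewrite orbF; case: eqP => [->|_]; rewrite ?addn1 ?addn0.
- move=> x f; rewrite mem_rcons inE => hf hi.
  have [/andP [hx /eqP hwf]|hn] := boolP (inc u v x e && (w f == w e)).
    have hkx : c' 4 x (w f) = (c 3 x 0).+1.
      rewrite hk hwf eqxx !andbT; case: eqP => [-> //|hv]; case: eqP => [-> //|hu].
      by move: hx; rewrite /inc; case/orP => /eqP.
    rewrite hkx hwf cnt hx leqnn addn1 g1; split.
      congr _.+1; apply: eq_in_count => g hg /=; by rewrite hw // andbT.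
    rewrite hQ -g1; move: hx; rewrite /inc => /orP [] /eqP ->.
      exact/mem_push/push_mem.
    exact: push_mem.
  have hf' : f \in ls.
    by case/orP: hf => // /eqP ef; move: hn; rewrite -ef hi eqxx.
  have [e1 e2] := g2 x f hf' hi.
  have hkx : c' 4 x (w f) = c 4 x (w f).
    rewrite hk; move: hn; rewrite /inc; case: (w f == w e); rewrite ?andbF // !andbT.
    by rewrite negb_or => /andP [/negbTE -> /negbTE ->].
  rewrite hkx cnt; split.
    rewrite e1; have := hw f hf'; move: hn; case: (inc u v x e) => /=; last by rewrite addn0.
    by rewrite eqn_leq => hn hle; rewrite hle andbT in hn; rewrite (negbTE hn) addn0.
  by rewrite hQ; do 2 apply: mem_push.
- move=> x y f; rewrite mem_rcons inE => /orP [/eqP ->|hf] he; last first.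
    by rewrite hI; do 2 apply: mem_push; apply: g3.
  rewrite hI; case/orP: he => /andP [/eqP -> /eqP ->]; last exact: push_mem.
  exact/mem_push/push_mem.
- move=> x y l f; rewrite hI => /push_inv [/push_inv [|]|].
  + by move=> /g4 [h1 h2 h3]; split=> //; rewrite mem_rcons inE h1 orbT.
  + by move=> [-> -> [-> ->]]; rewrite mem_rcons inE eqxx /ends !eqxx.
  + by move=> [-> -> [-> ->]]; rewrite mem_rcons inE eqxx /ends !eqxx orbT.
- rewrite (volume_ext _ _ hQ) (volume_ext _ _ hI) !volume_push ?ltnS //; try exact: u_lt; try exact: v_lt.
  + by rewrite g5 g6 size_rcons; lia.
  + exact: w_le.
  + exact: w_le.
Qed.

Definition weight_order := dist m.+1 (fun e => m - w e) (iota 0 m).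

Lemma weight_order_perm : perm_eq weight_order (iota 0 m).
Proof. by apply: dist_perm => e _; lia. Qed.

Lemma weight_order_split p e q : weight_order = p ++ e :: q ->
  [/\ e < m, size p < m & forall f, f \in p -> w e <= w f].
Proof.
move=> h; have hp := weight_order_perm; have hs := perm_size hp; rewrite h in hs.
have hm f : f \in weight_order -> f < m by rewrite (perm_mem hp) mem_iota.
have hem : e < m by apply: hm; rewrite h mem_cat inE eqxx orbT.
split=> //; first by move: hs; rewrite size_cat size_iota /=; lia.
move=> f hf; have : pairwise (lexi (fun e => m - w e) (fun _ _ => true)) weight_order.
  by apply: dist_pairwise; elim: (iota 0 m) => //= a l ->; rewrite andbT; apply/allP.
rewrite h pairwise_cat => /andP [/allrelP /(_ f e hf)]; rewrite inE eqxx => /(_ isT).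
have hfm : f < m by apply: hm; rewrite h mem_cat hf.
by have := w_le hem; have := w_le hfm; rewrite /lexi; lia.
Qed.

Lemma index_ok s0 : headers s0 -> edge_tables (cell s0) ->
  (forall j x y, 2 < j < 8 -> cell s0 j x y = 0) -> stk s0 9 0 0 = items (iota 0 m) ->
  (forall j x y, 2 < j < 9 -> stk s0 j x y = [::]) ->
  @wp alang index_code (fun s => [/\ keeps 10 s0 s, indexed weight_order (cell s) (stk s),
     forall j x y, j \notin [:: 3; 4] -> cell s j x y = cell s0 j x y,
     forall j x y, j \notin [:: 3; 4; 5] -> stk s j x y = stk s0 j x y
   & atick s <= atick s0 + 40 * m + 40]) s0.
Proof.
move=> [h0 h3 h4 h5 h9] hE hc h9s ht.
have i1 : iota 0 1 = [:: 0] by [].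
apply: wp_seq; apply: wp_mono (@distribute_ok 9 3 8 9 s0 (fun=> iota 0 m) isT isT h0 _ _) _.
- by rewrite h9 => -[|a].
- by move=> a; apply: ht.
rewrite h9 i1 /= cats0 size_iota => s1 [k1 c1 t1 t1' a1].
pose J (q : seq (nat * nat)) (c : cells) (t : stacks) :=
  [/\ indexed [seq p.1 | p <- q] c t,
      forall j x y, j \notin [:: 3; 4] -> c j x y = cell s0 j x y,
      forall j x y, j \notin [:: 3; 4; 5] -> t j x y = stk s0 j x y
    & forall a, t 3 a 0 = items [seq e <- iota 0 m | m - w e == a]].
have z1 : va s1 0 = 0 by rewrite k1.
have v5 : va s1 5 = m.+1 by rewrite k1.
have hflat : flatten [seq items [seq e <- iota 0 m | m - w e == a] | a <- iota 0 (va s1 5)] =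
    items weight_order by rewrite items_flatten v5.
have hitems l : [seq p.1 | p <- items l] = l by rewrite /items -map_comp map_id.
have J0 : J [::] (cell s1) (stk s1).
  have tot0 A B (f : nat -> nat -> seq (nat * nat)) : (forall i j, f i j = [::]) -> volume A B f = 0.
    by move=> hf; rewrite /volume big1 // => i _; rewrite big1 // => j _; rewrite hf.
  split=> //.
  - split=> //.
    + by move=> x; rewrite c1 hc.
    + by move=> x y l f; rewrite t1' // ht.
    + by rewrite !tot0 // => i j; rewrite t1' ?ht.
  - by move=> j x y _; rewrite c1.
  - by move=> j x y; rewrite !inE => hj; rewrite t1' //; lia.
  - move=> a; rewrite t1; congr items; apply: eq_in_filter => e; rewrite mem_iota => he.
    by have [_ _ _ ->] := hE e he.
apply: wp_mono (@wp_traverse 10 3 5 _ J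
  (fun a => items [seq e <- iota 0 m | m - w e == a]) 15 s1 isT z1 J0 _ _) _.
- by move=> q c t [_ _ _ h] a _; rewrite h.
- move=> q e q' s; rewrite hflat => /items_split [p [q2 [-> hsp _]]] h15 h16 hk [j1 j2 j3 j4].
  rewrite hitems in j1; have [hem hsz hw] := weight_order_split hsp.
  apply: wp_ablock; have z : va s 0 = 0 by rewrite hk.
  have [eu ev ew _] := hE e.1 hem.
  split; [exact: keeps_aeffs | | by rewrite /=; lia].
  rewrite /J map_rcons hitems /= !z !h15.
  have -> : cell s 0 e.1 0 = u e.1 by rewrite j2 // eu.
  have -> : cell s 1 e.1 0 = v e.1 by rewrite j2 // ev.
  have -> : cell s 2 e.1 0 = w e.1 by rewrite j2 // ew.
  have huv := loopless hem.
  have hvu : (v e.1 == u e.1) = false by rewrite eq_sym; apply/negbTE.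
  split.
  + apply: (index_step j1 hem hsz hw).
    * by move=> x; rewrite /upd3 /= !andbT hvu /=.
    * by move=> x l; rewrite /upd3 /= hvu /=.
    * by move=> i j; rewrite /upd3 /push /= hvu /=.
    * by move=> i j; rewrite /upd3 /push /= hvu /=.
  + by move=> j x y hj; rewrite /upd3; move: (hj); rewrite !inE => hj'; do 4 (rewrite ifF; last by lia); exact: j2.
  + by move=> j x y hj; rewrite /upd3; move: (hj); rewrite !inE => hj'; do 4 (rewrite ifF; last by lia); exact: j3.
  + by move=> a; rewrite /upd3 /= j4.
- move=> s' [k2 [j1 j2 j3 j4] a2]; rewrite hflat hitems in j1; split=> //.
  + exact: keeps_trans k1 k2.
  + move: a2; rewrite hflat size_map (perm_size weight_order_perm) size_iota v5; lia.
Qed.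

(* Each queue entry prepays its visit and the step back to the previous bucket, and each
   remaining edge the queue entry pushed by its deletion. *)
Definition potential (s : astate) :=
  20 * volume m.+1 1 (stk s 5) + 10 * volume n m.+1 (stk s 4) + 30 * va s 6 + 4 * (m - va s 7).

(** The visit clock is bounded by the elapsed time so that the later traversal of the time buckets
    is linear. *)
Definition frame (s0 s : astate) : Prop :=
  [/\ headers s, forall j x y, j \notin [:: 4; 6; 7] -> cell s j x y = cell s0 j x y,
      forall j x y, j \notin [:: 4; 5] -> stk s j x y = stk s0 j x y & va s 8 <= atick s].

Definition main_state (s : astate) : Prop :=
  main_inv m u v w (va s 7) (va s 8) (va s 6) (cell s 4) (fun f => cell s 6 f 0)
    (fun f => cell s 7 f 0) (fun d => stk s 5 d 0) (stk s 4).

Definition inner_state (x l : nat) (s : astate) : Prop :=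
  [/\ va s 21 = x, va s 22 = l, va s 25 = size (stk s 4 x l)
    & inner_inv m u v w (va s 7) (va s 8) x l (va s 6) (cell s 4) (fun f => cell s 6 f 0)
        (fun f => cell s 7 f 0) (fun d => stk s 5 d 0) (stk s 4)].

Lemma take_rcons T (q : seq T) z : take (size (rcons q z)).-1 (rcons q z) = q.
Proof. by rewrite size_rcons -cats1 take_size_cat. Qed.

(** The popped incidence entry frees 10 units, enough for a stale one. A genuine deletion also frees
    the 30 of its edge and spends 20 on the new queue entry, which leaves 20 for 12 ticks. *)
Lemma delete_ok s0 N x l s : inner_state x l s -> frame s0 s ->
  atick s + potential s + 6 <= N -> va s 25 <> 0 ->
  @wp alang delete_code (fun s' => [/\ inner_state x l s', frame s0 s'
    & atick s' + potential s' + 6 <= N]) (atest s).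
Proof.
move=> [h21 h22 h25 hinv] [[h0 h3 h4 h5 h9] hc ht h8] hpot hne.
have : stk s 4 x l <> [::] by move=> h; rewrite h25 h in hne.
move eL: (stk s 4 x l) => L; case/lastP: L eL => [//|q [y e]] hI _.
have [hem hwe hends] : [/\ e < m, w e = l & ends u v x y e].
  by apply: (ii_ends hinv); rewrite hI mem_rcons inE eqxx.
have hxn : x < n.
  by case/orP: hends => /andP [/eqP -> _]; [apply: u_lt | apply: v_lt].
have hlm : l < m.+1 by rewrite -hwe ltnS w_le.
apply: wp_seq; apply: wp_ablock; set s1 := aeffs _ _.
have e26 : va s1 26 = y by rewrite /= h21 h22 hI last_rcons.
have e27 : va s1 27 = e by rewrite /= h21 h22 hI last_rcons.
have e28 : va s1 28 = cell s 6 e 0 by rewrite /= h21 h22 hI last_rcons h0.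
have eI a b : stk s1 4 a b = if (a == x) && (b == l) then q else stk s 4 a b.
  by rewrite /= h21 h22 hI take_rcons /upd3.
have vI : volume n m.+1 (stk s1 4) + 1 = volume n m.+1 (stk s 4).
  by have := volume_upd hxn hlm eI; rewrite hI size_rcons; lia.
have k1 : keeps 26 s s1 by apply: (@keeps_aeffs 26 _ (atest s)).
have t1 j a b : j != 4 -> stk s1 j a b = stk s j a b.
  by move=> hj; rewrite /= /upd3 (negbTE hj).
have c1 : cell s1 = cell s by [].
have t5 : stk s1 5 = stk s 5 by [].
have a1 : atick s1 = atick s + 3 by rewrite /=; lia.
clearbody s1.
have hlen s2 : va s2 21 = x -> va s2 22 = l -> inner_state x l (aeffs [:: Len 25 4 21 22] s2) <->
    inner_inv m u v w (va s2 7) (va s2 8) x l (va s2 6) (cell s2 4) (fun f => cell s2 6 f 0)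
        (fun f => cell s2 7 f 0) (fun d => stk s2 5 d 0) (stk s2 4).
  by move=> e1 e2; split=> [[_ _ _]|h] //; split=> //=; rewrite e1 e2.
apply: wp_seq; apply: wp_if => h28.
- have he : cell s 6 e 0 = 0 by rewrite -e28.
  apply: wp_ablock; set s2 := aeffs _ _.
  have f0 : va s1 0 = 0 by rewrite k1.
  have q21 : va s1 21 = x by rewrite k1.
  have q22 : va s1 22 = l by rewrite k1.
  have q8 : va s1 8 = va s 8 by rewrite k1.
  have q9 : va s1 9 = 1 by rewrite k1.
  have q6 : va s1 6 = va s 6 by rewrite k1.
  have q7 : va s1 7 = va s 7 by rewrite k1.
  have hxy := ends_neq loopless hem hends.
  have esK f : cell s2 6 f 0 = if f == e then va s 8 else cell s 6 f 0.
    by rewrite /s2 /= c1 f0 e27 q8 /upd3 /= andbT.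
  have esD f : cell s2 7 f 0 = if f == e then cell s 4 y l else cell s 7 f 0.
    by rewrite /s2 /= c1 f0 e27 e26 q22 /upd3 /= andbT.
  have esk a b : cell s2 4 a b = if (a == y) && (b == l) then (cell s 4 y l).-1 else cell s 4 a b.
    by rewrite /s2 /= c1 f0 e27 e26 q22 q9 /upd3 /= subn1.
  have esQ k : stk s2 5 k 0 = if k == (cell s 4 y l).-1 then rcons (stk s 5 k 0) (y, l) else stk s 5 k 0.
    rewrite /s2 /= c1 f0 e27 e26 q22 q9 /upd3 /= subn1 andbT !t1 //.
    by case: eqP => // ->.
  have [hinv' hrem hkm] := inner_assign loopless simple hinv hI eI he esK esD esk esQ.
  have hin2 : inner_inv m u v w (va s2 7) (va s2 8) x l (va s2 6) (cell s2 4)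
      (fun f => cell s2 6 f 0) (fun f => cell s2 7 f 0) (fun d => stk s2 5 d 0) (stk s2 4).
    have -> : va s2 6 = (va s 6).-1 by rewrite /s2 /= q6 q9 subn1.
    have -> : va s2 7 = va s 7 by rewrite /s2 /= q7.
    have -> : va s2 8 = va s 8 by rewrite /s2 /= q8.
    have -> : stk s2 4 = stk s1 4 by [].
    exact: hinv'.
  have vQ : volume m.+1 1 (stk s2 5) = (volume m.+1 1 (stk s 5)).+1.
    have hk : (cell s 4 y l).-1 < m.+1 by lia.
    rewrite -(@volume_push m.+1 1 (stk s 5) _ 0 (y, l) hk isT); apply: volume_ext => a b.
    by rewrite /s2 /= c1 f0 e27 e26 q22 q9 /upd3 /push /= subn1 !t1.
  apply: wp_ablock; split.
  + by apply/hlen.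
  + split.
    * by split; rewrite /s2 /= k1.
    * move=> j a b; rewrite !inE => hj; rewrite -hc ?inE // /s2 /= c1 /upd3.
      have -> : (j == 4) = false by lia.
      have -> : (j == 6) = false by lia.
      by have -> : (j == 7) = false by lia.
    * move=> j a b; rewrite !inE => hj; rewrite -ht ?inE // /s2 /= /upd3 (t1 j); last by lia.
      by have -> : (j == 5) = false by lia.
    * by rewrite /s2 /= q8 a1; lia.
  + move: hpot; rewrite /potential.
    have -> : stk (aeffs [:: Len 25 4 21 22] s2) = stk s2 by [].
    have -> : va (aeffs [:: Len 25 4 21 22] s2) 6 = (va s 6).-1 by rewrite /s2 /= q6 q9 subn1.
    have -> : va (aeffs [:: Len 25 4 21 22] s2) 7 = va s 7 by rewrite /s2 /= q7.
    have -> : atick (aeffs [:: Len 25 4 21 22] s2) = atick s + 12 by rewrite /s2 /= a1; lia.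
    have -> : stk s2 4 = stk s1 4 by [].
    by rewrite vQ -vI; lia.
- have he : cell s 6 e 0 != 0 by apply/eqP; rewrite -e28.
  apply: wp_skip; apply: wp_ablock; have hinv' := inner_skip hinv hI eI he.
  have q22 : va s1 22 = l by rewrite k1.
  split.
  + by apply/hlen => //; rewrite /= !k1 // c1 t5.
  + split.
    * by split; rewrite /= k1.
    * by move=> j a b hj; rewrite /= c1 hc.
    * by move=> j a b hj; rewrite /= t1 ?ht //; move: hj; rewrite !inE; lia.
    * by rewrite /= k1 // a1; lia.
  + move: hpot; rewrite /potential /= t5 !k1 // a1 -vI; lia.
Qed.

(** Of the 8 units in reserve, 2 pay for the clock and the first length; the 6 kept through the loop
    pay for the last test, the decrement of the bucket and the 4 units by which it raises the
    potential. *)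
Lemma visit_ok s0 N x l s : va s 21 = x -> va s 22 = l -> va s 7 <= m ->
  inner_inv m u v w (va s 7) (va s 8).+1 x l (va s 6) (cell s 4) (fun f => cell s 6 f 0)
        (fun f => cell s 7 f 0) (fun d => stk s 5 d 0) (stk s 4) ->
  frame s0 s -> atick s + potential s + 8 <= N ->
  @wp alang visit_code (fun s' => [/\ main_state s', frame s0 s' & atick s' + potential s' <= N]) s.
Proof.
move=> h21 h22 h7 hinv [hh hc ht h8] hpot.
apply: wp_seq; apply: wp_ablock; apply: wp_seq.
pose I s1 := [/\ inner_state x l s1, frame s0 s1 & atick s1 + potential s1 + 6 <= N].
apply: (@wp_while alang _ _ I _ N).
- split.
  + by split=> //=; rewrite h21 h22.
  + by split=> //=; lia.
  + by move: hpot; rewrite /potential /=; lia.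
- by move=> s1 [_ _]; rewrite /=; lia.
- by move=> s1 [i1 i2 i3]; apply: delete_ok.
- move=> s1 [[j21 j22 j25 jinv] [jh jc jt j8] jpot] /= j0.
  apply: wp_ablock; have h9 : va s1 9 = 1 by case: jh.
  have hI : stk s1 4 x l = [::] by apply: size0nil; rewrite -j25.
  split.
  + by rewrite /main_state /= h9 subn1; exact: (inner_exit simple jinv hI).
  + by split=> //=; lia.
  + by move: jpot; rewrite /potential /= h9; lia.
Qed.

(** Moving to the next bucket takes 4 ticks, the loss in [4 * (m - va s 7)]. A popped queue entry
    frees 20: 6 ticks for popping and comparing, 14 for the visit. The extra tick in [N.+1] is the
    last test. *)
Lemma main_ok s0 N : main_state s0 -> headers s0 -> va s0 8 <= atick s0 ->
  atick s0 + potential s0 <= N ->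
  @wp alang main_code (fun s => [/\ main_state s /\ va s 6 = 0, frame s0 s & atick s <= N.+1]) s0.
Proof.
move=> hm hh h8 hN.
pose I s := [/\ main_state s, frame s0 s & atick s + potential s <= N].
apply: (@wp_while alang _ _ I _ N).
- by split.
- by move=> s [_ _]; rewrite /=; lia.
- move=> s [hms [[z h3 h4 h5 h9] hc ht h8s] hpot] /eqP /= hrem.
  apply: wp_seq; apply: wp_ablock; apply: wp_if => /= [/eqP|/eqP]; rewrite z.
    rewrite size_eq0 => /eqP hQ; apply: wp_ablock.
    have hms' := main_empty hms hrem hQ.
    split=> //; first by split=> //=; lia.
    have := mi_d hms'; move: hpot; rewrite /potential /=; lia.
  move=> hne; have : stk s 5 (va s 7) 0 <> [::] by move=> h; rewrite h in hne.
  move eL: (stk s 5 (va s 7) 0) => L; case/lastP: L eL => [//|q [x l]] hQ _.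
  apply: wp_seq; apply: wp_ablock; set s1 := aeffs _ _.
  have eQ a b : stk s1 5 a b = if (a == va s 7) && (b == 0) then q else stk s 5 a b.
    by rewrite /= z hQ take_rcons /upd3.
  have eQ0 a : stk s1 5 a 0 = if a == va s 7 then q else stk s 5 a 0 by rewrite eQ andbT.
  have hd := mi_d hms.
  have vQ : volume m.+1 1 (stk s1 5) + 1 = volume m.+1 1 (stk s 5).
    have hd' : va s 7 < m.+1 by [].
    by have := volume_upd hd' (isT : 0 < 1) eQ; rewrite hQ size_rcons; lia.
  have e21 : va s1 21 = x by rewrite /= z hQ last_rcons.
  have e22 : va s1 22 = l by rewrite /= z hQ last_rcons.
  have e24 : va s1 24 = cell s 4 x l - va s 7 by rewrite /= z hQ last_rcons.
  have k1 : keeps 20 s s1 by move=> a ha; rewrite /= !ifN //; lia.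
  have t4 : stk s1 4 = stk s 4 by [].
  have t1 j a b : (j != 5 :> nat) -> stk s1 j a b = stk s j a b.
    by move=> hj; rewrite /= /upd3 (negbTE hj).
  have c1 : cell s1 = cell s by [].
  have a1 : atick s1 = atick s + 6 by rewrite /=; lia.
  clearbody s1.
  have f1 : frame s0 s1.
    split; first by split; rewrite k1.
    - by move=> j a b hj; rewrite c1 hc.
    - by move=> j a b hj; rewrite t1 ?ht //; move: hj; rewrite !inE; lia.
    - by rewrite k1 // a1; lia.
  have pot1 : atick s1 + potential s1 + 14 <= N.
    by move: hpot; rewrite /potential t4 !k1 // a1 -vQ; lia.
  apply: wp_if => h24.
    have hk : cell s 4 x l <= va s 7 by move: h24; rewrite /= e24; lia.
    apply: (@visit_ok s0 N x l) => //.
    + by rewrite /= k1.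
    + by rewrite /= !k1 // c1 t4; apply: main_enter hms hQ eQ0 hk.
    + by case: f1 => a1' a2 a3 a4; split=> //=; lia.
    + by move: pot1; rewrite /potential /=; lia.
  have hk : va s 7 < cell s 4 x l by move: h24; rewrite /= e24; lia.
  apply: wp_skip; split.
  + by rewrite /main_state /= !k1 // c1 t4; apply: main_skip hms hQ eQ0 hk.
  + by case: f1 => a1' a2 a3 a4; split=> //=; lia.
  + by move: pot1; rewrite /potential /=; lia.
- move=> s [hms [hhs hc ht h8s] hpot] /= h0; split=> //.
  + by split=> //=; lia.
  + by rewrite /=; lia.
Qed.

Definition sorted_edges (tt kd : nat -> nat) (T : nat) : seq nat :=
  dist m.+1 w (dist T.+1 tt (dist m.+1 kd (iota 0 m))).

Lemma items_fst l : [seq p.1 | p <- items l] = l.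
Proof. by rewrite /items -map_comp map_id. Qed.

Lemma sort_ok s0 (tt kd : nat -> nat) : headers s0 -> edge_tables (cell s0) ->
  (forall e, cell s0 6 e 0 = tt e) -> (forall e, cell s0 7 e 0 = kd e) ->
  (forall e, e < m -> tt e <= va s0 8) -> (forall e, e < m -> kd e <= m) ->
  stk s0 9 0 0 = items (iota 0 m) ->
  (forall j x y, 5 < j < 9 -> stk s0 j x y = [::]) ->
  out_stacks (stk s0) [:: n, m & flatten out] [:: n; m] ->
  @wp alang sort_code (fun s =>
    outputs s [:: n, m & flatten out]
      [:: n, m & flatten [seq [:: u e; v e] | e <- sorted_edges tt kd (va s0 8)]] /\
    atick s <= atick s0 + 40 * m + 7 * va s0 8 + 50) s0.
Proof.
move=> [z h3 h4 h5 h9] hE h6 h7 htt hkd hs9 hs [o0 o1 o2]; set T := va s0 8 in htt *.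
apply: wp_seq; apply: wp_mono (@distribute_ok 9 6 7 9 s0 (fun=> iota 0 m) isT isT z _ _) _.
- by rewrite h9 => -[|a].
- by move=> a; apply: hs.
rewrite h9 [iota 0 1]/= [flatten _]/= cats0 size_iota => s1 [k1 c1 g1 t1 a1].
pose l1 := dist m.+1 kd (iota 0 m).
have p1 : perm_eq l1 (iota 0 m).
  by apply: dist_perm => e; rewrite mem_iota => he; rewrite ltnS hkd.
have z1 : va s1 0 = 0 by rewrite k1.
have v1 : va s1 5 = m.+1 by rewrite k1.
apply: wp_seq.
apply: wp_mono (@distribute_ok 6 7 6 5 s1 (fun a => [seq e <- iota 0 m | kd e == a]) isT isT z1 _ _) _.
- by move=> a _; rewrite g1; congr items; apply: eq_filter => e; rewrite h7.
- by move=> a; rewrite t1 ?hs.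
rewrite v1 -/(dist _ _ _) -/l1 (perm_size p1) size_iota => s2 [k2 c2 g2 t2 a2].
apply: wp_seq; apply: wp_ablock; apply: wp_seq; set s3 := aeffs _ _.
pose l2 := dist T.+1 tt l1.
have p2 : perm_eq l2 l1.
  by apply: dist_perm => e; rewrite (perm_mem p1) mem_iota => he; rewrite ltnS htt.
have z3 : va s3 0 = 0 by rewrite /= k2 ?z1.
have v3 : va s3 8 = T.+1 by rewrite /= k2 ?k1.
apply: wp_mono (@distribute_ok 7 8 2 8 s3 (fun a => [seq e <- l1 | tt e == a]) isT isT z3 _ _) _.
- by move=> a _; rewrite [stk _]/= g2; congr items; apply: eq_filter => e; rewrite c1 h6.
- by move=> a; rewrite [stk _]/= t2 // t1 ?hs.
rewrite v3 -/(dist _ _ _) -/l2 (perm_size p2) (perm_size p1) size_iota => s4 [k4 c4 g4 t4 a4].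
have z4 : va s4 0 = 0 by rewrite k4.
have v4 : va s4 5 = m.+1 by rewrite k4 //= k2.
have c40 : cell s4 = cell s0 by rewrite c4 [cell _]/= c2 c1.
have hl2 e : e \in l2 -> e < m by rewrite (perm_mem p2) (perm_mem p1) mem_iota.
have p3 : perm_eq (sorted_edges tt kd T) l2.
  by apply: dist_perm => e /hl2 he; rewrite ltnS w_le.
pose L a := [seq e <- l2 | w e == a].
have hflat : flatten [seq items (L a) | a <- iota 0 (va s4 5)] = items (sorted_edges tt kd T).
  by rewrite items_flatten v4.
have st j x y : j < 2 -> stk s4 j x y = stk s0 j x y.
  by move=> hj; rewrite t4 ?[stk _]/= ?t2 ?t1 //; lia.
pose J (q : seq (nat * nat)) (c : cells) (t : stacks) :=
  [/\ c = cell s0, forall a, t 8 a 0 = items (L a)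
    & out_stacks t [:: n, m & flatten out]
        [:: n, m & flatten [seq [:: u e; v e] | e <- [seq p.1 | p <- q]]]].
have J0 : J [::] (cell s4) (stk s4).
  split=> //.
  - move=> a; rewrite g4; congr items; apply: eq_in_filter => e /hl2 he.
    by rewrite [cell _]/= c2 c1; have [_ _ -> _] := hE e he.
  - by split=> /=; rewrite ?st // => j x y hj hxy; rewrite st ?o2.
apply: wp_seq; apply: wp_mono (@wp_traverse 10 8 5 _ J (fun a => items (L a)) 4 s4 isT z4 J0 _ _) _.
- by move=> q c t [_ h _] a _; rewrite h.
- move=> q e q' s; rewrite hflat => /items_split [p [q2 [-> hsp _]]] h15 h16 hk [j1 j2 [j3 j4 j5]].
  have hem : e.1 < m.
    by apply: hl2; rewrite -(perm_mem p3) hsp mem_cat inE eqxx orbT.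
  apply: wp_ablock; have zs : va s 0 = 0 by rewrite hk.
  have [eu ev _ _] := hE e.1 hem.
  split; [exact: keeps_aeffs | | by rewrite /=; lia].
  rewrite /J map_rcons items_fst /= !zs !h15 j1 eu ev; split=> //; split.
  + by rewrite /upd3 /=.
  + rewrite /upd3 /= !map_rcons j4 items_fst -!cats1 flatten_cat /=.
    by rewrite -!catA.
  + by move=> j x y hj hxy; rewrite !upd3_origin ?j5.
- move=> s5 [k5 [j1 j2 [j3 j4 j5]] a5]; rewrite hflat items_fst in j4; apply: wp_ablock.
  have z5 : va s5 0 = 0 by rewrite k5.
  split.
    split=> //=; rewrite ?z5 //.
      by have := congr1 size j3; rewrite size_map.
    by have := congr1 size j4; rewrite size_map.
  move: a5; rewrite hflat size_map (perm_size p3) (perm_size p2) (perm_size p1) size_iota v4.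
  by move: a4 => /=; lia.
Qed.

Lemma main_init s : va s 6 = m -> va s 7 = 0 -> va s 8 = 0 ->
  (forall x, cell s 6 x 0 = 0) -> indexed weight_order (cell s) (stk s) -> main_state s.
Proof.
move=> h6 h7 h8 hc [_ g2 g3 g4 _]; rewrite /main_state h6 h7 h8.
have hmem f : (f \in weight_order) = (f < m) by rewrite (perm_mem weight_order_perm) mem_iota.
split=> //.
- by move=> f _; rewrite hc.
- move=> y f hf _ hi; have [e1 e2] := g2 y f (etrans (hmem f) hf) hi; split=> //.
  rewrite e1 (permP weight_order_perm); apply: eq_count => e /=; congr (_ && _).
  by rewrite /live /pend hc andbT leq_eqVlt orbC eq_sym.
- by move=> x y f hf _; apply: g3; rewrite hmem.
- by move=> x y l f /g4 [h1 h2 h3]; rewrite -hmem.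
- rewrite (eq_count (a2 := predT)) ?count_predT ?size_iota // => f /=.
  by rewrite hc.
- by move=> e _; rewrite hc.
Qed.

(** Sorting spends 7 ticks per value of the visit clock, and this clock is only bounded by the time
    spent before; this multiplication explains the size of 1300. *)
Theorem order_ok :
  @wp alang order_code (fun s => exists tt kd T,
    [/\ forall e, e < m -> 0 < tt e <= T /\ scheduled m u v w tt kd e,
        outputs s [:: n, m & flatten out]
          [:: n, m & flatten [seq [:: u e; v e] | e <- sorted_edges tt kd T]]
      & atick s <= 1300 * (in_size inp).+1]) (ainit inp).
Proof.
apply: wp_seq; apply: wp_mono read_ok _ => s1 [[hh1 [v6 v7 v8]] [hE1 hc1] [h91 hs1] ho1 a1].
apply: wp_seq; apply: wp_mono (index_ok hh1 hE1 hc1 h91 hs1) _ => s2 [k2 ix c2 t2 a2].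
have hh2 : headers s2 by case: hh1 => *; split; rewrite k2.
have hm2 : main_state s2 by apply: main_init; rewrite ?k2 // => x; rewrite c2 ?hc1.
(* Two queue entries and two incidence entries per edge give 40 and 20, the edge itself 30, and the
   bucket, initially 0, gives 4. *)
have pot2 : potential s2 = 94 * m.
  rewrite /potential; have [-> ->] := ix_volume ix; rewrite (perm_size weight_order_perm) size_iota !k2 // v6 v7; lia.
have h8 : va s2 8 <= atick s2 by rewrite k2 // v8.
apply: wp_seq; apply: wp_mono (@main_ok s2 (atick s2 + potential s2) hm2 hh2 h8 (leqnn _)) _.
move=> s3 [[hm3 v63] [hh3 c3 t3 h83] a3].
have hsch := main_done; rewrite /main_state v63 in hm3.
have {hsch} hsch := main_done hm3.
have hE3 : edge_tables (cell s3) by move=> e he; rewrite !c3 // !c2 //; apply: hE1.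
have h93 : stk s3 9 0 0 = items (iota 0 m) by rewrite t3 // t2.
have hs3 j x y : 5 < j < 9 -> stk s3 j x y = [::].
  by move=> hj; rewrite t3 ?t2 ?hs1 // ?inE; lia.
have ho3 : out_stacks (stk s3) [:: n, m & flatten out] [:: n; m].
  case: ho1 => o1 o2 o3; split; [by rewrite t3 // t2 | by rewrite t3 // t2 | ].
  by move=> j x y hj hxy; rewrite t3 ?t2 ?o3 // ?inE; lia.
apply: wp_mono (sort_ok hh3 hE3 (fun=> erefl) (fun=> erefl) _ _ h93 hs3 ho3) _.
- by move=> e he; have [/andP [_ ->]] := hsch e he.
- by move=> e he; have [_ [x [y [_ _ _ -> _]]]] := hsch e he; apply: ldeg_max.
- move=> s4 [ho4 a4].
  exists (fun e => cell s3 6 e 0), (fun e => cell s3 7 e 0), (va s3 8); split=> //.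
  have hin : m <= in_size inp.
    by rewrite /in_size /inp /= (size_flatten_width (w := 3)) // -/m; lia.
  move: a1 a2 a3 h83 a4; rewrite pot2; lia.
Qed.

End Ordering.

(** * The computed order is degree-minimal *)

Section Minimal.
Variables (m T : nat) (u v w tt kd : nat -> nat) (ord p q : seq nat) (e : nat).
Hypothesis loopless : forall e, e < m -> u e != v e.
Hypothesis simple : forall e f x y, e < m -> f < m -> ends u v x y e -> ends u v x y f -> e = f.
Hypothesis sched : forall e, e < m -> 0 < tt e <= T /\ scheduled m u v w tt kd e.
Hypothesis ord_perm : perm_eq ord (iota 0 m).
Hypothesis ord_sorted : pairwise (lexi w (lexi tt (lexi kd (fun _ _ => true)))) ord.
Hypothesis ord_split : ord = p ++ e :: q.

(** The degree of [z] at the time of the visit counts the edges present just before [e] and the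
    [c z] edges of [p] deleted earlier in the same visit. Subtracting the latter turns minimality at
    the start of the visit into minimality at the deletion of [e]. *)
Lemma order_minimal : exists x y, [/\ ends u v x y e,
  forall f z, f \in e :: q -> w f = w e -> inc u v z f ->
    count (inc u v x) (e :: q) <= count (inc u v z) (e :: q)
  & forall f z, f \in e :: q -> w f = w e -> ends u v x z f ->
    count (inc u v y) (e :: q) <= count (inc u v z) (e :: q)].
Proof.
have hm f : f \in ord -> f < m by rewrite (perm_mem ord_perm) mem_iota.
have hqm f : f \in e :: q -> f < m by move=> h; apply: hm; rewrite ord_split mem_cat h orbT.
have hpm f : f \in p -> f < m by move=> h; apply: hm; rewrite ord_split mem_cat h.
have hem : e < m by apply: hqm; rewrite inE eqxx.
have hu : uniq ord by rewrite (perm_uniq ord_perm) iota_uniq.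
move: ord_sorted; rewrite ord_split pairwise_cat /= => /and4P [/allrelP lexp _ /allP lexq _].
have [_ [x [y [hends hx ht hkd hmin]]]] := sched hem.
pose lv f := live w tt (w e) (tt e) f.
have live_q f : f \in e :: q -> lv f.
  rewrite inE /lv /live /pend => /orP [/eqP ->|/lexq]; first by rewrite eqxx leqnn !orbT.
  by rewrite /lexi; lia.
have live_p f : f \in p -> lv f -> w f = w e /\ tt f = tt e.
  move=> hf; have := lexp f e hf; rewrite inE eqxx => /(_ isT).
  have [/andP [h0 _] _] := sched (hpm f hf).
  by rewrite /lexi /lv /live /pend; lia.
pose c z := count (inc u v z) [seq f <- p | lv f].
have deg z : ldeg m u v w tt z (w e) (tt e) = c z + count (inc u v z) (e :: q).
  rewrite /ldeg -(permP ord_perm) ord_split count_cat /c count_filter; congr (_ + _).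
  by apply: eq_in_count => f /live_q hf; rewrite -/(lv f) hf andbT.
(* The edges already deleted in this visit all contain [x], so no degree has dropped more than that
   of [x]. *)
have cx z : c z <= c x.
  rewrite /c; apply: leq_trans (count_size _ _) _; rewrite -count_predT; apply: eq_leq.
  apply: eq_in_count => f; rewrite mem_filter => /andP [hl hf]; symmetry.
  by have [h1 h2] := live_p f hf hl; have [] := ht f (hpm f hf) h2.
exists x, y; split=> //.
- move=> f z hf hwf hi; have hp : pend tt (tt e) f.
    by move: (live_q f hf); rewrite /lv /live hwf ltnn eqxx.
  by have := hmin f z (hqm f hf) hwf hp hi; rewrite !deg; move: (cx z) => /=; clear; lia.
- move=> f z hf hwf hez; have [hxf hzf] := ends_inc hez.
  have hfm := hqm f hf.
  have [ef|nef] := eqVneq f e.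
    have -> : z = y; last by [].
    by move: hez hends (loopless hem); rewrite ef /ends; lia.
  have htf : tt f = tt e.
    have := live_q f hf; rewrite /lv /live /pend hwf ltnn eqxx /=.
    by move: (hx f hfm hwf hxf); clear; lia.
  have hk : kd e <= kd f.
    move: hf; rewrite inE (negbTE nef) /= => /lexq.
    by rewrite /lexi hwf htf; lia.
  have [_ [x' [y' [hends' _ ht' hkd' _]]]] := sched hfm.
  have [_ hx'e] := ht' e hem (esym htf); have [hx'f hy'f] := ends_inc hends'.
  have ex : x' = x.
    apply/eqP/negPn/negP => hne; move/eqP: nef; case.
    exact: simple hfm hem (inc_ends hne hx'f hxf) (inc_ends hne hx'e (proj1 (ends_inc hends))).
  have ey : y' = z.
    by move: hends' hez (loopless hfm); rewrite ex /ends; clear; lia.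
  (* An edge of [p] deleted in this visit contains [x]; if it contained [z] too, it would be [f],
     which comes after [p]. So the recorded key of [f] is still the degree of [z]. *)
  have cz : c z = 0.
    apply/eqP; rewrite -leqn0 leqNgt -has_count; apply/hasPn => g.
    rewrite mem_filter => /andP [hl hg]; apply/negP => hzg.
    have [h1 h2] := live_p g hg hl; have [_ hxg] := ht g (hpm g hg) h2.
    have hxz := ends_neq loopless hfm hez.
    have eg := simple (hpm g hg) hfm (inc_ends hxz hxg hzg) hez.
    move: hu; rewrite ord_split cat_uniq => /and3P [_ /hasPn /(_ f hf) /negP hn _].
    by apply: hn; rewrite -eg.
  move: hk; rewrite hkd hkd' ey hwf htf !deg cz add0n.
  exact: leq_trans (leq_addl _ _).
Qed.
End Minimal.

(** * Level graphs and elimination schemes *)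

Lemma graph_eq n (E1 E2 : {set {set 'I_n}}) h1 h2 : E1 = E2 -> @Graph n E1 h1 = @Graph n E2 h2.
Proof. by move=> e; subst E2; rewrite (bool_irrelevance h1 h2). Qed.

Lemma gdel_eq G (A B : {set {set 'I_(gV G)}}) : gE G :\: A = gE G :\: B -> gdel G A = gdel G B.
Proof. exact: graph_eq. Qed.

Lemma gdel_none G (A : {set {set 'I_(gV G)}}) : gE G :&: A = set0 -> gdel G A = G.
Proof.
case: G A => n E h A /= hA; apply: graph_eq; apply/setP => e; rewrite inE.
by move/setP/(_ e): hA; rewrite !inE; case: (e \in E); case: (e \in A).
Qed.

Lemma gdel_gdel G (A B : {set {set 'I_(gV G)}}) : gdel (gdel G A) B = gdel G (A :|: B).
Proof. by apply: graph_eq; rewrite /= setDDl. Qed.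

Lemma filter_take T (f : T -> nat) (s : seq T) i :
  pairwise (fun a b => f a <= f b) s ->
  [seq a <- s | f a < i] = take (count (fun a => f a < i) s) s.
Proof.
elim: s => //= a s IH /andP [ha hs]; case: ltnP => h /=; first by rewrite IH.
have h0 : forall t, all (fun b => f a <= f b) t -> [seq b <- t | f b < i] = [::].
  elim=> //= b t IHt /andP [hb ht]; rewrite ltnNge (leq_trans h hb) /=; exact: IHt.
by rewrite -size_filter (h0 s ha) take0.
Qed.

Section Levels.
Variables (C : gclass) (G : graph) (om : {set 'I_(gV G)} -> nat) (tau : seq {set 'I_(gV G)}).
Hypothesis hdsm : degree_sandwich_monotone C.
Hypothesis tau_ord : edge_ordering tau.
Hypothesis tau_sorted : pairwise (fun a b => om a <= om b) tau.
Hypothesis tau_min : forall p e q, tau = p ++ e :: q ->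
  @degree_minimal (gdel G [set a in p]) [set a in e :: q | om a == om e] e.

(** Forwards, the remaining edges of weight [om e] form a safe set just before [e] is deleted, and
    [e] is degree-minimal in it. Backwards, the edges of weight below [i] form a prefix of the
    sorted [tau], so each level graph occurs in the elimination. *)
Lemma level_elim : is_weighted (existT _ G om) ->
  level_class C (existT _ G om) <-> C G /\ safe_elim_scheme C tau.
Proof.
have tau_mem a : (a \in tau) = (a \in gE G) by rewrite (perm_mem tau_ord) mem_enum.
have tau_uniq : uniq tau by rewrite (perm_uniq tau_ord) enum_uniq.
move=> [k0 hk0]; split=> [[k [hk hlev]]|[hG [_ hs]]].
  have hG : C G.
    have := hlev 1 isT; rewrite /level_graph /= gdel_none //.
    apply/setP => a; rewrite !inE; apply/negP => /and3P [ha _ ha1].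
    by have := hk.1 a ha; rewrite /=; lia.
  split=> //; split=> // i /andP [_ hi].
  have {hi} : i <= size tau by [].
  elim: i => [|i IH] hi.
    by rewrite take0 gdel_none //; apply/setP => a; rewrite !inE andbF.
  have hc := IH (ltnW hi); set e := nth set0 tau i; set p := take i tau; set q := drop i.+1 tau.
  have hsplit : tau = p ++ e :: q by rewrite -(drop_nth set0 hi) cat_take_drop.
  have he : e \in gE G by rewrite -tau_mem mem_nth.
  pose F := [set a in e :: q | om a == om e].
  have hpq a : a \in p -> a \notin e :: q.
    move=> ha; apply/negP => ha'; move: tau_uniq.
    by rewrite hsplit cat_uniq => /and3P [_ /hasPn /(_ a ha') /negP].
  have htau a : (a \in gE G) = (a \in p) || (a \in e :: q) by rewrite -tau_mem hsplit mem_cat.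
  move: tau_sorted; rewrite hsplit pairwise_cat /= => /and4P [/allrelP hpe _ /allP hqe _].
  have hsafe : safe_set C (gdel G [set a in p]) F.
    split.
      apply/subsetP => a; rewrite !inE => /andP [ha _].
      have ha' : a \in e :: q by rewrite inE.
      rewrite htau ha' orbT andbT; apply/negP => hap.
      by move: (hpq a hap); rewrite ha'.
    (* Edges of [p] weigh at most [om e] and later ones at least [om e], so [p] and [F] together are
       exactly the edges of weight up to [om e]. *)
    have -> : gdel (gdel G [set a in p]) F = level_graph (existT _ G om) (om e).+1.
      rewrite gdel_gdel; apply: gdel_eq; apply/setP => a; rewrite /= !inE.
      case hag: (a \in gE G); rewrite ?andbF // !andbT ltnS; congr (~~ _).
      move: hag; rewrite htau; case hap: (a \in p) => /=.
        by move=> _; rewrite (hpe a e hap) ?inE ?eqxx.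
      rewrite inE => haq; rewrite haq /=; case/orP: haq => [/eqP ->|haq]; first by rewrite leqnn eqxx.
      by have := hqe a haq; rewrite eqn_leq => ->; rewrite andbT.
    by apply: hlev; have := hk.1 e he; rewrite /=; lia.
  have := hdsm hc hsafe (tau_min hsplit).
  rewrite gdel_gdel; congr C; apply: gdel_eq; congr (_ :\: _); apply/setP => a.
  by rewrite !inE -hsplit (take_nth set0 hi) mem_rcons inE orbC.
exists k0; split=> // i hi; rewrite /level_graph /=.
pose j := count (fun a => om a < i) tau.
have hset : [set a in gE G | om a < i] = [set a in take j tau].
  apply/setP => a; rewrite !inE -(filter_take i tau_sorted) mem_filter andbC.
  by rewrite tau_mem.
rewrite hset; have [hj|hj] := posnP j.
  by rewrite hj take0 gdel_none //; apply/setP => a; rewrite !inE andbF.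
by apply: hs; rewrite hj count_size.
Qed.
End Levels.

(** * Encodings *)

Section Encoding.
Variables (G : graph) (om : {set 'I_(gV G)} -> nat) (es : seq ('I_(gV G) * 'I_(gV G))).
Let sets : seq {set 'I_(gV G)} := [seq [set q.1; q.2] | q <- es].
Hypothesis es_perm : perm_eq sets (enum (gE G)).

Let m := size es.
Let ts : seq (nat * nat * nat) := [seq (val q.1, val q.2, om [set q.1; q.2]) | q <- es].
Let u e := (nth (0, 0, 0) ts e).1.1.
Let v e := (nth (0, 0, 0) ts e).1.2.
Let w e := (nth (0, 0, 0) ts e).2.
Let E i := nth set0 sets i.

Let sets_size : size sets = m. Proof. exact: size_map. Qed.

Lemma edge_at i : i < m -> exists a b : 'I_(gV G),
  [/\ E i = [set a; b], u i = a, v i = b, w i = om (E i) & a != b].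
Proof.
move=> hi; have [q0 _] : exists q0 : 'I_(gV G) * 'I_(gV G), true.
  by move: hi; rewrite /m; case: (es) => // q0 _ _; exists q0.
rewrite /E /u /v /w !(nth_map q0) //; set q := nth q0 es i.
exists q.1, q.2; split=> //.
have : [set q.1; q.2] \in gE G.
  by rewrite -mem_enum -(perm_mem es_perm); apply/mapP; exists q => //; apply: mem_nth.
by move=> /(implyP (forallP (gE_wf G) _)); rewrite cards2; case: (_ != _).
Qed.

Lemma edge_in i : i < m -> E i \in gE G.
Proof. by move=> hi; rewrite -mem_enum -(perm_mem es_perm) mem_nth ?sets_size. Qed.

Lemma edge_inj i j : i < m -> j < m -> E i = E j -> i = j.
Proof.
move=> hi hj /eqP; rewrite nth_uniq ?sets_size //; first by move/eqP.
by rewrite (perm_uniq es_perm) enum_uniq.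
Qed.

Lemma edges_ends i (a b : 'I_(gV G)) : i < m -> a != b ->
  ends u v a b i <-> E i = [set a; b].
Proof.
move=> hi hab; rewrite /ends; have [c [d [-> -> -> _ hcd]]] := edge_at hi; rewrite !val_eqE; split.
  by case/orP=> /andP [/eqP -> /eqP ->] //; rewrite setUC.
move=> h; have hc : c \in [set a; b] by rewrite -h !inE eqxx.
have hd : d \in [set a; b] by rewrite -h !inE eqxx orbT.
move: hc hd hcd; rewrite !inE => /orP [] /eqP -> /orP [] /eqP ->; rewrite ?eqxx ?orbT //.
Qed.

Lemma edges_loopless i : i < m -> u i != v i.
Proof. by move=> hi; have [a [b [_ -> -> _ h]]] := edge_at hi; rewrite val_eqE. Qed.

Lemma edges_lt i : i < m -> u i < gV G /\ v i < gV G.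
Proof. by move=> hi; have [a [b [_ -> -> _ h]]] := edge_at hi; split. Qed.

Lemma edges_simple i j x y : i < m -> j < m -> ends u v x y i -> ends u v x y j -> i = j.
Proof.
move=> hi hj he hf; have [a [b [_ ha hb _ hab]]] := edge_at hi.
have {he} [[ex ey]|[ex ey]] : (x = a /\ y = b) \/ (x = b /\ y = a).
- by case/orP: he => /andP [/eqP -> /eqP ->]; rewrite ha hb; [left | right].
- subst x y; apply: edge_inj => //.
  by rewrite (proj1 (edges_ends hi hab)) ?(proj1 (edges_ends hj hab)) // /ends ha hb !eqxx.
- subst x y; rewrite eq_sym in hab; apply: edge_inj => //.
  by rewrite (proj1 (edges_ends hi hab)) ?(proj1 (edges_ends hj hab)) // /ends ha hb !eqxx orbT.
Qed.

Section Order.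
Variables (T : nat) (tt kd : nat -> nat).
Hypothesis sched : forall e, e < m -> 0 < tt e <= T /\ scheduled m u v w tt kd e.
Variable ord : seq nat.
Hypothesis ord_perm : perm_eq ord (iota 0 m).
Hypothesis ord_sorted : pairwise (lexi w (lexi tt (lexi kd (fun _ _ => true)))) ord.

Let tau := [seq E i | i <- ord].

Lemma order_edges : edge_ordering tau.
Proof.
apply: perm_trans es_perm.
have <- : [seq E i | i <- iota 0 m] = sets by rewrite -sets_size -/(mkseq _ _) mkseq_nth.
exact: perm_map.
Qed.

Let ord_lt i : i \in ord -> i < m. Proof. by rewrite (perm_mem ord_perm) mem_iota. Qed.

Lemma order_weights : pairwise (fun a b => om a <= om b) tau.
Proof.
rewrite /tau pairwise_map; apply: (sub_in_pairwise (P := [pred i | i < m])) ord_sorted.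
  move=> i j hi hj; have [_ [_ [_ _ _ wi _]]] := edge_at hi; have [_ [_ [_ _ _ wj _]]] := edge_at hj.
  by rewrite /= -wi -wj /lexi; lia.
by apply/allP => i /ord_lt.
Qed.

Lemma order_deg p q (z : 'I_(gV G)) : ord = p ++ q ->
  @deg (gdel G [set a in [seq E i | i <- p]]) z = count (inc u v z) q.
Proof.
move=> hs; have ht : tau = [seq E i | i <- p] ++ [seq E i | i <- q] by rewrite /tau hs map_cat.
have hu : uniq tau by rewrite (perm_uniq order_edges) enum_uniq.
have hmem a : (a \in gE G) = (a \in [seq E i | i <- p]) || (a \in [seq E i | i <- q]).
  by rewrite -mem_enum -(perm_mem order_edges) ht mem_cat.
move: hu; rewrite ht cat_uniq => /and3P [_ /hasPn hd hq].
rewrite /deg /= (_ : [set a in _ | _] = [set a | a \in [seq a : {set 'I_(gV G)} <- [seq E i | i <- q] | z \in a]]); last first.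
  apply/setP => a; rewrite !inE mem_filter hmem andbC; congr (_ && _).
  case hap: (a \in [seq E i | i <- p]) => //=.
  by apply/esym/negP => haq; have := hd a haq; rewrite /= hap.
rewrite cardsE (card_uniqP _) ?filter_uniq // size_filter count_map.
apply: eq_in_count => i hi /=; have him : i < m by apply: ord_lt; rewrite hs mem_cat hi orbT.
by rewrite /inc; have [a [b [-> -> -> _ _]]] := edge_at him; rewrite !inE !val_eqE.
Qed.

Lemma order_degree_minimal p e q : tau = p ++ e :: q ->
  @degree_minimal (gdel G [set a in p]) [set a in e :: q | om a == om e] e.
Proof.
move=> hs; pose i := nth 0 ord (size p).
have hsz : size p < size ord by rewrite -(size_map E) -/tau hs size_cat /=; lia.
have ho : ord = take (size p) ord ++ i :: drop (size p).+1 ord.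
  by rewrite -(drop_nth 0 hsz) cat_take_drop.
have hp : p = [seq E j | j <- take (size p) ord] by rewrite map_take -/tau hs take_size_cat.
have hq : e :: q = [seq E j | j <- i :: drop (size p).+1 ord].
  by rewrite -(drop_nth 0 hsz) map_drop -/tau hs drop_size_cat.
set P := take _ _ in ho hp; set Q := drop _ _ in ho hq.
have he : e = E i by case: hq.
have him : i < m by apply/ord_lt/mem_nth.
have hw j : j < m -> w j = om (E j) by move=> hj; have [c [d [_ _ _ -> _]]] := edge_at hj.
have hQm j : j \in i :: Q -> j < m by move=> hj; apply: ord_lt; rewrite ho mem_cat hj orbT.
have [x [y [hxy h1 h2]]] :=
  order_minimal edges_loopless edges_simple sched ord_perm ord_sorted ho.
have hF f : f \in [set a in e :: q | om a == om e] -> exists j, [/\ f = E j, j \in i :: Q & w j = w i].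
  rewrite !inE -in_cons hq => /andP [/mapP [j hj ->]] /eqP hom.
  by exists j; split=> //; rewrite (hw _ (hQm j hj)) (hw _ him) -he.
split; first by rewrite !inE !eqxx.
have [a [b [hE ha hb _ hab]]] := edge_at him.
have [U [V [hUV hU hV]]] : exists U V : 'I_(gV G), [/\ U != V, x = U & y = V].
  case/orP: hxy => /andP [/eqP -> /eqP ->]; rewrite ha hb; first by exists a, b.
  by exists b, a; rewrite eq_sym.
exists U, V; split; first by rewrite he; apply/(edges_ends him hUV); rewrite -hU -hV.
rewrite hp; split.
- move=> f z /hF [j [-> hj hwj]] hz; rewrite !(order_deg _ ho) -hU; apply: (h1 j) => //.
  by move: hz; rewrite /inc; have [c [d [-> -> -> _ _]]] := edge_at (hQm j hj); rewrite !inE !val_eqE.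
- move=> z /hF [j [hz hj hwj]]; rewrite !(order_deg _ ho) -hV; apply: (h2 j) => //.
  rewrite hU; apply/edges_ends => //; first exact: hQm.
  (* A [z] equal to [U] would make the pair a singleton, which is not an edge. *)
  apply/eqP => hUz; have [c [d [hc _ _ _ hcd]]] := edge_at (hQm j hj).
  by have := congr1 (fun A : {set _} => #|A|) hz; rewrite hUz setUid cards1 hc cards2 hcd.
Qed.
End Order.
End Encoding.

(** Weights are surjective, so distinct weights need distinct edges. This keeps weights within the
    input size, where they can index tables. *)
Lemma k_weighted_bound k x : k_weighted k x -> k <= #|gE (projT1 x)|.
Proof.
move=> [_ h]; rewrite cardE -(size_map (projT2 x)) -(size_iota 1 k).
apply: uniq_leq_size; first exact: iota_uniq.
move=> i; rewrite mem_iota add1n ltnS => /h [e he <-].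
by apply: map_f; rewrite mem_enum.
Qed.

Lemma enc_wgraph_in_size x s : is_weighted x -> enc_wgraph x s -> reads_in_size s.
Proof.
move=> [k hk] [es [-> hp]] a; have hkm := k_weighted_bound hk.
have hsz : size es = #|gE (projT1 x)| by rewrite cardE -(perm_size hp) size_map.
rewrite /in_size /= (size_flatten_width (w := 3)) // !inE => /or3P [/eqP ->|/eqP ->|].
- by lia.
- by lia.
- move=> /flattenP [l /mapP [q hq ->]]; rewrite !inE => /or3P [] /eqP ->.
  + by have := ltn_ord q.1; rewrite /=; lia.
  + by have := ltn_ord q.2; rewrite /=; lia.
  + have he : [set q.1; q.2] \in gE (projT1 x).
      by rewrite -mem_enum -(perm_mem hp); apply/mapP; exists q.
    have /andP [_ hw] := hk.1 _ he; rewrite -hsz in hkm.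
    by apply: leq_trans hw (leq_trans hkm _); lia.
Qed.

Lemma enc_edges_in_size n (es : seq ('I_n * 'I_n)) :
  reads_in_size [:: n, size es & flatten [seq [:: val q.1; val q.2] | q <- es]].
Proof.
move=> a; rewrite /in_size /= (size_flatten_width (w := 2)) // !inE.
move=> /or3P [/eqP ->|/eqP ->|]; try by lia.
move=> /flattenP [l /mapP [q hq ->]]; rewrite !inE => /orP [] /eqP ->.
- by have := ltn_ord q.1; rewrite /=; lia.
- by have := ltn_ord q.2; rewrite /=; lia.
Qed.

Lemma weigh_out_map T (f : nat -> nat) (es : seq T) (a b c : T -> nat) :
  mkseq f (size es) = [seq c q | q <- es] ->
  weigh_out f [seq (a q, b q) | q <- es] = [seq [:: a q; b q; c q] | q <- es].
Proof.
by move=> h; rewrite /weigh_out size_map h zip_map -map_comp.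
Qed.

(** In an edgeless graph the constant weighting is surjective only for [k = 0], and level 1 is the
    only level. Otherwise level 2 is the edgeless graph, which groundedness puts in [C]. *)
Lemma level_class_one (C : gclass) G : grounded C ->
  is_weighted (existT _ G (fun=> 1)) /\ (C G <-> level_class C (existT _ G (fun=> 1))).
Proof.
move=> hg; pose x : wgraph := existT _ G (fun=> 1).
have l1 : level_graph x 1 = G.
  by rewrite /level_graph gdel_none //; apply/setP => e; rewrite !inE /= andbF andbF.
have [h0|[e he]] := set_0Vmem (gE G).
  have hx : k_weighted 0 x by split=> [e|i]; rewrite /= ?h0 ?inE //; lia.
  split; first by exists 0.
  split=> [hG|[k [_ h]]]; last by have := h 1 isT; rewrite -/x l1.
  exists 0; split=> // i hi; have -> : i = 1 by lia.
  by rewrite l1.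
have hx : k_weighted 1 x.
  split=> [f _|i hi] //=; exists e => //; lia.
split; first by exists 1.
split=> [hG|[k [_ h]]]; last by have := h 1 isT; rewrite -/x l1.
exists 1; split=> // i hi; have [->|->] : i = 1 \/ i = 2 by lia.
  by rewrite l1.
suff -> : level_graph x 2 = gdel G (gE G) by apply: hg.
by apply: gdel_eq; apply/setP => f; rewrite /= !inE andbT.
Qed.

(** The edge at position [i], counted from 0, weighs [i + 1], so level [i + 1] deletes exactly the
    first [i] edges. Level 1 is [G], in [C] by the domain of the ordering problem. *)
Lemma level_class_rank (C : gclass) G (tau : seq {set 'I_(gV G)}) :
  C G -> edge_ordering tau ->
  let x : wgraph := existT _ G (fun e => (index e tau).+1) in
  is_weighted x /\ (safe_elim_scheme C tau <-> level_class C x).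
Proof.
move=> hG ho x.
have hmem e : (e \in gE G) = (e \in tau) by rewrite (perm_mem ho) mem_enum.
have hu : uniq tau by rewrite (perm_uniq ho) enum_uniq.
have hx : k_weighted (size tau) x.
  split=> [e|i hi] /=; first by rewrite hmem index_mem.
  have hi' : i.-1 < size tau by lia.
  exists (nth set0 tau i.-1); first by rewrite hmem mem_nth.
  by rewrite index_uniq //; lia.
have hl i : level_graph x i.+1 = gdel G [set e in take i tau].
  apply: gdel_eq; apply/setP => e; rewrite /= !inE.
  by case he: (e \in gE G); rewrite ?andbF // !andbT ltnS in_take -?hmem.
split; first by exists (size tau).
split=> [[_ hs]|[k [hk hs]]].
  exists (size tau); split=> // -[|i] // hi; rewrite hl.
  have [->|hi0] := posnP i; last by apply: hs; lia.
  by rewrite take0 gdel_none //; apply/setP => e; rewrite !inE andbF.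
split=> // i /andP [_ hi]; rewrite -hl; apply: hs; rewrite ltnS /=.
case: i hi => // i hi; rewrite ltnS; have hm : nth set0 tau i \in gE G by rewrite hmem mem_nth.
by have := hk.1 _ hm; rewrite /= index_uniq // => /andP [].
Qed.

Lemma sorted_edges_perm es tt kd T : let m := size es in
  (forall i, i < m -> (nth (0, 0, 0) es i).2 <= m) ->
  (forall i, i < m -> tt i <= T) -> (forall i, i < m -> kd i <= m) ->
  perm_eq (sorted_edges es tt kd T) (iota 0 m).
Proof.
move=> m hw ht hk.
have p1 : perm_eq (dist m.+1 kd (iota 0 m)) (iota 0 m).
  by apply: dist_perm => e; rewrite mem_iota => he; rewrite ltnS hk.
have p2 : perm_eq (dist T.+1 tt (dist m.+1 kd (iota 0 m))) (iota 0 m).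
  apply: perm_trans (p1); apply: dist_perm => e.
  by rewrite (perm_mem p1) mem_iota => he; rewrite ltnS ht.
apply: perm_trans (p2); apply: dist_perm => e.
by rewrite (perm_mem p2) mem_iota => he; rewrite ltnS hw.
Qed.

Lemma sorted_edges_sorted es tt kd T :
  pairwise (lexi (fun i => (nth (0, 0, 0) es i).2) (lexi tt (lexi kd (fun _ _ => true))))
    (sorted_edges es tt kd T).
Proof.
do 3 apply: dist_pairwise.
by elim: (iota _ _) => //= a l ->; rewrite andbT; apply/allP.
Qed.

(** * Equivalence of the recognition problems *)

Theorem theorem3p1 (C : gclass) (hground : grounded C)
    (hdsm : degree_sandwich_monotone C) :
  (exists p, lin_time_decides enc_wgraph is_weighted (level_class C) p) <->
  ((exists p, lin_time_decides enc_graph (fun _ => True) C p) /\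
   (exists p, lin_time_decides enc_ordering
                (fun x : ordgraph => C (projT1 x) /\ edge_ordering (projT2 x))
                (fun x : ordgraph => safe_elim_scheme C (projT2 x)) p)).
Proof.
split=> [[p hp]|[[p1 hp1] [p2 hp2]]].
- split.
  + apply: (@reduction graph wgraph unit enc_graph enc_wgraph _ _ _ _ _ _ _ p accept
      (weigh_code [:: Cst 25 1]) 40 hp accept_decides isT) => G _ _ [es [-> hes]].
    split; first exact: enc_edges_in_size.
    have [hw hl] := level_class_one G hground.
    pose esn := [seq (val q.1, val q.2) | q <- es].
    have hin : [seq [:: val q.1; val q.2] | q <- es] = [seq [:: q.1; q.2] | q <- esn].
      by rewrite -map_comp.
    have hsz : size es = size esn by rewrite size_map.
    have hout : weigh_out (fun=> 1) esn = [seq [:: val q.1; val q.2; 1] | q <- es].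
      have cst U (s : seq U) : [seq 1 | _ <- s] = nseq (size s) 1 by elim: s => //= _ s ->.
      by apply: weigh_out_map; rewrite /mkseq !cst size_iota.
    exists (existT _ G (fun=> 1)), tt, [:: gV G, size es & flatten (weigh_out (fun=> 1) esn)], [::].
    split=> //.
    * by split=> //; exists es; split=> //; rewrite hout.
    * have h3 := @size_flatten_width _ (fun q => [:: val q.1; val q.2; 1]) 3 es (fun=> erefl).
      have h2 := @size_flatten_width _ (fun q : 'I_(gV G) * 'I_(gV G) => [:: val q.1; val q.2]) 2 es (fun=> erefl).
      by rewrite hout /in_size /= h2 h3; move: (gV G) (size es) => a b; split; lia.
    * by rewrite hl; split=> [|[]].
    * by rewrite hin hsz; apply: weigh_ok weighs_one.
  + apply: (@reduction ordgraph wgraph unit enc_ordering enc_wgraph _ _ _ _ _ _ _ p accept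
      (weigh_code [:: Mov 25 10; Inc 25]) 40 hp accept_decides isT) => -[G tau] _ [/= hG ho] [/= es [-> hes]].
    split; first exact: enc_edges_in_size.
    have [hw hl] := level_class_rank hG ho.
    pose om e := (index e tau).+1.
    pose esn := [seq (val q.1, val q.2) | q <- es].
    have hin : [seq [:: val q.1; val q.2] | q <- es] = [seq [:: q.1; q.2] | q <- esn].
      by rewrite -map_comp.
    have hsz : size es = size esn by rewrite size_map.
    have hu : uniq tau by rewrite (perm_uniq ho) enum_uniq.
    have hst : size tau = size es by rewrite -hes size_map.
    have hout : weigh_out S esn = [seq [:: val q.1; val q.2; om [set q.1; q.2]] | q <- es].
      apply: weigh_out_map; apply: (@eq_from_nth _ 0); rewrite ?size_mkseq ?size_map // => i hi.
      rewrite nth_mkseq // (map_comp om (fun q => [set q.1; q.2])) hes (nth_map set0) ?hst //.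
      by rewrite /om index_uniq ?hst.
    exists (existT _ G om), tt, [:: gV G, size es & flatten (weigh_out S esn)], [::].
    split=> //.
    * split=> //; exists es; split=> /=; first by rewrite hout.
      by rewrite hes.
    * have h3 := @size_flatten_width _ (fun q => [:: val q.1; val q.2; om [set q.1; q.2]]) 3 es (fun=> erefl).
      have h2 := @size_flatten_width _ (fun q : 'I_(gV G) * 'I_(gV G) => [:: val q.1; val q.2]) 2 es (fun=> erefl).
      by rewrite hout /in_size /= h2 h3; move: (gV G) (size es) => a b; split; lia.
    * by rewrite hl; split=> [|[]].
    * by rewrite hin hsz; apply: weigh_ok weighs_rank.
(* The first output is the graph stripped of its weights, for the recognizer; the second lists the
   same edges in the computed order. *)
- apply: (@reduction wgraph graph ordgraph enc_wgraph enc_graph enc_ordering _ _ _ _ _ _ p1 p2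
      order_code 1300 hp1 hp2 isT) => -[G om] s hx hs.
  split; first exact: enc_wgraph_in_size hx hs.
  have [es [-> hes]] := hs; rewrite /= in es hes *.
  pose ts := [seq (val q.1, val q.2, om [set q.1; q.2]) | q <- es].
  have hin : [seq [:: val q.1; val q.2; om [set q.1; q.2]] | q <- es] =
      [seq [:: q.1.1; q.1.2; q.2] | q <- ts] by rewrite -map_comp.
  have hsz : size ts = size es by rewrite size_map.
  have w_bound i : i < size ts -> 0 < (nth (0, 0, 0) ts i).2 <= size ts.
    have [k hk] := hx; rewrite hsz => hi; have [a [b [_ _ _ -> _]]] := edge_at om hes hi.
    have := hk.1 _ (edge_in hes hi) => /= /andP [-> hw]; apply: leq_trans hw _.
    have := k_weighted_bound hk; rewrite /= cardE -(perm_size hes) size_map; exact.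
  have u_lt i : i < size ts -> (nth (0, 0, 0) ts i).1.1 < gV G.
    by rewrite hsz => hi; have [] := edges_lt om hes hi.
  have v_lt i : i < size ts -> (nth (0, 0, 0) ts i).1.2 < gV G.
    by rewrite hsz => hi; have [] := edges_lt om hes hi.
  have w_le i : i < size ts -> (nth (0, 0, 0) ts i).2 <= size ts.
    by move=> hi; have /andP [] := w_bound i hi.
  have loopless i : i < size ts -> (nth (0, 0, 0) ts i).1.1 != (nth (0, 0, 0) ts i).1.2.
    by rewrite hsz; apply: edges_loopless.
  have simple i j x y : i < size ts -> j < size ts ->
      ends (fun e => (nth (0, 0, 0) ts e).1.1) (fun e => (nth (0, 0, 0) ts e).1.2) x y i ->
      ends (fun e => (nth (0, 0, 0) ts e).1.1) (fun e => (nth (0, 0, 0) ts e).1.2) x y j -> i = j.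
    by rewrite hsz; apply: edges_simple.
  have [s' hex [tm [kd [T [hsch hout ht]]]]] := order_ok u_lt v_lt w_le loopless simple.
  have operm : perm_eq (sorted_edges ts tm kd T) (iota 0 (size es)).
    rewrite -hsz; apply: sorted_edges_perm => // i hi; have [/andP [_ h1] h2] := hsch i hi => //.
    by have [x [y [_ _ _ -> _]]] := h2; apply: ldeg_max.
  have osort := sorted_edges_sorted ts tm kd T.
  set ord := sorted_edges ts tm kd T in operm osort hout *.
  pose tau := [seq nth set0 [seq [set q.1; q.2] | q <- es] i | i <- ord].
  have htau : @edge_ordering G tau by apply: order_edges.
  rewrite hsz in hsch.
  exists G, (existT _ G tau), [:: gV G, size es & flatten [seq [:: q.1.1; q.1.2] | q <- ts]],
    [:: gV G, size es & flatten [seq [:: (nth (0, 0, 0) ts e).1.1; (nth (0, 0, 0) ts e).1.2] | e <- ord]].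
  split.
  + by split=> //; exists es; split=> //; rewrite -map_comp.
  + split=> //.
    (* The computed order lists edge numbers, [es'] the corresponding pairs of vertices; quantifying
       over [F] and [H] yields both the numerical encoding and the sets of endpoints. The case
       analysis on [es] provides a default pair, which need not exist for a graph without
       vertices. *)
    have [q0 hq0] : exists es' : seq ('I_(gV G) * 'I_(gV G)),
        forall (A : Type) (F : nat -> A) (H : 'I_(gV G) * 'I_(gV G) -> A),
        (forall i q0, i < size es -> F i = H (nth q0 es i)) ->
        [seq F i | i <- ord] = [seq H q | q <- es'].
      case: (es) operm => [|q0 es'] operm.
        by exists [::] => A F H _; move/perm_size: operm => /= /size0nil ->.
      exists [seq nth q0 (q0 :: es') i | i <- ord] => A F H h; rewrite -map_comp.
      by apply/eq_in_map => i; rewrite (perm_mem operm) mem_iota => hi; apply: h.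
    exists q0; split=> /=.
      have hs0 : size q0 = size es.
        have := congr1 size (hq0 unit (fun=> tt) (fun=> tt) (fun _ _ _ => erefl)).
        by rewrite !size_map => <-; rewrite (perm_size operm) size_iota.
      rewrite hs0; congr [:: _, _ & flatten _]; apply: hq0 => i q hi.
      by rewrite /ts (nth_map q).
    by symmetry; apply: hq0 => i q hi; rewrite (nth_map q).
  + have h2 := @size_flatten_width _ (fun q : nat * nat * nat => [:: q.1.1; q.1.2]) 2 ts (fun=> erefl).
    have h2' := @size_flatten_width _ (fun e => [:: (nth (0, 0, 0) ts e).1.1; (nth (0, 0, 0) ts e).1.2])
      2 ord (fun=> erefl).
    have ho : size ord = size es by rewrite (perm_size operm) size_iota.
    have h3 := @size_flatten_width _ (fun q : 'I_(gV G) * 'I_(gV G) =>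
      [:: val q.1; val q.2; om [set q.1; q.2]]) 3 es (fun=> erefl).
    by rewrite /in_size /= h2 h2' h3 ho hsz; move: (gV G) (size es) => a b; split; lia.
  + apply: (level_elim hdsm htau _ _ hx).
      exact: (order_weights hes operm osort).
    move=> p e q; exact: (order_degree_minimal hes hsch operm osort).
  + by rewrite hin -hsz; exists s'.
Qed.
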